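(* Let $0<\alpha\le0.2$. There is a constant $c_2$ depending on $\alpha$ only such that $$E_fL(\mathrm{CI}^c_* )\ \le\ c_2\,L^*_\alpha(f,F_c)$$ for all convex functions $f\in F_c$. For example, $c_2$ can be taken to be $24$ for $\alpha=0.05$ and $19$ for $\alpha=0.01$.
   Context: White noise model: one observes $Y$ with $dY(t)=f(t)\,dt+n^{-1/2}\,dW(t)$, $-\frac12\le t\le\frac12$, where $W$ is standard Brownian motion and $n>0$ is known (the constant $c_2$ does not depend on $n$). $E_f$ denotes expectation when the true function is $f$. $F_c$ is the collection of all convex functions on $[-\frac12,\frac12]$. $z_\alpha=\Phi^{-1}(1-\alpha)$ with $\Phi$ the standard normal cdf. $\mathcal{I}_\alpha(F_c)$ is the collection of all confidence intervals based on $Y$ which cover $f(0)$ with probability at least $1-\alpha$ for every $f\in F_c$, and $L^*_\alpha(f,F_c)=\inf_{\mathrm{CI}\in\mathcal{I}_\alpha(F_c)}E_f(L(\mathrm{CI}))$, where $L(\mathrm{CI})$ is the length of $\mathrm{CI}$. For integers $j\ge1$ let $$\delta_j=2^{j-1}\bigl(Y(2^{-j})-Y(-2^{-j})\bigr),\qquad \sigma_j^2=\frac{2^{j-1}}{n},\qquad T_j=\delta_j-\delta_{j+1},$$ and for $0<\beta<1$ $$\mathrm{CI}^c_j(\beta)=\bigl[2\delta_{j+1}-\delta_j-z_{\beta/2}\sqrt5\,\sigma_j,\ \delta_{j+1}+z_{\beta/2}\,\sigma_{j+1}\bigr],$$ with the convention that the interval is the empty set if the left endpoint exceeds the right endpoint;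 its length is thus $\max(\delta_j-\delta_{j+1}+(\sqrt5+\sqrt2)z_{\beta/2}\sigma_j,\,0)$. Let $$\hat j=\inf\{j\ge1:\ T_j\le z_\alpha\sigma_j\},\qquad \mathrm{CI}^c_*=\mathrm{CI}^c_{\hat j}\Bigl(\frac{\alpha}{6}\Bigr).$$ *)

(* Defs.v *)
From HB Require Import structures.
From mathcomp Require Import all_boot all_order all_algebra.
From mathcomp Require Import all_classical all_reals all_analysis.

Set Implicit Arguments.
Unset Strict Implicit.
Unset Printing Implicit Defensive.

Import Order.TTheory GRing.Theory Num.Theory.
Import numFieldNormedType.Exports.

Local Open Scope classical_set_scope.
Local Open Scope ring_scope.

Section Gaussian.
Variable R : realType.

Definition std_normal_cdf (x : R) : \bar R := normal_prob 0 1 `]-oo, x].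

Definition std_normal_quantile (p : R) : R :=
  get [set x : R | std_normal_cdf x = p%:E].

Definition z_ (a : R) : R := std_normal_quantile (1 - a).

End Gaussian.

Section Model.
Variable R : realType.

Definition obs_interval : set R := `[- 2^-1, 2^-1].

(* Convex functions on the observation interval; the values of f outside the
   interval are never used. *)
Definition Fc : set (R -> R) :=
  [set f | @convex_function R R^o obs_interval f].

(* The sigma-algebra on paths generated by the evaluations at the times of the
   observation interval.  Its trace on the continuous paths is the Borel
   sigma-algebra of C[-1/2, 1/2], and a measurable functional depends only on
   the path restricted to the observation interval. *)
Definition cylinders : set (set (R -> R)) :=
  [set A | exists2 t, obs_interval t &
     exists2 B : set R, measurable B & A = [set y | B (y t)]].

Definition path_space := g_sigma_algebraType cylinders.

Definition mutually_independent d (T : measurableType d) (P : probability T R)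
    (k : nat) (X : 'I_k -> T -> R) : Prop :=
  forall B : 'I_k -> set R, (forall i, measurable (B i)) ->
    P [set w | forall i, B i (X i w)]
    = (\prod_(i < k) P [set w | B i (X i w)])%E.

(* Standard Brownian motion indexed by [-1/2, 1/2], started from 0 at the left
   endpoint; normal_prob takes a standard deviation. *)
Record brownian d (T : measurableType d) (P : probability T R)
    (W : R -> T -> R) : Prop := Brownian {
  brownian_measurable : forall t, obs_interval t -> measurable_fun setT (W t);
  brownian_start : {ae P, forall w, W (- 2^-1) w = 0};
  brownian_continuous :
    {ae P, forall w, {within obs_interval, continuous (W ^~ w)}};
  brownian_gaussian : forall s t, obs_interval s -> obs_interval t -> s < t ->
    forall B : set R, measurable B ->
      P [set w | B (W t w - W s w)] = normal_prob 0 (Num.sqrt (t - s)) B;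
  brownian_independent : forall (k : nat) (t : nat -> R),
    (forall i, (i <= k)%N -> obs_interval (t i)) ->
    (forall i, (i < k)%N -> t i < t i.+1) ->
    mutually_independent P (fun (i : 'I_k) w => W (t i.+1) w - W (t i) w)
}.

(* Solution of dY = f dt + n^(-1/2) dW normalised by Y(-1/2) = 0. *)
Definition observation (T : Type) (n : R) (W : R -> T -> R) (f : R -> R)
    (w : T) : path_space :=
  fun t => \int[lebesgue_measure]_(s in `[- 2^-1, t]) f s
           + (Num.sqrt n)^-1 * W t w.

(* The length of an interval is its Lebesgue measure: 0 for the empty interval,
   +oo for an unbounded one. *)
Definition expected_length d (T : measurableType d) (P : probability T R)
    (n : R) (W : R -> T -> R) (f : R -> R) (C : path_space -> set R) : \bar R :=
  (\int[P]_w lebesgue_measure (C (observation n W f w)))%E.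

(* Random intervals based on Y are the interval-valued functionals of the path
   with a jointly measurable graph, so they may be empty, unbounded, and open
   or closed at either end. *)
Definition I_ (a : R) d (T : measurableType d) (P : probability T R)
    (n : R) (W : R -> T -> R) : set (path_space -> set R) :=
  [set C | [/\ measurable [set yx : path_space * R | C yx.1 yx.2],
    forall y, is_interval (C y) &
    forall g, Fc g ->
      ((1 - a)%:E <= P [set w | C (observation n W g w) (g 0%R)])%E]].

Definition Lstar (a : R) d (T : measurableType d) (P : probability T R)
    (n : R) (W : R -> T -> R) (f : R -> R) : \bar R :=
  ereal_inf [set expected_length P n W f C | C in I_ a P n W].

End Model.

Section Procedure.
Variable R : realType.
Implicit Types (n a b : R) (y : path_space R) (j : nat).

(* The index j is at least 1 throughout. *)
Definition delta y j : R := 2 ^+ j.-1 * (y (2 ^- j) - y (- 2 ^- j)).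

Definition sigma n j : R := Num.sqrt (2 ^+ j.-1 / n).

Definition T_ y j : R := delta y j - delta y j.+1.

Definition CIc n b y j : set R :=
  `[2 * delta y j.+1 - delta y j - z_ (b / 2) * Num.sqrt 5 * sigma n j,
    delta y j.+1 + z_ (b / 2) * sigma n j.+1].

Definition stops n a y j : bool := (1 <= j)%N && (T_ y j <= z_ a * sigma n j).

(* ex_minn is the least index at which the procedure stops.  If it never stops,
   an event of probability 0, the interval is the whole line. *)
Definition CIc_star n a y : set R :=
  match pselect (exists j, stops n a y j) with
  | left h => CIc n (a / 6) y (ex_minn h)
  | right _ => setT
  end.

End Procedure.

Definition star_within_factor (R : realType) (a c2 : R) : Prop :=
  forall (n : R), 0 < n ->
  forall (d : measure_display) (T : measurableType d) (P : probability T R)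
    (W : R -> T -> R), brownian P W ->
  forall f : R -> R, Fc f ->
    (expected_length P n W f (CIc_star n a) <= c2%:E * Lstar a P n W f)%E.

(* Main.v *)
Require Import Defs.
From HB Require Import structures.
From mathcomp Require Import all_boot all_order all_algebra.
From mathcomp Require Import all_classical all_reals all_analysis.
From mathcomp Require Import measurable_realfun.
From mathcomp Require unstable.
From mathcomp Require Import ring lra zify.

Set Implicit Arguments.
Unset Strict Implicit.
Unset Printing Implicit Defensive.

Import Order.TTheory GRing.Theory Num.Theory.
Import numFieldNormedType.Exports.

Local Open Scope classical_set_scope.
Local Open Scope ring_scope.

(** Validity at f + t c forces a confidence interval, under f, to contain
    f(0) + t c(0) with probability at least P(N > t e - z_alpha), where N is standard
    normal and e^2 bounds n times the integral of c^2. This is the Neyman-Pearson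
    comparison for a Gaussian shift, made on events depending on finitely many
    increments and extended to all events by approximation. Integrating over t gives
    L* >= c(0) z_alpha / e.

    Let J be the first scale at which E T_J <= z_alpha sigma_J. For J >= 2 take for c
    the excess over f of the maximum of f and its chord over [-h, h], h = 2^(1-J): by
    convexity c(0) >= 2 E T_(J-1) > 2 z_alpha sigma_(J-1), while the integral of c^2
    is at most (8/3) h c(0)^2, so L* >= (sqrt 3 / 2) z_alpha sigma_(J-1). For J = 1
    take c constant.

    Conversely E T_j is nonincreasing in j by convexity. So if the procedure is still
    running after the scales J, ..., J+m-1, the noises of delta_J, ..., delta_(J+m)
    decrease, which has probability at most 2^-m. As sigma_(J+m) = 2^(m/2) sigma_J,
    the expected length is at most (1 + 1/sqrt 2)(K + z_alpha) sigma_J with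
    K = (sqrt 5 + sqrt 2) z_(alpha/12). *)

(** * Pushforwards, densities and affine changes of variables *)

(** A confidence interval is an arbitrary measurable functional of the path, and no likelihood ratio
    on path space is constructed. On a finite grid the two laws differ by a Gaussian shift of norm
    at most e, by Cauchy-Schwarz. An event is approximated under both laws at once, and the error is
    amplified by at most exp(|z| e) whatever the grid, so the bound survives the limit. In the lower
    bound the height of the cap cancels: e is proportional to c(0) / sigma, so c(0) z / e depends on
    z and sigma alone. The size of c(0) only ensures e >= 2 z, which keeps the shifts t = (u + z) /
    e with |u| <= z inside [0, 1]. In the upper bound the averages over nested intervals are
    dependent. Doubling an interval adds as much length as it had, so the new noise is the mean of
    the old one and an independent copy; their difference is symmetric and independent of their
    mean, and each further scale costs a factor 1/2. Lengths grow only by sqrt 2 per scale, so the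
    expected length is a convergent series. *)

Section ImageLaw.
Context d d' (T1 : measurableType d) (T2 : measurableType d') (R : realType).

Definition image_law (m : set T1 -> \bar R) (f : T1 -> T2)
  (mf : measurable_fun [set: T1] f) : set T2 -> \bar R := pushforward m f.

Section Measure.
Variables (m : {measure set T1 -> \bar R}) (f : T1 -> T2).
Variable mf : measurable_fun [set: T1] f.

HB.instance Definition _ := Measure.copy (image_law m mf)
  (measure_function_pushforward__canonical__measure_function_Measure m mf).

Lemma ge0_integral_image_law (F : T2 -> \bar R) :
  measurable_fun [set: T2] F -> (forall y, 0 <= F y)%E ->
  (\int[image_law m mf]_y F y = \int[m]_x F (f x))%E.
Proof. by move=> mF F0; rewrite ge0_integral_pushforward. Qed.
End Measure.

Section Probability.
Variables (P : probability T1 R) (f : T1 -> T2).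
Variable mf : measurable_fun [set: T1] f.

Lemma image_law_setT : image_law P mf [set: T2] = 1%E.
Proof. by rewrite /image_law /pushforward preimage_setT probability_setT. Qed.

HB.instance Definition _ :=
  Measure_isProbability.Build _ _ _ (image_law P mf) image_law_setT.
End Probability.

End ImageLaw.

Section Affine.
Context {R : realType}.
Notation mu := (@lebesgue_measure R).

Lemma measurable_affine (a b : R) :
  measurable_fun [set: R] (fun x : R => a * x + b).
Proof. by apply: measurable_funD => //; apply: measurable_funM. Qed.

(** Lebesgue measure is determined by its values on half-open intervals. For negative a the preimage
    of ]u, v] is closed on the left and open on the right, which does not affect its measure. *)
Lemma lebesgue_measure_affine (a b : R) (A : set R) : a != 0 ->
  measurable A ->
  mu A = (`|a|%:E * mu ((fun x => a * x + b)%R @^-1` A))%E.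
Proof.
move=> a0 mA; pose k : {nonneg R} := NngNum (normr_ge0 a).
have mf : measurable_fun [set: R] (fun x : R => a * x + b : measurableTypeR R).
  exact: measurable_affine.
suff -> : mu A = mscale k (image_law mu mf) A by [].
apply: lebesgue_measure_unique => //= X /ocitvP[->|[[u v]/= uv ->]].
  by rewrite !measure0.
rewrite /mscale /= /image_law /pushforward.
have [a1|a1] := ltP 0 a.
  rewrite (_ : _ @^-1` _ = `](u - b) / a, (v - b) / a]%classic); last first.
    apply/seteqP; split => x /=; rewrite !in_itv/= ltr_pdivrMr// ler_pdivlMr//;
      by rewrite ltrBlDr lerBrDr (mulrC x).
  rewrite !lebesgue_measure_itv/= !lte_fin uv ltr_pM2r ?invr_gt0// ltrD2r uv.
  rewrite gtr0_norm// -!EFinD -EFinM; congr EFin; field.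
  by rewrite gt_eqF.
have {}a1 : a < 0 by rewrite lt_neqAle a0.
rewrite (_ : _ @^-1` _ = `[(v - b) / a, (u - b) / a[%classic); last first.
  apply/seteqP; split => x /=; rewrite !in_itv/= ler_ndivrMr// ltr_ndivlMr//;
    by rewrite ltrBlDr lerBrDr (mulrC x) andbC.
rewrite !lebesgue_measure_itv/= !lte_fin uv ltr_nM2r ?invr_lt0// ltrD2r uv.
rewrite ltr0_norm// -!EFinD -EFinM; congr EFin; field.
by rewrite lt_eqF.
Qed.

Lemma ge0_integral_affine (F : R -> \bar R) (a b : R) : a != 0 ->
  measurable_fun [set: R] F -> (forall x, 0 <= F x)%E ->
  (\int[mu]_x F x = `|a|%:E * \int[mu]_x F (a * x + b)%R)%E.
Proof.
move=> a0 mF F0; pose k : {nonneg R} := NngNum (normr_ge0 a).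
have mf : measurable_fun [set: R] (fun x : R => a * x + b : measurableTypeR R).
  exact: measurable_affine.
transitivity (\int[mscale k (image_law mu mf)]_x F x)%E.
  by apply: eq_measure_integral => A mA _; exact: lebesgue_measure_affine.
by rewrite ge0_integral_mscale// ge0_integral_image_law.
Qed.

End Affine.

(* The library's Lebesgue and normal measures live on [measurableTypeR R], whose
   display differs from that of [R]; product measures need copies on [R]. *)
Section CopiesOnR.
Context {R : realType}.

Lemma measurable_id_measurableTypeR :
  measurable_fun [set: measurableTypeR R] (id : measurableTypeR R -> R).
Proof. by []. Qed.

Definition leb : set R -> \bar R :=
  image_law (@lebesgue_measure R) measurable_id_measurableTypeR.

HB.instance Definition _ := Measure.on leb.

Let leb_sigma_finite : sigma_finite setT leb.
Proof. exact: (@sigma_finiteT _ _ _ (@lebesgue_measure R)). Qed.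

HB.instance Definition _ :=
  Measure_isSigmaFinite.Build _ _ _ leb leb_sigma_finite.

Lemma ge0_integral_leb (F : R -> \bar R) : measurable_fun [set: R] F ->
  (forall x, 0 <= F x)%E ->
  (\int[leb]_x F x = \int[lebesgue_measure]_x F x)%E.
Proof. by move=> mF F0; rewrite /leb ge0_integral_image_law. Qed.

Lemma ge0_integral_leb_affine (F : R -> \bar R) (a b : R) : a != 0 ->
  measurable_fun [set: R] F -> (forall x, 0 <= F x)%E ->
  (\int[leb]_x F x = `|a|%:E * \int[leb]_x F (a * x + b)%R)%E.
Proof.
move=> a0 mF F0; rewrite !ge0_integral_leb//; first exact: ge0_integral_affine.
exact: measurableT_comp mF (measurable_affine a b).
Qed.

Definition gauss : set R -> \bar R :=
  image_law (@normal_prob R 0 1) measurable_id_measurableTypeR.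

HB.instance Definition _ := Probability.on gauss.

End CopiesOnR.

Section Density.
Context d (T : measurableType d) (R : realType).
Variables (nu : {finite_measure set T -> \bar R})
          (m : {sigma_finite_measure set T -> \bar R}) (h : T -> \bar R).
Hypothesis mh : measurable_fun [set: T] h.
Hypothesis h0 : forall x, (0 <= h x)%E.
Hypothesis nuE : forall A, measurable A -> nu A = (\int[m]_(x in A) h x)%E.

(** Change of variables holds for the Radon-Nikodym derivative of nu, and h equals that derivative
    almost everywhere because both have the same integral over every measurable set. *)
Lemma ge0_integral_density (F : T -> \bar R) :
  measurable_fun [set: T] F -> (forall x, 0 <= F x)%E ->
  (\int[nu]_x F x = \int[m]_x (F x * h x))%E.
Proof.
move=> mF F0.
have num : nu `<< m.
  apply/null_content_dominatesP => A mA A0; rewrite nuE//.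
  by apply: null_set_integral => //; apply/measurable_funTS.
rewrite -(Radon_Nikodym_SigmaFinite.change_of_variables num)//.
apply: ge0_ae_eq_integral => //.
- apply: emeasurable_funM => //.
  exact: measurable_int (Radon_Nikodym_SigmaFinite.f_integrable _).
- exact: emeasurable_funM.
- by move=> x _; rewrite mule_ge0// Radon_Nikodym_SigmaFinite.f_ge0.
- by move=> x _; rewrite mule_ge0.
- apply: ae_eqe_mul2l; apply: integral_ae_eq => //.
  + exact: Radon_Nikodym_SigmaFinite.f_integrable.
  + move=> E _ mE; rewrite -nuE//.
    by rewrite -Radon_Nikodym_SigmaFinite.f_integral.
Qed.

End Density.

(** * Gaussian integrals *)

Section Rotation.
Context {R : realType}.
Notation mu := (@leb R).
Local Open Scope ereal_scope.

Lemma measurable_lincomb (a b : R) :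
  measurable_fun [set: R * R] (fun p : R * R => (a * p.1 + b * p.2)%R).
Proof.
by apply: measurable_funD; apply: measurable_funM => //.
Qed.

(** A rotation is two one-variable substitutions: with y fixed, x is replaced by a x + b y; then,
    with the new first coordinate fixed, y is rescaled. The factors 1/|a| and |a| cancel. *)
Lemma lebesgue_rotation (J : R * R -> \bar R) (a b : R) :
  a != 0%R -> (a ^+ 2 + b ^+ 2 = 1)%R ->
  measurable_fun [set: R * R] J -> (forall p, 0 <= J p) ->
  \int[mu]_x \int[mu]_y J (a * x + b * y, a * y - b * x)%R =
  \int[mu]_x \int[mu]_y J (x, y).
Proof.
move=> a0 ab mJ J0.
(* The second rotated coordinate in terms of the first; the normalisation of (a, b) enters here. *)
have rot1 (x y : R) : ((y - b * (a * x + b * y)) / a = a * y - b * x)%R.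
  apply: (mulIf a0); rewrite divfK//.
  by rewrite -[X in (X - _)%R](mul1r y) -ab; ring.
have rot2 (x y : R) : ((a * y + b * x - b * x) / a = y)%R by field.
have mJ1 : measurable_fun [set: R * R]
    (fun p : R * R => J (a * p.1 + b * p.2, a * p.2 - b * p.1)%R).
  apply: measurableT_comp => //; apply: measurable_fun_pair => /=.
    exact: measurable_lincomb.
  rewrite (_ : (fun _ => _) = fun p => (- b * p.1 + a * p.2)%R); last first.
    by apply/funext => p /=; rewrite mulNr addrC.
  exact: measurable_lincomb.
have mJ2 : measurable_fun [set: R * R]
    (fun p : R * R => J (p.2, (p.1 - b * p.2) / a)%R).
  apply: measurableT_comp => //; apply: measurable_fun_pair => //=.
  rewrite (_ : (fun _ => _) = fun p => (a^-1 * p.1 + - (b / a) * p.2)%R); last first.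
    by apply/funext => p /=; rewrite mulrBl mulNr mulrAC (mulrC p.1).
  exact: measurable_lincomb.
transitivity (\int[mu]_y \int[mu]_x J (a * x + b * y, a * y - b * x)%R).
  exact: (fubini_tonelli (m1 := mu) (m2 := mu)
    (fun p : R * R => J (a * p.1 + b * p.2, a * p.2 - b * p.1)%R)).
have a1 : (`|a|^-1%:E * `|a|%:E = 1) by rewrite -EFinM mulVf// normr_eq0.
transitivity (\int[mu]_y (`|a|^-1%:E * \int[mu]_x J (x, (y - b * x) / a)%R)).
  apply: eq_integral => y _.
  have -> := ge0_integral_leb_affine (F := fun x => J (x, (y - b * x) / a)%R)
    (b * y) a0 (measurableT_comp mJ2 (pair1_measurable y)) (fun=> J0 _).
  rewrite muleA a1 mul1e; apply: eq_integral => x _; congr (J (_, _)).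
  exact/esym/rot1.
rewrite ge0_integralZl//; last 2 first.
- exact: (measurable_fun_fubini_tonelli_F (m2 := mu)
    (fun p : R * R => J (p.2, (p.1 - b * p.2) / a)%R)).
- by move=> y _; apply: integral_ge0.
transitivity (`|a|^-1%:E *
    \int[mu]_x \int[mu]_y J (x, (y - b * x) / a)%R).
  congr *%E.
  exact: (fubini_tonelli (m1 := mu) (m2 := mu)
    (fun p : R * R => J (p.2, (p.1 - b * p.2) / a)%R)).
rewrite -[RHS]mul1e -a1 -muleA; congr *%E.
rewrite -ge0_integralZl//; last 2 first.
- exact: (measurable_fun_fubini_tonelli_F (m2 := mu) J).
- by move=> y _; apply: integral_ge0.
apply: eq_integral => x _.
have -> := ge0_integral_leb_affine (F := fun y => J (x, (y - b * x) / a)%R)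
  (b * x) a0 (measurableT_comp mJ2 (pair2_measurable x)) (fun=> J0 _).
by congr *%E; apply: eq_integral => y _; rewrite rot2.
Qed.

End Rotation.

Section StandardNormal.
Context {R : realType}.
Notation mu := (@leb R).
Local Open Scope ereal_scope.

Notation phi := (normal_pdf 0%R 1%R : R -> R).

Lemma phiE x : phi x = (normal_peak 1 * expR (- x ^+ 2 / 2))%R.
Proof.
by rewrite normal_pdfE ?oner_eq0// /normal_fun subr0 expr1n.
Qed.

Lemma phi_ge0 x : (0 <= phi x)%R. Proof. exact: normal_pdf_ge0. Qed.

Lemma measurable_phi : measurable_fun [set: R] (EFin \o phi).
Proof. by apply/measurable_EFinP; exact: measurable_normal_pdf. Qed.

Lemma ge0_integral_gauss (F : R -> \bar R) :
  measurable_fun [set: R] F -> (forall x, 0 <= F x) ->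
  \int[gauss]_x F x = \int[mu]_x (F x * (phi x)%:E).
Proof.
move=> mF F0; apply: (@ge0_integral_density _ _ _ _ _ (EFin \o phi)) => //.
- exact: measurable_phi.
- by move=> x; rewrite lee_fin phi_ge0.
- move=> A mA; rewrite -[LHS]/(@normal_prob R 0%R 1%R A) /normal_prob.
  rewrite integral_mkcond [RHS]integral_mkcond.
  rewrite ge0_integral_leb//.
  + by apply/(measurable_restrictT _ _).1 => //; apply: measurable_funTS; exact: measurable_phi.
  + by move=> x; apply: erestrict_ge0 => y _; rewrite lee_fin phi_ge0.
Qed.

End StandardNormal.

Section GaussTransforms.
Context {R : realType}.
Notation mu := (@leb R).
Notation gauss := (@gauss R).
Notation phi := (normal_pdf 0%R 1%R : R -> R).
Local Open Scope ereal_scope.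

Lemma measurable_phi2 : measurable_fun [set: R * R]
  (fun p : R * R => (phi p.1 * phi p.2)%:E).
Proof.
apply/measurable_EFinP; apply: measurable_funM.
  exact: (measurableT_comp (measurable_normal_pdf 0 1)).
exact: (measurableT_comp (measurable_normal_pdf 0 1)).
Qed.

Lemma ge0_integral_gauss2 (F : R * R -> \bar R) :
  measurable_fun [set: R * R] F -> (forall p, 0 <= F p) ->
  \int[gauss]_x \int[gauss]_y F (x, y) =
  \int[mu]_x \int[mu]_y (F (x, y) * (phi x * phi y)%:E).
Proof.
move=> mF F0.
have mF1 x : measurable_fun [set: R] (fun y => F (x, y)).
  exact: measurableT_comp mF (pair1_measurable x).
rewrite ge0_integral_gauss; last 2 first.
- exact: (@measurable_fun_fubini_tonelli_F _ _ _ _ _ gauss F mF F0).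
- by move=> x; apply: integral_ge0.
apply: eq_integral => x _.
rewrite (@ge0_integral_gauss _ (fun y => F (x, y)))//.
rewrite -ge0_integralZr//; last 3 first.
- by apply: emeasurable_funM => //; exact: measurable_phi.
- by move=> y _; rewrite mule_ge0// lee_fin phi_ge0.
- by rewrite lee_fin phi_ge0.
by apply: eq_integral => y _; rewrite -muleA -EFinM (mulrC (phi y)).
Qed.

(** The product density depends on x^2 + y^2 only, so the invariance of Lebesgue measure carries
    over. *)
Lemma gauss_rotation (F : R * R -> \bar R) (a b : R) :
  a != 0%R -> (a ^+ 2 + b ^+ 2 = 1)%R ->
  measurable_fun [set: R * R] F -> (forall p, 0 <= F p) ->
  \int[gauss]_x \int[gauss]_y F (a * x + b * y, a * y - b * x)%R =
  \int[gauss]_x \int[gauss]_y F (x, y).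
Proof.
move=> a0 ab mF F0.
have mF1 : measurable_fun [set: R * R]
    (fun p : R * R => F (a * p.1 + b * p.2, a * p.2 - b * p.1)%R).
  apply: measurableT_comp => //; apply: measurable_fun_pair => /=.
    exact: measurable_lincomb.
  rewrite (_ : (fun _ => _) = fun p => (- b * p.1 + a * p.2)%R); last first.
    by apply/funext => p /=; rewrite mulNr addrC.
  exact: measurable_lincomb.
rewrite (ge0_integral_gauss2 mF1 (fun p => F0 _)) (ge0_integral_gauss2 mF F0).
rewrite -(lebesgue_rotation a0 ab (J := fun p => F p * (phi p.1 * phi p.2)%:E)).
- apply: eq_integral => x _; apply: eq_integral => y _ /=.
  congr (_ * _%:E); rewrite !phiE mulrACA [RHS]mulrACA -!expRD; congr (_ * expR _)%R.
  rewrite -!mulrDl -!opprD; congr (- _ / _)%R.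
  by rewrite -[LHS]mul1r -ab; ring.
- by apply: emeasurable_funM => //; exact: measurable_phi2.
- by move=> p; rewrite mule_ge0// lee_fin mulr_ge0// phi_ge0.
Qed.

Lemma gauss_opp (F : R -> \bar R) :
  measurable_fun [set: R] F -> (forall x, 0 <= F x) ->
  \int[gauss]_x F (- x)%R = \int[gauss]_x F x.
Proof.
move=> mF F0.
have mN : measurable_fun [set: R] (fun x : R => F (- x)%R).
  exact: measurableT_comp.
rewrite !ge0_integral_gauss//.
rewrite [RHS](@ge0_integral_leb_affine _ _ (-1)%R 0%R)//.
- rewrite normrN1 mul1e; apply: eq_integral => x _.
  by rewrite addr0 mulN1r !phiE sqrrN.
- by apply: emeasurable_funM => //; exact: measurable_phi.
- by move=> x; rewrite mule_ge0// lee_fin phi_ge0.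
Qed.

(** Completing the square; this is the one-dimensional Cameron-Martin formula. *)
Lemma gauss_shift (F : R -> \bar R) (m : R) :
  measurable_fun [set: R] F -> (forall x, 0 <= F x) ->
  \int[gauss]_x F (x + m)%R =
  \int[gauss]_x (F x * (expR (m * x - m ^+ 2 / 2))%:E).
Proof.
move=> mF F0.
have mN : measurable_fun [set: R] (fun x : R => F (x + m)%R).
  by apply: measurableT_comp => //; exact: measurable_funD.
have mE : measurable_fun [set: R] (fun x : R => (expR (m * x - m ^+ 2 / 2))%:E).
  apply/measurable_EFinP; apply: measurableT_comp => //.
  exact: measurable_affine.
rewrite !ge0_integral_gauss//; last 2 first.
- exact: emeasurable_funM.
- by move=> x; rewrite mule_ge0// lee_fin expR_ge0.
rewrite [RHS](@ge0_integral_leb_affine _ _ 1 m)//.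
- rewrite normr1 mul1e; apply: eq_integral => x _.
  rewrite mul1r -muleA; congr (_ * _); rewrite -EFinM; congr EFin.
  rewrite !phiE mulrCA -expRD; congr (_ * expR _)%R; by field.
- by apply: emeasurable_funM; [exact: emeasurable_funM|exact: measurable_phi].
- by move=> x; rewrite !mule_ge0// lee_fin ?phi_ge0// expR_ge0.
Qed.

(** Rotate (a, b) onto the first axis; the second coordinate then integrates to 1. The rotation
    divides by the first coefficient, so a = 0 is handled by exchanging the variables. *)
Lemma gauss_lincomb (F : R -> \bar R) (a b : R) :
  measurable_fun [set: R] F -> (forall x, 0 <= F x) ->
  \int[gauss]_x \int[gauss]_y F (a * x + b * y)%R =
  \int[gauss]_x F (Num.sqrt (a ^+ 2 + b ^+ 2) * x)%R.
Proof.
move=> mF F0.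
have mL (c d : R) : measurable_fun [set: R * R]
    (fun p : R * R => F (c * p.1 + d * p.2)%R).
  exact: measurableT_comp (measurable_lincomb c d).
have mM (c : R) : measurable_fun [set: R] (fun x : R => F (c * x)%R).
  by apply: measurableT_comp => //; exact: measurable_funM.
have key (c d : R) : c != 0%R ->
    \int[gauss]_x \int[gauss]_y F (c * x + d * y)%R =
    \int[gauss]_x \int[gauss]_y F (Num.sqrt (c ^+ 2 + d ^+ 2) * x)%R.
  move=> c0; set r := Num.sqrt _.
  have r2 : (r ^+ 2 = c ^+ 2 + d ^+ 2)%R by rewrite sqr_sqrtr// addr_ge0// sqr_ge0.
  have r0 : r != 0%R.
    by rewrite sqrtr_eq0 -ltNge ltr_pwDl// ?sqr_ge0// exprn_even_gt0.
  rewrite -(gauss_rotation (F := fun p => F (r * p.1)%R) (a := c / r) (b := d / r)).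
  - by apply: eq_integral => x _; apply: eq_integral => y _ /=; congr F; field.
  - by rewrite mulf_neq0// invr_eq0.
  - by rewrite !expr_div_n -mulrDl -r2 divff// expf_neq0.
  - exact: measurableT_comp (mM r) _.
  - by [].
have cst2 (c : R) : \int[gauss]_x \int[gauss]_y F (c * x)%R =
    \int[gauss]_x F (c * x)%R.
  apply: eq_integral => x _.
  by rewrite integral_cst// -[RHS]mule1; congr *%E; exact: (@probability_setT _ _ _ gauss).
rewrite -cst2; have [a0|a0] := eqVneq a 0%R; last exact: key.
have [b0|b0] := eqVneq b 0%R.
  rewrite a0 b0 expr0n/= addr0 sqrtr0.
  by apply: eq_integral => x _; apply: eq_integral => y _; rewrite !mul0r addr0.
rewrite addrC -(key _ _ b0) (fubini_tonelli (fun p : R * R => F (a * p.1 + b * p.2)%R))//.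
by apply: eq_integral => x _; apply: eq_integral => y _ /=; rewrite addrC.
Qed.

End GaussTransforms.

(** * Independence *)

Section Independence.
Context d (T : measurableType d) (R : realType) (P : probability T R).
Local Open Scope ereal_scope.

Definition independent_families (S1 S2 : set (set T)) : Prop :=
  forall A B, S1 A -> S2 B -> P (A `&` B) = P A * P B.

Lemma independent_familiesC (S1 S2 : set (set T)) :
  independent_families S1 S2 -> independent_families S2 S1.
Proof. by move=> h A B SA SB; rewrite setIC muleC; exact: h. Qed.

(** With B fixed, the maps sending A to P(A and B) and to P(A) P(B) are finite measures that agree
    on the pi-system S1. *)
Let independent_sigma1 (S1 S2 : set (set T)) :
  S1 `<=` measurable -> S2 `<=` measurable -> setI_closed S1 -> S1 setT ->
  independent_families S1 S2 -> independent_families <<s S1 >> S2.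
Proof.
move=> mS1 mS2 IS1 TS1 ind A B sA sB.
have PBfin : P B \is a fin_num by exact: fin_num_measure (mS2 _ sB).
pose k : {nonneg R} := NngNum (fine_ge0 (measure_ge0 P B)).
have -> : P (A `&` B) = mrestr P (mS2 _ sB) A by [].
have -> : P A * P B = mscale k P A by rewrite /mscale /= fineK// muleC.
apply: (g_sigma_algebra_measure_unique S1 mS1 (fun=> setT)) => //=.
- by rewrite bigcup_const.
- by move=> C SC; rewrite /mrestr /mscale /= ind// fineK// muleC.
- move=> _; rewrite /mrestr setTI; exact: le_lt_trans (probability_le1 _ (mS2 _ sB)) (ltry _).
Qed.

Lemma sigma_sub_measurable (S : set (set T)) :
  S `<=` measurable -> <<s S >> `<=` measurable.
Proof. exact: smallest_sub (@sigma_algebra_measurable _ T). Qed.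

Lemma independent_sigma (S1 S2 : set (set T)) :
  S1 `<=` measurable -> S2 `<=` measurable ->
  setI_closed S1 -> setI_closed S2 -> S1 setT -> S2 setT ->
  independent_families S1 S2 -> independent_families <<s S1 >> <<s S2 >>.
Proof.
move=> mS1 mS2 IS1 IS2 TS1 TS2 ind; apply: independent_familiesC.
apply: independent_sigma1 => //; first exact: sigma_sub_measurable.
by apply: independent_familiesC; exact: independent_sigma1.
Qed.

End Independence.

Section IndependentIntegral.
Context d (T : measurableType d) (R : realType) (P : probability T R).
Context d1 (T1 : measurableType d1) d2 (T2 : measurableType d2).
Variables (U : T -> T1) (V : T -> T2).
Hypotheses (mU : measurable_fun setT U) (mV : measurable_fun setT V).
Hypothesis ind : forall A B, measurable A -> measurable B ->
  (P (U @^-1` A `&` V @^-1` B) = P (U @^-1` A) * P (V @^-1` B))%E.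
Local Open Scope ereal_scope.

(** The joint law is the product of the marginal laws. Only V is replaced by an integral over its
    law while U stays a random variable, so that coordinates can be removed one at a time. *)
Lemma ge0_integral_independent (F : T1 * T2 -> \bar R) :
  measurable_fun setT F -> (forall p, 0 <= F p) ->
  \int[P]_w F (U w, V w) = \int[P]_w \int[image_law P mV]_x F (U w, x).
Proof.
move=> mF F0.
have mUV : measurable_fun setT (fun w => (U w, V w)) by exact: measurable_fun_pair.
transitivity (\int[image_law P mUV]_p F p); first by rewrite ge0_integral_image_law.
transitivity (\int[image_law P mU \x image_law P mV]_p F p).
  by apply: eq_measure_integral => A mA _; apply/esym/product_measure_unique.
rewrite fubini_tonelli1// ge0_integral_image_law//.
- exact: (@measurable_fun_fubini_tonelli_F _ _ _ _ _ (image_law P mV) F).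
- by move=> x; exact: integral_ge0.
Qed.

End IndependentIntegral.

Section MutualIndependence.
Context d (T : measurableType d) (R : realType) (P : probability T R).
Variables (X : nat -> T -> R) (k : nat).
Hypothesis mX : forall i, (i < k)%N -> measurable_fun setT (X i).
Hypothesis indX : mutually_independent P (fun i : 'I_k => X i).
Local Open Scope ereal_scope.

(** A pi-system generating the sigma-algebra of the coordinates selected by I. *)
Definition coordinate_rectangles (I : pred nat) : set (set T) :=
  [set A | exists2 B : nat -> set R, (forall i, measurable (B i)) &
    A = [set w | forall i : 'I_k, I i -> B i (X i w)]].

Notation G := coordinate_rectangles.

Lemma coordinate_rectangles_measurable I : G I `<=` measurable.
Proof.
move=> _ [B mB ->].
rewrite (_ : [set _ | _] =
    \bigcap_(i in `I_k) (X i @^-1` (if I i then B i else setT))).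
  apply: fin_bigcap_measurable; first exact: finite_II.
  by move=> i ik; rewrite -[X in measurable X]setTI; apply: mX => //; case: ifP.
apply/seteqP; split => [w /= h i /= ik|w /= h i Ii].
  by case: ifPn => // Ii; exact: (h (Ordinal ik)).
by have := h i (ltn_ord i); rewrite Ii.
Qed.

Lemma coordinate_rectanglesI I : setI_closed (G I).
Proof.
move=> _ _ [B mB ->] [C mC ->]; exists (fun i => B i `&` C i).
  by move=> i; exact: measurableI.
apply/seteqP; split => [w [/= h1 h2] i Ii|w /= h]; first by split; [exact: h1|exact: h2].
by split => i Ii; have [] := h i Ii.
Qed.

Lemma coordinate_rectanglesT I : G I setT.
Proof. by exists (fun=> setT) => //; apply/seteqP; split. Qed.

Lemma coordinate_rectangles_coord (I : pred nat) i (B : set R) :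
  (i < k)%N -> I i -> measurable B -> G I (X i @^-1` B).
Proof.
move=> ik Ii mB; exists (fun j => if j == i then B else setT).
  by move=> j; case: ifP.
apply/seteqP; split => [w /= h j _|w /= /(_ (Ordinal ik) Ii)/=]; last by rewrite eqxx.
by case: eqP => // ->.
Qed.

(** Filling the unselected coordinates with the whole line turns all events into full rectangles,
    whose probabilities factor; as I and J are disjoint, at each coordinate at least one of the two
    sides is the whole line. *)
Lemma independent_coordinates (I J : pred nat) :
  (forall i, ~~ (I i && J i)) ->
  independent_families P <<s G I >> <<s G J >>.
Proof.
move=> IJ; apply: independent_sigma;
  try by [exact: coordinate_rectangles_measurable|exact: coordinate_rectanglesI|
    exact: coordinate_rectanglesT].
move=> _ _ [B mB ->] [C mC ->].
pose b i := if I i then B i else setT; pose c i := if J i then C i else setT.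
have E (I' : pred nat) (D : nat -> set R) :
    [set w | forall i : 'I_k, I' i -> D i (X i w)] =
    [set w | forall i : 'I_k, (if I' i then D i else setT) (X i w)].
  apply/seteqP; split => [w /= h i|w /= h i Ii]; first by case: ifPn => // /h.
  by have := h i; rewrite Ii.
rewrite (E I B) (E J C) (indX (B := fun i => b i)); last by move=> i; rewrite /b; case: ifP.
rewrite (indX (B := fun i => c i)); last by move=> i; rewrite /c; case: ifP.
rewrite -big_split /=.
rewrite (_ : _ `&` _ = [set w | forall i : 'I_k, (b i `&` c i) (X i w)]); last first.
  apply/seteqP; split => [w [/= h1 h2] i|w /= h]; first by split; [exact: h1|exact: h2].
  by split => i; have [] := h i.
rewrite (indX (B := fun i => b i `&` c i)); last first.
  by move=> i; apply: measurableI; rewrite /b /c; case: ifP.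
have PT (i : nat) : P [set w | [set: R] (X i w)] = 1 by exact: probability_setT.
apply: eq_bigr => i _; have := IJ i; rewrite /b /c.
case: (J i); last by move=> _; rewrite setIT PT mule1.
by rewrite andbT => /negbTE ->; rewrite setTI PT mul1e.
Qed.

End MutualIndependence.

Lemma emeasurable_prod d (T : measurableType d) (R : realType) (I : Type)
    (s : seq I) (h : I -> T -> \bar R) :
  (forall i, measurable_fun setT (h i)) ->
  measurable_fun setT (fun w => \prod_(i <- s) h i w)%E.
Proof.
move=> mh; elim: s => [|i s IH].
  by apply: (eq_measurable_fun (cst 1%E)) => // w _; rewrite big_nil.
apply: (eq_measurable_fun (fun w => h i w * \prod_(j <- s) h j w)%E).
  by move=> w _; rewrite big_cons.
exact: emeasurable_funM.
Qed.

(** * Independent standard normal coordinates *)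

Section GaussianVector.
Context d (T : measurableType d) (R : realType) (P : probability T R).
Variables (Z : nat -> T -> R) (k : nat).
Hypothesis mZ : forall i, (i < k)%N -> measurable_fun setT (Z i).
Hypothesis indZ : mutually_independent P (fun i : 'I_k => Z i).
Hypothesis lawZ : forall i, (i < k)%N -> forall B, measurable B ->
  P (Z i @^-1` B) = gauss B.
Notation gauss := (@gauss R).
Local Open Scope ereal_scope.

(** The sample space with the coarser sigma-algebra of the selected coordinates. Measurability on it
    expresses dependence on these coordinates only, and the identity from T plays the part of the
    vector they form. *)
Definition coordinate_type (I : pred nat) :=
  g_sigma_algebraType (coordinate_rectangles Z k I).

Lemma measurable_coordinate (I : pred nat) i : (i < k)%N -> I i ->
  measurable_fun [set: coordinate_type I] (Z i : coordinate_type I -> R).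
Proof.
move=> ik Ii _ B mB; rewrite setTI; apply: sub_sigma_algebra.
exact: coordinate_rectangles_coord.
Qed.

Lemma measurable_to_coordinate_type (I : pred nat) :
  measurable_fun [set: T] (id : T -> coordinate_type I).
Proof.
move=> _ B mB; rewrite setTI.
exact: (sigma_sub_measurable (coordinate_rectangles_measurable mZ (I := I))).
Qed.

Lemma ge0_integral_coordinate (I : pred nat) r
    (F : coordinate_type I * R -> \bar R) :
  (r < k)%N -> ~~ I r -> measurable_fun setT F -> (forall p, 0 <= F p) ->
  \int[P]_w F (w, Z r w) = \int[P]_w \int[gauss]_x F (w, x).
Proof.
move=> rk Ir mF F0.
rewrite (@ge0_integral_independent _ _ _ P _ (coordinate_type I) _ _
  (id : T -> coordinate_type I) (Z r) (@measurable_to_coordinate_type I) (mZ rk))//.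
- apply: eq_integral => w _; apply: eq_measure_integral => B mB _.
  exact: lawZ.
- move=> A B mA mB; rewrite preimage_id.
  apply: (independent_coordinates mZ indZ (I := I) (J := pred1 r)) => //.
    by move=> i /=; case: eqP => [->|_]; rewrite ?andbF ?andbT.
  by apply: sub_sigma_algebra; apply: coordinate_rectangles_coord => //=.
Qed.

(** F varies in the induction: integrating out the last coordinate replaces it by [H], to which the
    hypothesis applies, and [gauss_lincomb] merges the two remaining normal variables. *)
Lemma ge0_integral_lincomb (a : nat -> R) (F : R -> \bar R) r : (r <= k)%N ->
  measurable_fun setT F -> (forall x, 0 <= F x) ->
  \int[P]_w F (\sum_(i < r) a i * Z i w)%R =
  \int[gauss]_x F (Num.sqrt (\sum_(i < r) a i ^+ 2) * x)%R.
Proof.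
elim: r F => [|r IH] F rk mF F0.
  under eq_integral do rewrite big_ord0.
  under [RHS]eq_integral do rewrite big_ord0 sqrtr0 mul0r.
  rewrite !integral_cst//; congr *%E.
  by rewrite [RHS](@probability_setT _ _ _ gauss) [LHS]probability_setT.
have mS (I : pred nat) : (forall i, (i < r)%N -> I i) -> measurable_fun setT
    (fun w : coordinate_type I => \sum_(i < r) a i * Z i w)%R.
  move=> Ir; apply: measurable_sum => i.
  apply: measurable_funM => //; apply: measurable_coordinate; last exact: Ir.
  exact: ltn_trans (ltn_ord i) rk.
have mF2 (c e : R) : measurable_fun [set: R * R] (fun p : R * R => F (c * p.1 + e * p.2)%R).
  exact: measurableT_comp mF (measurable_lincomb c e).
pose H s := \int[gauss]_x F (s + a r * x)%R.
have mH : measurable_fun setT H.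
  have := @measurable_fun_fubini_tonelli_F _ _ _ _ _ gauss _ (mF2 1%R (a r)) (fun=> F0 _).
  by apply: eq_measurable_fun => s _ /=; apply: eq_integral => x _; rewrite mul1r.
have H0 s : 0 <= H s by exact: integral_ge0.
transitivity (\int[P]_w H (\sum_(i < r) a i * Z i w)%R).
  rewrite -(@ge0_integral_coordinate (fun i => (i < r)%N) r
     (fun p => F (\sum_(i < r) a i * Z i p.1 + a r * p.2)%R))//.
  - by apply: eq_integral => w _; rewrite big_ord_recr.
  - by rewrite ltnn.
  - apply: measurableT_comp => //; apply: measurable_funD; last first.
      exact: measurable_funM.
    by apply: (measurableT_comp (mS (fun i => (i < r)%N) _)).
rewrite IH//; last exact: ltnW.
rewrite /H (gauss_lincomb _ (a r) mF F0) sqr_sqrtr; last first.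
  by apply: sumr_ge0 => i _; exact: sqr_ge0.
by rewrite big_ord_recr.
Qed.

Lemma ge0_integral_prod (h : nat -> R -> \bar R) r : (r <= k)%N ->
  (forall i, measurable_fun setT (h i)) -> (forall i x, 0 <= h i x) ->
  \int[P]_w (\prod_(i < r) h i (Z i w)) = \prod_(i < r) \int[gauss]_x h i x.
Proof.
move=> + mh h0; elim: r => [|r IH] rk.
  under eq_integral do rewrite big_ord0.
  by rewrite integral_cst// mul1e [LHS]probability_setT big_ord0.
have mS : measurable_fun setT
    (fun w : coordinate_type (fun i => (i < r)%N) => \prod_(i < r) h i (Z i w)).
  apply: emeasurable_prod => i _.
  apply: measurableT_comp => //; apply: measurable_coordinate => //=.
  exact: ltn_trans (ltn_ord i) rk.
have p0 w : 0 <= \prod_(i < r) h i (Z i w) by exact: prode_ge0.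
rewrite big_ord_recr/= -IH; last exact: ltnW.
transitivity (\int[P]_w \int[gauss]_x (\prod_(i < r) h i (Z i w) * h r x)).
  rewrite -(@ge0_integral_coordinate (fun i => (i < r)%N) r
     (fun p => \prod_(i < r) h i (Z i p.1) * h r p.2))//.
  - by apply: eq_integral => w _; rewrite big_ord_recr.
  - by rewrite ltnn.
  - apply: emeasurable_funM; last exact: measurableT_comp.
    exact: (measurableT_comp mS).
  - by move=> p; rewrite mule_ge0.
rewrite -ge0_integralZr//; last 2 first.
- apply: emeasurable_prod => i _; apply: measurableT_comp => //; apply: mZ.
  exact: ltn_trans (ltn_ord i) rk.
- exact: integral_ge0.
by apply: eq_integral => w _; rewrite ge0_integralZl.
Qed.

End GaussianVector.

(** * Testing against a Gaussian shift *)

Section Tilt.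
Context d (T : measurableType d) (R : realType) (P : {measure set T -> \bar R}).
Variable L : T -> R.
Hypothesis mL : measurable_fun setT L.
Hypothesis L0 : forall w, 0 <= L w.
Local Open Scope ereal_scope.

Definition tilt (mL : measurable_fun setT L) (L0 : forall w, (0 <= L w)%R)
  (A : set T) : \bar R := \int[P]_(w in A) (L w)%:E.

Let tilt0 : tilt mL L0 set0 = 0.
Proof. exact: integral_set0. Qed.

Let tilt_ge0 A : 0 <= tilt mL L0 A.
Proof. by apply: integral_ge0 => w _; rewrite lee_fin. Qed.

Let tilt_sigma_additive : semi_sigma_additive (tilt mL L0).
Proof.
move=> F mF tF mUF; rewrite /tilt ge0_integral_bigcup//.
- apply: is_cvg_ereal_nneg_natsum => n _.
  by apply: integral_ge0 => w _; rewrite lee_fin.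
- by apply/measurable_EFinP; exact: measurable_funTS.
- by move=> w _; rewrite lee_fin.
Qed.

HB.instance Definition _ :=
  isMeasure.Build _ _ _ (tilt mL L0) tilt0 tilt_ge0 tilt_sigma_additive.

End Tilt.

Section CameronMartin.
Context d (T : measurableType d) (R : realType) (P : probability T R).
Variables (Z : nat -> T -> R) (k : nat).
Hypothesis mZ : forall i, (i < k)%N -> measurable_fun setT (Z i).
Hypothesis indZ : mutually_independent P (fun i : 'I_k => Z i).
Hypothesis lawZ : forall i, (i < k)%N -> forall B, measurable B ->
  P (Z i @^-1` B) = gauss B.
Variable h : nat -> R.
Notation gauss := (@gauss R).
Local Open Scope ereal_scope.

(** Density of the law of Z + h with respect to that of Z: the Cameron-Martin formula in finite
    dimension. *)
Definition shift_likelihood (w : T) : R :=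
  expR (\sum_(i < k) h i * Z i w - (\sum_(i < k) h i ^+ 2) / 2).

Lemma measurable_shift_likelihood : measurable_fun setT shift_likelihood.
Proof.
apply: measurableT_comp => //; apply: measurable_funB => //.
by apply: measurable_sum => i; apply: measurable_funM => //; exact: mZ.
Qed.

Lemma shift_likelihood_ge0 w : (0 <= shift_likelihood w)%R.
Proof. exact: expR_ge0. Qed.

Notation tiltP := (tilt P measurable_shift_likelihood shift_likelihood_ge0).

Lemma shift_rectangle (B : nat -> set R) : (forall i, measurable (B i)) ->
  P [set w | forall i : 'I_k, B i (Z i w + h i)%R] =
  tiltP [set w | forall i : 'I_k, B i (Z i w)].
Proof.
move=> mB.
pose B' i := (fun x : R => x + h i)%R @^-1` B i.
have mB' i : measurable (B' i).
  rewrite -[B' i]setTI; apply: (measurable_funD (g := cst (h i))) => //.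
rewrite (indZ (B := fun i => B' i))//.
pose u i x : \bar R := (\1_(B i) x)%:E * (expR (h i * x - h i ^+ 2 / 2))%:E.
have mu i : measurable_fun setT (u i).
  apply: emeasurable_funM; apply/measurable_EFinP => //.
  by apply: measurableT_comp => //; exact: measurable_affine.
have u0 i x : 0 <= u i x.
  by rewrite mule_ge0// lee_fin ?expR_ge0.
transitivity (\prod_(i < k) \int[gauss]_x u i x).
  apply: eq_bigr => i _.
  rewrite -(@gauss_shift _ (fun x => (\1_(B i) x)%:E) (h i)); last 2 first.
  - by apply/measurable_EFinP; exact: measurable_indic.
  - by move=> x; rewrite lee_fin.
  rewrite (_ : P _ = P (Z i @^-1` B' i))// lawZ//.
  transitivity (\int[gauss]_x (\1_(B' i) x)%:E) => //.
  by rewrite integral_indic// setIT.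
rewrite -(ge0_integral_prod mZ indZ lawZ (h := u) (leqnn k))//.
rewrite /tilt integral_mkcond; apply: eq_integral => w _.
rewrite patchE; case: ifPn => [|].
  rewrite inE /= => Bw.
  rewrite /shift_likelihood mulr_suml -sumrB expR_sum.
  rewrite -prodEFin; apply: eq_bigr => i _.
  by rewrite /u indicE mem_set ?mul1e//; exact: Bw.
rewrite notin_setE /= => /existsNP[i Bi].
by rewrite (bigD1 i)//= /u indicE memNset// mul0e mul0e.
Qed.

Section Transfer.
Context d' (E : measurableType d') (Y Y' : T -> E) (S : set (set E)).
Hypotheses (mY : measurable_fun setT Y) (mY' : measurable_fun setT Y').
Hypotheses (mS : S `<=` measurable) (SI : setI_closed S) (ST : S setT).
Hypothesis SZ : forall A, S A -> exists2 B : nat -> set R,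
  (forall i, measurable (B i)) &
  Y @^-1` A = [set w | forall i : 'I_k, B i (Z i w)] /\
  Y' @^-1` A = [set w | forall i : 'I_k, B i (Z i w + h i)%R].

(** In the application Y and Y' are the observations under two functions: on the pi-system S both
    are read off from the same Gaussian vector, unshifted and shifted by h. Both sides are finite
    measures in A, so agreement on S is enough. *)
Lemma shift_transfer A : <<s S >> A -> P (Y' @^-1` A) = tiltP (Y @^-1` A).
Proof.
have mYt : measurable_fun [set: T] Y by [].
move=> sA; rewrite -[LHS]/(image_law P mY' A) -[RHS]/(image_law tiltP mY A).
apply: (g_sigma_algebra_measure_unique S mS (fun=> setT)) => //.
- by rewrite bigcup_const.
- move=> {sA}A /SZ[B mB [YE Y'E]].
  rewrite -[LHS]/(P (Y' @^-1` A)) -[RHS]/(tiltP (Y @^-1` A)) YE Y'E.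
  exact: shift_rectangle.
- move=> _; apply: le_lt_trans (probability_le1 (image_law P mY') measurableT) _.
  exact: ltry.
Qed.

(** With L the likelihood ratio, the indicator of A is at most c L times itself plus (1 - c L)^+.
    The first part integrates to c P(Y' in A); in the second, L depends on one normal variable, and
    c puts the zero of 1 - c L at e - z. Subtracted terms are moved across to avoid differences of
    extended reals. *)
Lemma neyman_pearson_shift A (z e c : R) : <<s S >> A ->
  e = Num.sqrt (\sum_(i < k) h i ^+ 2)%R -> c = expR (z * e - e ^+ 2 / 2) ->
  P (Y @^-1` A) + c%:E * gauss `]-oo, (- z)%R]%classic <=
  c%:E * P (Y' @^-1` A) + gauss `]-oo, (e - z)%R]%classic.
Proof.
move=> sA eE cE.
have e0 : (0 <= e)%R by rewrite eE sqrtr_ge0.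
have c0 : (0 <= c)%R by rewrite cE expR_ge0.
have e2 : (e ^+ 2 = \sum_(i < k) h i ^+ 2)%R.
  by rewrite eE sqr_sqrtr// sumr_ge0// => i _; exact: sqr_ge0.
pose u (s : R) : R := Num.max 0%R (1 - c * expR (s - e ^+ 2 / 2))%R.
have u0 s : (0 <= u s)%R by rewrite le_max lexx.
have mexp (b : R) : measurable_fun [set: R] (fun s : R => expR (b * s - e ^+ 2 / 2)).
  by apply: measurableT_comp => //; exact: measurable_affine.
have mu : measurable_fun [set: R] u.
  apply: measurable_maxr => //; apply: measurable_funB => //.
  apply: measurable_funM => //.
  by apply: eq_measurable_fun (mexp 1%R) => s _; rewrite mul1r.
have mYA : measurable (Y @^-1` A).
  by rewrite -[_ @^-1` _]setTI; apply: mY => //; exact: sigma_sub_measurable sA.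
have lik w : shift_likelihood w = expR (\sum_(i < k) h i * Z i w - e ^+ 2 / 2).
  by rewrite e2.
have tail : \int[gauss]_x (u (e * x)%R)%:E + c%:E * gauss `]-oo, (- z)%R]%classic =
    gauss `]-oo, (e - z)%R]%classic.
  have mI : measurable `]-oo, (e - z)%R]%classic by exact: measurable_itv.
  rewrite (_ : gauss `]-oo, (- z)%R]%classic = \int[gauss]_x
      ((\1_(`]-oo, (e - z)%R]%classic) x)%:E * (expR (e * x - e ^+ 2 / 2))%:E)); last first.
    rewrite -(@gauss_shift _ (fun x => (\1_(`]-oo, (e - z)%R]%classic) x)%:E) e); last 2 first.
    - by apply/measurable_EFinP; exact: measurable_indic.
    - by move=> x; rewrite lee_fin.
    transitivity (\int[gauss]_x (\1_(`]-oo, (- z)%R]%classic) x)%:E).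
      by rewrite integral_indic// setIT.
    apply: eq_integral => x _; rewrite !indicE; congr ((nat_of_bool _)%:R%:E).
    by apply/idP/idP; rewrite !inE /= !in_itv/= => ?; lra.
  rewrite -ge0_integralZl//; last first.
    by apply: emeasurable_funM; apply/measurable_EFinP.
  rewrite -ge0_integralD//; last 4 first.
  - by move=> x _; rewrite lee_fin u0.
  - by apply/measurable_EFinP; apply: measurableT_comp => //; exact: measurable_funM.
  - by move=> x _; rewrite !mule_ge0// lee_fin ?expR_ge0.
  - apply: emeasurable_funM => //; apply: emeasurable_funM; apply/measurable_EFinP => //.
  transitivity (\int[gauss]_x (\1_(`]-oo, (e - z)%R]%classic) x)%:E); last first.
    by rewrite integral_indic// setIT.
  apply: eq_integral => x _; rewrite /u -!EFinM -EFinD; congr EFin.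
  have -> : (c * expR (e * x - e ^+ 2 / 2) = expR (e * (x - (e - z))))%R.
    by rewrite cE -expRD; congr expR; field.
  rewrite mulrCA cE -expRD indicE.
  have -> : (z * e - e ^+ 2 / 2 + (e * x - e ^+ 2 / 2) = e * (x - (e - z)))%R by field.
  case: (boolP (x \in _)); rewrite ?inE ?notin_setE /= in_itv/=.
    move=> xz; rewrite mul1r (max_idPr _) ?subrK//.
    rewrite subr_ge0 -expR0 ler_expR; nra.
  move=> /negP; rewrite -ltNge => xz; rewrite mul0r addr0; apply/max_idPl.
  rewrite subr_le0 -expR0 ler_expR; nra.
rewrite -tail addeA leeD2r//.
rewrite (shift_transfer sA) /tilt.
have -> : \int[gauss]_x (u (e * x)%R)%:E =
    \int[P]_w (u (\sum_(i < k) h i * Z i w)%R)%:E.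
  rewrite [in LHS]eE; apply/esym.
  apply: (@ge0_integral_lincomb _ _ _ _ _ _ mZ indZ lawZ h (EFin \o u) k) => //.
  exact/measurable_EFinP.
have -> : P (Y @^-1` A) = \int[P]_w (\1_(Y @^-1` A) w)%:E.
  by rewrite integral_indic// setIT.
have mLA : measurable_fun setT (((EFin \o shift_likelihood)) \_ (Y @^-1` A)).
  apply/(measurable_restrictT _ _).1 => //; apply: measurable_funTS.
  by apply/measurable_EFinP; exact: measurable_shift_likelihood.
have LA0 w : 0 <= ((EFin \o shift_likelihood) \_ (Y @^-1` A)) w.
  by apply: erestrict_ge0 => ? _; rewrite lee_fin expR_ge0.
have mSu : measurable_fun setT (fun w => (u (\sum_(i < k) h i * Z i w)%R)%:E).
  apply/measurable_EFinP; apply: measurableT_comp => //.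
  by apply: measurable_sum => i; apply: measurable_funM => //; exact: mZ.
rewrite integral_mkcond -ge0_integralZl// -ge0_integralD//; last 3 first.
- by move=> w _; rewrite mule_ge0.
- exact: emeasurable_funM.
- by move=> w _; rewrite lee_fin u0.
apply: ge0_le_integral => //.
- by apply/measurable_EFinP; exact: measurable_indic.
- by apply: emeasurable_funD => //; exact: emeasurable_funM.
move=> w _; rewrite patchE indicE; case: ifPn => [wA|_] /=; last first.
  by rewrite mule0 add0e lee_fin u0.
by rewrite -EFinM -EFinD lee_fin lik -lerBlDl /u le_max lexx orbT.
Qed.

End Transfer.
End CameronMartin.

(** * Approximation of events by an algebra *)

Section AlgebraApproximation.
Context d (T : measurableType d) (R : realType).
Variable m : {measure set T -> \bar R}.
Hypothesis moo : (m setT < +oo)%E.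
Variable S : set (set T).
Hypothesis mS : S `<=` measurable.
Hypothesis S0 : S set0.
Hypothesis SC : forall A, S A -> S (~` A).
Hypothesis SU : forall A B, S A -> S B -> S (A `|` B).

Definition symdiff (A B : set T) := (A `\` B) `|` (B `\` A).

Lemma measurable_symdiff A B :
  measurable A -> measurable B -> measurable (symdiff A B).
Proof. by move=> mA mB; apply: measurableU; exact: measurableD. Qed.

Let D := [set A | measurable A /\
  forall e : R, 0 < e -> exists2 B, S B & (m (symdiff A B) < e%:E)%E].

Let DU A B : D A -> D B -> D (A `|` B).
Proof.
move=> [mA hA] [mB hB]; split; first exact: measurableU.
move=> e e0; have e20 : 0 < e / 2 by rewrite divr_gt0.
have [A' SA' hA'] := hA _ e20; have [B' SB' hB'] := hB _ e20.
exists (A' `|` B'); first exact: SU.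
have mAA' := measurable_symdiff mA (mS SA').
have mBB' := measurable_symdiff mB (mS SB').
apply: (@le_lt_trans _ _ (m (symdiff A A' `|` symdiff B B'))).
  apply: le_measure; rewrite ?inE.
  - by apply: measurable_symdiff; apply: measurableU => //; exact: mS.
  - exact: measurableU.
  - by move=> x; rewrite /symdiff /=; tauto.
apply: (le_lt_trans (measureU2 _ mAA' mBB')).
by rewrite [e]splitr EFinD lteD.
Qed.

(** Only countable unions need care: finiteness of m makes what the partial unions miss tend to 0,
    and finite unions are approximated by [DU]. *)
Let D_sigma : sigma_algebra setT D.
Proof.
split.
- split; first exact: measurable0.
  by move=> e e0; exists set0 => //; rewrite /symdiff setDv setU0 measure0.
- move=> A [mA hA]; rewrite setTD; split; first exact: measurableC.
  move=> e /hA[B SB AB]; exists (~` B); first exact: SC.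
  rewrite (_ : symdiff _ _ = symdiff A B)//.
  by apply/seteqP; split => x; rewrite /symdiff /=;
    have [?|?] := pselect (A x); have [?|?] := pselect (B x); tauto.
- move=> F DF.
  have mF n : measurable (F n) by have [] := DF n.
  have mUF : measurable (\bigcup_n F n) by exact: bigcupT_measurable.
  split => // e e0; have e20 : 0 < e / 2 by rewrite divr_gt0.
  pose G n := \big[setU/set0]_(i < n) F i.
  have DG n : D (G n).
    rewrite /G; elim: n => [|n IH]; last by rewrite big_ord_recr; exact: DU.
    rewrite big_ord0; split; first exact: measurable0.
    by move=> ? ?; exists set0 => //; rewrite /symdiff setDv setU0 measure0.
  have mG n : measurable (G n) by have [] := DG n.
  have GUF n : G n `<=` \bigcup_n F n.
    by rewrite /G -bigcup_mkord => x [i _ Fi]; exists i.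
  have [N hN] : exists N, (m (\bigcup_n F n `\` G N) < (e / 2)%:E)%E.
    pose H n := \bigcup_n F n `\` G n.
    have mH n : measurable (H n) by exact: measurableD.
    have H0 : \bigcap_n H n = set0.
      apply/seteqP; split => // x /= Hx; have [[i _ Fi] _] := Hx 0%N Logic.I.
      have [_] := Hx i.+1 Logic.I; apply.
      by rewrite /G -bigcup_mkord; exists i => /=.
    have cvgH : m \o H @ \oo --> m (\bigcap_n H n).
      apply: nonincreasing_cvg_mu => //.
      - by apply: le_lt_trans moo; apply: le_measure; rewrite ?inE.
      - by rewrite H0; exact: measurable0.
      - move=> a b ab; apply/subsetPset; apply: setDS.
        by rewrite /G; apply: subset_bigsetU.
    rewrite H0 measure0 in cvgH.
    have e2E : (0 < (e / 2)%:E)%E by rewrite lte_fin.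
    by have [N _ hN] := cvgH _ (open_ereal_lt' e2E); exists N; exact: (hN N (leqnn N)).
  have [_ /(_ _ e20)[B SB GB]] := DG N.
  exists B => //.
  have mUB := measurable_symdiff (mG N) (mS SB).
  have mUG : measurable (\bigcup_n F n `\` G N) by exact: measurableD.
  apply: (@le_lt_trans _ _ (m ((\bigcup_n F n `\` G N) `|` symdiff (G N) B))).
    apply: le_measure; rewrite ?inE.
    - by apply: measurable_symdiff => //; exact: mS.
    - exact: measurableU.
    - by move=> x; rewrite /symdiff /=; have := GUF N x;
        have [?|?] := pselect (G N x); tauto.
  apply: (le_lt_trans (measureU2 _ mUG mUB)).
  by rewrite [e]splitr EFinD lteD.
Qed.

Lemma algebra_approximation A (e : R) : <<s S >> A -> 0 < e ->
  exists2 B, S B & (m (symdiff A B) < e%:E)%E.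
Proof.
have : <<s S >> `<=` D.
  apply: smallest_sub; first exact: D_sigma.
  move=> B SB; split; first exact: mS.
  by move=> ? ?; exists B => //; rewrite /symdiff setDv setU0 measure0.
by move=> /[apply] -[_ h] /h.
Qed.

End AlgebraApproximation.

(** * The observation process *)

Section Primitive.
Context {R : realType}.
Notation mu := (@lebesgue_measure R).
Notation obs := (@obs_interval R).
Implicit Types (f c : R -> R) (s t : R).

Lemma obsE t : obs t <-> - 2^-1 <= t <= 2^-1.
Proof. by rewrite /obs_interval /= in_itv. Qed.

Lemma measurable_obs : measurable obs.
Proof. exact: measurable_itv. Qed.

Lemma le_bound_integrable (D : set R) f (M : R) : measurable D ->
  (mu D < +oo)%E -> measurable_fun D f -> (forall x, D x -> `|f x| <= M) ->
  mu.-integrable D (EFin \o f).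
Proof.
move=> mD Doo mf fM; apply: measurable_bounded_integrable => //.
exists M; split; first exact: num_real.
by move=> K MK x Dx; exact/(le_trans (fM _ Dx))/ltW.
Qed.

Lemma primitiveB f s t : mu.-integrable obs (EFin \o f) ->
  obs s -> obs t -> s <= t ->
  \int[mu]_(x in `[- 2^-1, t]) f x - \int[mu]_(x in `[- 2^-1, s]) f x =
  \int[mu]_(x in `]s, t]) f x.
Proof.
move=> fi /obsE/andP[s1 s2] /obsE/andP[t1 t2] st.
apply: Rintegral_itvB; rewrite ?bnd_simp//.
apply: integrableS fi; [exact: measurable_obs|exact: measurable_itv|].
by apply: subset_itvl; rewrite bnd_simp.
Qed.

Lemma integrable_sub_obs f s t : mu.-integrable obs (EFin \o f) ->
  obs s -> obs t -> mu.-integrable `]s, t] (EFin \o f).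
Proof.
move=> fi /obsE/andP[s1 s2] /obsE/andP[t1 t2].
apply: integrableS fi; [exact: measurable_obs|exact: measurable_itv|].
by apply: subset_itv; rewrite bnd_simp.
Qed.

(** Cauchy-Schwarz, obtained by integrating (c - l)^2 >= 0 with l the mean of c. *)
Lemma sqr_Rintegral_le c s t : s < t ->
  mu.-integrable `]s, t] (EFin \o c) ->
  mu.-integrable `]s, t] (EFin \o (fun x => c x ^+ 2)) ->
  (\int[mu]_(x in `]s, t]) c x) ^+ 2 / (t - s) <=
  \int[mu]_(x in `]s, t]) c x ^+ 2.
Proof.
move=> st ci c2i; set I := \int[mu]_(x in _) c x; pose l := I / (t - s).
have ts : 0 < t - s by rewrite subr_gt0.
have mI : measurable (`]s, t]%classic : set (measurableTypeR R)) by exact: measurable_itv.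
have muI : mu `]s, t]%classic = (t - s)%:E by rewrite lebesgue_measure_itv/= lte_fin st EFinD.
have csti : mu.-integrable `]s, t] (EFin \o cst (l ^+ 2)).
  by apply: (@le_bound_integrable _ _ `|l ^+ 2|) => //; rewrite muI ltry.
have i1 : mu.-integrable `]s, t] (EFin \o (fun x => 2 * l * c x)).
  have := integrableZl mI (2 * l) ci.
  by apply: eq_integrable => // x _; rewrite /= EFinM.
have i2 : mu.-integrable `]s, t] (EFin \o (fun x => c x ^+ 2 + l ^+ 2)).
  by have := integrableD mI c2i csti; apply: eq_integrable.
have H : \int[mu]_(x in `]s, t]) (2 * l * c x) <=
    \int[mu]_(x in `]s, t]) (c x ^+ 2 + l ^+ 2).
  apply: le_Rintegral => // x _.
  by rewrite -subr_ge0 (_ : _ - _ = (c x - l) ^+ 2) ?sqr_ge0//; ring.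
have muI' : fine (mu `]s, t]%classic) = t - s by rewrite muI.
rewrite RintegralZl// RintegralD// Rintegral_cst// [fine _]muI' -/I in H.
have E1 : 2 * l * I = 2 * (I ^+ 2 / (t - s)) by rewrite /l; field; rewrite gt_eqF.
have E2 : l ^+ 2 * (t - s) = I ^+ 2 / (t - s) by rewrite /l; field; rewrite gt_eqF.
rewrite E1 E2 in H; lra.
Qed.

(** Cauchy-Schwarz on each cell. A right-hand side that ignores the grid is what makes the testing
    bound uniform over grids. *)
Lemma sum_sqr_Rintegral_le c (t : nat -> R) k :
  mu.-integrable obs (EFin \o c) ->
  mu.-integrable obs (EFin \o (fun x => c x ^+ 2)) ->
  (forall i, (i <= k)%N -> obs (t i)) -> (forall i, (i < k)%N -> t i < t i.+1) ->
  \sum_(i < k) (\int[mu]_(x in `]t i, t i.+1]) c x) ^+ 2 / (t i.+1 - t i) <=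
  \int[mu]_(x in obs) c x ^+ 2.
Proof.
move=> ci c2i ot tt.
have h1 : \int[mu]_(x in obs) c x ^+ 2 =
  \int[mu]_(x in `[- 2^-1, t k]) c x ^+ 2 + \int[mu]_(x in `]t k, 2^-1]) c x ^+ 2.
  rewrite -(@primitiveB (fun x => c x ^+ 2))//; first by rewrite addrC subrK.
  - exact: ot.
  - by apply/obsE; lra.
  - by have /obsE/andP[] := ot _ (leqnn k).
rewrite h1 -[leLHS]addr0 lerD//; last by apply: Rintegral_ge0 => x _; exact: sqr_ge0.
move: {h1} k ot tt; elim=> [|k IH] ot tt.
  by rewrite big_ord0; apply: Rintegral_ge0 => x _; exact: sqr_ge0.
rewrite big_ord_recr/= -[leRHS](subrK (\int[mu]_(x in `[- 2^-1, t k]) c x ^+ 2)).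
have ok : obs (t k) by apply: ot.
have ok1 : obs (t k.+1) by apply: ot.
rewrite addrC lerD//; last first.
  by apply: IH => i ik; [apply: ot; exact: leqW|apply: tt; exact: leqW].
rewrite (@primitiveB (fun x => c x ^+ 2))//; last exact/ltW/tt.
by apply: sqr_Rintegral_le; [exact: tt|exact: integrable_sub_obs..].
Qed.

End Primitive.

Section ScaledNormal.
Context {R : realType}.

Lemma normal_prob_scale (s : R) (A : set R) : 0 < s -> measurable A ->
  normal_prob 0 s A = gauss ((fun x => s * x) @^-1` A).
Proof.
move=> s0 mA; have sn : s != 0 by rewrite gt_eqF.
have mA' : measurable ((fun x => s * x) @^-1` A).
  rewrite -[X in measurable X]setTI; apply: measurable_funM => //.
have -> : gauss ((fun x => s * x) @^-1` A) = (\int[gauss]_x (\1_A (s * x)%R)%:E)%E.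
  transitivity (\int[gauss]_x (\1_((fun x => s * x) @^-1` A) x)%:E)%E => //.
  by rewrite integral_indic// setIT.
have m1 : measurable_fun [set: R] (fun x : R => (\1_A (s * x) : R)%:E).
  apply/measurable_EFinP; apply: (measurableT_comp (f := \1_A : R -> R)) => //.
rewrite ge0_integral_gauss//.
have m2 : measurable_fun [set: R] (fun x : R => (\1_A x : R)%:E * (normal_pdf 0 s x)%:E)%E.
  apply: emeasurable_funM; apply/measurable_EFinP; first exact: measurable_indic.
  exact: measurable_normal_pdf.
have p0 x : (0 <= (\1_A x)%:E * (normal_pdf 0 s x)%:E)%E.
  by rewrite mule_ge0// lee_fin// normal_pdf_ge0.
transitivity (\int[leb]_x ((\1_A x)%:E * (normal_pdf 0 s x)%:E))%E.
  rewrite ge0_integral_leb// /normal_prob integral_mkcond.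
  apply: eq_integral => x _; rewrite patchE indicE.
  by case: ifPn => _; rewrite ?mul1e ?mul0e.
rewrite (ge0_integral_leb_affine 0 sn)//.
rewrite -ge0_integralZl//; last first.
  exact: measurableT_comp m2 (measurable_affine s 0).
apply: eq_integral => x _; rewrite addr0 muleCA; congr (_ * _)%E.
rewrite -EFinM gtr0_norm//; congr EFin.
rewrite normal_pdfE// phiE /normal_peak /normal_fun subr0 expr1n.
rewrite mulrA; congr (_ * expR _).
  rewrite -mulrnAr sqrtrM ?sqr_ge0// sqrtr_sqr gtr0_norm// invfM mulrA.
  by rewrite divff// !mul1r.
by rewrite exprMn; field.
Qed.

End ScaledNormal.

Section PathSpace.
Context {R : realType}.

Lemma measurable_eval (t : R) : obs_interval t ->
  measurable_fun setT (fun y : path_space R => y t).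
Proof.
move=> ot _ B mB; rewrite setTI; apply: sub_sigma_algebra.
by exists t => //; exists B.
Qed.

Definition increments (t : nat -> R) (i : nat) (y : path_space R) : R :=
  y (t i.+1) - y (t i).

Lemma measurable_increments (t : nat -> R) k :
  (forall i, (i <= k)%N -> obs_interval (t i)) ->
  forall i, (i < k)%N -> measurable_fun setT (increments t i).
Proof.
move=> ot i ik; apply: measurable_funB; apply: measurable_eval; apply: ot => //.
exact: ltnW.
Qed.

End PathSpace.

Section Testing.
Context {R : realType} (d : measure_display) (T : measurableType d).
Variables (P : probability T R) (n : R) (W : R -> T -> R).
Hypotheses (n0 : 0 < n) (bW : brownian P W).
Notation mu := (@lebesgue_measure R).
Notation obs := (@obs_interval R).
Notation Y := (observation n W).

Lemma measurable_observation f : measurable_fun setT (Y f).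
Proof.
apply: (@measurability _ _ _ (path_space R) setT (Y f) (@cylinders R)) => //.
move=> _ [_ [t ot [B mB ->]] <-].
suff : measurable_fun setT (fun w => Y f w t) by move/(_ measurableT B mB).
apply: measurable_funD => //; apply: measurable_funM => //.
exact: (brownian_measurable bW).
Qed.

Lemma probability_observation_fin f A : measurable A ->
  P (Y f @^-1` A) \is a fin_num.
Proof.
move=> mA; apply: fin_num_measure; rewrite -[_ @^-1` _]setTI.
exact: measurable_observation.
Qed.

Section Increments.
Variables (t : nat -> R) (k : nat).
Hypothesis ot : forall i, (i <= k)%N -> obs (t i).
Hypothesis tt : forall i, (i < k)%N -> t i < t i.+1.

Let s i := Num.sqrt (t i.+1 - t i).
Definition normalized_increments i (w : T) : R :=
  (W (t i.+1) w - W (t i) w) / Num.sqrt (t i.+1 - t i).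
Notation Z := normalized_increments.

Let s0 i : (i < k)%N -> 0 < s i.
Proof. by move=> ik; rewrite sqrtr_gt0 subr_gt0 tt. Qed.

Lemma measurable_normalized_increments i : (i < k)%N -> measurable_fun setT (Z i).
Proof.
move=> ik; apply: measurable_funM => //; apply: measurable_funB;
  apply: (brownian_measurable bW); apply: ot => //.
exact: ltnW.
Qed.

Let measurable_div (c : R) (B : set R) : measurable B ->
  measurable ((fun x => x / c) @^-1` B).
Proof.
by move=> mB; rewrite -[X in measurable X]setTI; apply: measurable_funM.
Qed.

Lemma normalized_increments_law i : (i < k)%N -> forall B, measurable B ->
  P (Z i @^-1` B) = gauss B.
Proof.
move=> ik B mB; have si := s0 ik.
have := brownian_gaussian bW (ot (ltnW ik)) (ot ik) (tt ik) (measurable_div (s i) mB).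
rewrite normal_prob_scale//; last exact: measurable_div.
rewrite /preimage /= => ->; congr (gauss _); apply/seteqP; split => x /=.
  by rewrite mulrC mulKf// gt_eqF.
by rewrite [s i * x]mulrC mulfK// gt_eqF.
Qed.

Lemma normalized_increments_independent :
  mutually_independent P (fun i : 'I_k => Z i).
Proof.
move=> B mB.
exact: (brownian_independent bW ot tt (B := fun i => (fun x => x / s i) @^-1` B i)
  (fun i => measurable_div (s i) (mB i))).
Qed.

End Increments.

Variables (f g : R -> R) (e z : R).
Hypotheses (fi : mu.-integrable obs (EFin \o f)) (gi : mu.-integrable obs (EFin \o g)).
Hypothesis gf2i : mu.-integrable obs (EFin \o (fun x => (g x - f x) ^+ 2)).
Hypotheses (e0 : 0 <= e) (gfe : n * \int[mu]_(x in obs) (g x - f x) ^+ 2 <= e ^+ 2).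

Let gfi : mu.-integrable obs (EFin \o (fun x => g x - f x)).
Proof.
have := integrableB (measurable_obs : measurable (obs : set (measurableTypeR R))) gi fi.
by apply: eq_integrable; first exact: measurable_obs.
Qed.

(** Bound on the probability under f of an event of probability p under g. The excess of p over the
    level is amplified by at most exp(|z| e), a factor that does not depend on the grid. *)
Definition power_bound (p : R) : R :=
  fine (gauss `]-oo, (e - z)]) +
  expR (`|z| * e) * Num.max 0 (p - fine (gauss `]-oo, (- z)])).

Lemma testing_increments (t : nat -> R) k A :
  (forall i, (i <= k)%N -> obs (t i)) -> (forall i, (i < k)%N -> t i < t i.+1) ->
  <<s coordinate_rectangles (increments t) k predT >> A ->
  fine (P (Y f @^-1` A)) <= power_bound (fine (P (Y g @^-1` A))).
Proof.
move=> ot tt sA.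
have mI := measurable_increments ot.
pose S := coordinate_rectangles (increments t) k predT.
have mA : measurable A.
  by apply: (sigma_sub_measurable _ sA); exact: coordinate_rectangles_measurable.
pose m (u : R -> R) i := \int[mu]_(x in `]t i, t i.+1]) u x.
pose s i := Num.sqrt (t i.+1 - t i).
have s0 i : (i < k)%N -> 0 < s i by move=> ik; rewrite sqrtr_gt0 subr_gt0 tt.
have sn0 : 0 < Num.sqrt n by rewrite sqrtr_gt0.
(* Shift of the i-th normalized increment when f is replaced by g. *)
pose h i := Num.sqrt n * (m g i - m f i) / s i.
have incE u (i : 'I_k) w : mu.-integrable obs (EFin \o u) ->
    increments t i (Y u w) = m u i + s i / Num.sqrt n * normalized_increments t i w.
  move=> ui; have ik := ltn_ord i.
  rewrite /increments /observation opprD addrACA primitiveB//; last 3 first.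
  - exact/ot/ltnW.
  - exact: ot.
  - exact/ltW/tt.
  congr (_ + _); rewrite -mulrBr /normalized_increments -/(s i).
  by field; rewrite !gt_eqF// s0.
have SE : forall A, S A -> exists2 B : nat -> set R,
   (forall i, measurable (B i)) &
   Y f @^-1` A = [set w | forall i : 'I_k, B i (normalized_increments t i w)] /\
   Y g @^-1` A = [set w | forall i : 'I_k, B i (normalized_increments t i w + h i)].
  move=> _ [B mB ->].
  exists (fun i => (fun x => s i / Num.sqrt n * x + m f i) @^-1` B i).
    by move=> i; rewrite -[X in measurable X]setTI; exact: measurable_affine.
  have hE (i : 'I_k) w : s i / Num.sqrt n * (normalized_increments t i w + h i) + m f i
      = increments t i (Y g w).
    by rewrite incE// /h; field; rewrite !gt_eqF// s0.
  split; apply/seteqP; split => w /= H i.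
  - by have := H i isT; rewrite incE// addrC.
  - by move=> _; rewrite incE// addrC; exact: H.
  - by rewrite hE; exact: H.
  - by move=> _; rewrite -hE; exact: H.
pose ek := Num.sqrt (\sum_(i < k) h i ^+ 2).
pose c := expR (z * ek - ek ^+ 2 / 2).
have := neyman_pearson_shift (measurable_normalized_increments ot)
  (@normalized_increments_independent t k ot tt)
  (@normalized_increments_law t k ot tt)
  (measurable_observation f) (measurable_observation g)
  (coordinate_rectangles_measurable mI (I := predT))
  (@coordinate_rectanglesI _ _ _ _ _ _) (@coordinate_rectanglesT _ _ _ _ _ _) SE sA (z := z)
  (erefl ek) (erefl c).
have ek0 : 0 <= ek by exact: sqrtr_ge0.
(* The norm of the shift on the grid is at most e by Cauchy-Schwarz, so the Neyman-Pearson bound at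
   [ek] can be relaxed to one at e. *)
have eke : ek <= e.
  rewrite -(ler_pXn2r (n := 2))// ?nnegrE// sqr_sqrtr; last first.
    by apply: sumr_ge0 => i _; exact: sqr_ge0.
  apply: le_trans gfe.
  rewrite (eq_bigr (fun i : 'I_k => n *
    ((\int[mu]_(x in `]t i, t i.+1]) (g x - f x)) ^+ 2 / (t i.+1 - t i)))); last first.
    move=> i _; rewrite /h /m /s RintegralB//; last 2 first.
    - by apply: integrable_sub_obs => //; apply: ot => //; exact: ltnW.
    - by apply: integrable_sub_obs => //; apply: ot => //; exact: ltnW.
    by rewrite !exprMn exprVn sqr_sqrtr ?(ltW n0)// sqr_sqrtr ?mulrA// subr_ge0 ltW// tt.
  rewrite -mulr_sumr ler_pM2l//.
  exact: (@sum_sqr_Rintegral_le _ (fun x => g x - f x)).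
have finf := probability_observation_fin f mA.
have fing := probability_observation_fin g mA.
have gfin (x : R) : gauss `]-oo, x] \is a fin_num by exact: fin_num_measure.
rewrite -(fineK finf) -(fineK fing) -(fineK (gfin _)) -(fineK (gfin (ek - z))).
rewrite -!EFinM -!EFinD lee_fin /power_bound.
set pf := fine (P _); set pg := fine (P _); set al := fine (gauss `]-oo, (- z)]).
have : fine (gauss `]-oo, (ek - z)]) <= fine (gauss `]-oo, (e - z)]).
  apply: fine_le => //; apply: le_measure; rewrite ?inE//.
  by apply: subset_itvl; rewrite bnd_simp lerB.
set p1 := fine (gauss _); set p2 := fine (gauss _) => p12 H.
have c0 : 0 <= c by exact: expR_ge0.
have cC : c <= expR (`|z| * e).
  rewrite ler_expR; have := ler_norm z; have := normr_ge0 z; nra.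
have mx0 : 0 <= Num.max 0 (pg - al) by rewrite le_max lexx.
have mx1 : pg - al <= Num.max 0 (pg - al) by rewrite le_max lexx orbT.
have H1 := ler_wpM2l c0 mx1; have H2 := ler_wpM2r mx0 cC; rewrite /=; lra.
Qed.

End Testing.

(** * Events depending on finitely many times *)

Section FiniteCylinders.
Context {R : realType}.
Notation obs := (@obs_interval R).
Implicit Types (s : seq R) (y : path_space R).

Definition centered y : path_space R := fun t => y t - y (- 2^-1).

(** Increments determine a path only up to its starting value, so events are first moved to the path
    started at 0; almost surely this changes nothing for the observation. *)
Definition centered_cylinders s : set (set (path_space R)) :=
  [set A | exists2 t, t \in s &
     exists2 B : set R, measurable B & A = [set y | B (centered y t)]].

Definition finite_cylinders : set (set (path_space R)) :=
  [set A | exists2 s, (forall t, t \in s -> obs t) & <<s centered_cylinders s >> A].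

Lemma obs_left : obs (- 2^-1). Proof. by apply/obsE; lra. Qed.

Lemma finite_cylinders0 : finite_cylinders set0.
Proof. by exists [::] => //; exact: (@sigma_algebra0 _ setT). Qed.

Lemma finite_cylindersC A : finite_cylinders A -> finite_cylinders (~` A).
Proof. by move=> [s os sA]; exists s => //; exact: sigma_algebraC. Qed.

Lemma finite_cylindersU A B :
  finite_cylinders A -> finite_cylinders B -> finite_cylinders (A `|` B).
Proof.
move=> [s os sA] [s' os' sB]; exists (s ++ s').
  by move=> t; rewrite mem_cat => /orP[/os|/os'].
have mono (u v : seq R) : {subset u <= v} ->
    <<s centered_cylinders u >> `<=` <<s centered_cylinders v >>.
  move=> uv; apply: sub_sigma_algebra2 => _ [t ut [C mC ->]].
  by exists t; [exact: uv|exists C].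
apply: (@measurableU _ (g_sigma_algebraType (centered_cylinders (s ++ s')))).
- by apply: mono sA => t ts; rewrite mem_cat ts.
- by apply: mono sB => t ts; rewrite mem_cat ts orbT.
Qed.

(** The times are sorted after adding the left endpoint, which becomes t 0; every centred value is
    then a telescoping sum of increments. *)
Lemma finite_cylinders_increments s : (forall t, t \in s -> obs t) ->
  exists (t : nat -> R) k, [/\ forall i, (i <= k)%N -> obs (t i),
    forall i, (i < k)%N -> t i < t i.+1 &
    <<s centered_cylinders s >> `<=`
    <<s coordinate_rectangles (increments t) k predT >>].
Proof.
move=> os; pose u := sort <=%R (undup (- 2^-1 :: s)).
pose t i := nth 0 u i; pose k := (size u).-1.
have memu x : (x \in u) = (x \in - 2^-1 :: s) by rewrite mem_sort mem_undup.
have ou x : x \in u -> obs x.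
  by rewrite memu inE => /orP[/eqP ->|/os//]; exact: obs_left.
have u0 : (0 < size u)%N.
  by rewrite lt0n size_eq0; apply/eqP => u0; have := memu (- 2^-1); rewrite u0 !inE eqxx.
have su : sorted <%R u by rewrite sort_lt_sorted undup_uniq.
have sz i : (i <= k)%N -> (i < size u)%N.
  by move=> ik; rewrite -(prednK u0) ltnS.
have tt i : (i < k)%N -> t i < t i.+1.
  move=> ik; apply: (sorted_ltn_nth lt_trans) => //; rewrite ?inE.
  - exact/sz/ltnW.
  - exact: sz.
have t0 : t 0%N = - 2^-1.
  have uo : - 2^-1 \in u by rewrite memu inE eqxx.
  have : (index (- 2^-1 : R) u < size u)%N by rewrite index_mem.
  case E : (index _ _) => [|j] ju; first by rewrite -[RHS](nth_index 0 uo) E.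
  have : t 0%N < t j.+1 by apply: (sorted_ltn_nth lt_trans) => //; rewrite ?inE.
  rewrite {2}/t -E nth_index// ltNge.
  by have /obsE/andP[-> _] : obs (t 0%N) by apply: ou; exact: mem_nth.
exists t, k; split => //; first by move=> i ik; apply: ou; apply: mem_nth; exact: sz.
apply: smallest_sub; first exact: smallest_sigma_algebra.
move=> _ [x xs [B mB ->]].
have xu : x \in u by rewrite memu inE xs orbT.
pose j := index x u.
have jk : (j <= k)%N by rewrite -ltnS (prednK u0) index_mem.
have tj : t j = x by rewrite /t nth_index.
have telescope y : centered y x = \sum_(i < j) increments t i y.
  rewrite /centered -tj -t0.
  by rewrite -(telescope_sumr (fun i => y (t i)) (leq0n j)) big_mkord.
have mc : measurable_fun [set: coordinate_type (increments t) k predT]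
   (fun y : coordinate_type (increments t) k predT => centered y x).
  rewrite (_ : (fun _ => _) = fun y => \sum_(i < j) increments t i y); last first.
    by apply/funext => y; exact: telescope.
  apply: measurable_sum => i; apply: measurable_coordinate => //.
  exact: leq_trans (ltn_ord i) jk.
by have := mc measurableT B mB; rewrite setTI.
Qed.

Lemma finite_cylinders_measurable : finite_cylinders `<=` measurable.
Proof.
move=> A [s os]; have [t [k [ot _ sub]]] := finite_cylinders_increments os.
move=> /sub; apply: sigma_sub_measurable.
by apply: coordinate_rectangles_measurable; exact: measurable_increments.
Qed.

Lemma centered_preimage A : measurable A -> <<s finite_cylinders >> (centered @^-1` A).
Proof.
have : measurable_fun [set: g_sigma_algebraType finite_cylinders]
  (centered : g_sigma_algebraType finite_cylinders -> path_space R).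
  apply: (@measurability _ _ (g_sigma_algebraType finite_cylinders)
    (path_space R) setT centered (@cylinders R)) => //.
  move=> _ [_ [t ot [B mB ->]] <-]; rewrite setTI; apply: sub_sigma_algebra.
  exists [:: t]; first by move=> x; rewrite inE => /eqP ->.
  by apply: sub_sigma_algebra; exists t; [rewrite inE|exists B].
by move=> mc /(mc measurableT); rewrite setTI.
Qed.

End FiniteCylinders.

Section Testing.
Context {R : realType} (d : measure_display) (T : measurableType d).
Variables (P : probability T R) (n : R) (W : R -> T -> R).
Hypotheses (n0 : 0 < n) (bW : brownian P W).
Notation mu := (@lebesgue_measure R).
Notation obs := (@obs_interval R).
Notation Y := (observation n W).

Lemma observation_centered f A : measurable A ->
  P (Y f @^-1` A) = P (Y f @^-1` (@centered R @^-1` A)).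
Proof.
move=> mA.
have mA' : measurable (@centered R @^-1` A).
  by apply: (sigma_sub_measurable (@finite_cylinders_measurable R)); exact: centered_preimage.
have mYA B : measurable B -> measurable (Y f @^-1` B).
  by move=> mB; have := measurable_observation n bW f measurableT mB; rewrite setTI.
have [N [mN N0 subN]] := brownian_start bW.
suff eqN B C : measurable B -> measurable C ->
    (forall w, ~ N w -> B w -> C w) -> (P B <= P C)%E.
  have YE w : ~ N w -> centered (Y f w) = Y f w.
    move=> nN; apply/funext => t; rewrite /centered {2}/observation.
    have -> : W (- 2^-1) w = 0 by apply: contrapT => h; apply: nN; exact: subN.
    by rewrite set_itv1 Rintegral_set1 mulr0 addr0 subr0.
  apply/eqP; rewrite eq_le; apply/andP; split; apply: eqN; try exact: mYA.
  - by move=> w nN /=; rewrite YE.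
  - by move=> w nN /=; rewrite YE.
move=> mB mC BC; rewrite -[leRHS]adde0 -N0.
apply: le_trans (measureU2 _ mC mN); apply: le_measure; rewrite ?inE//.
  exact: measurableU.
by move=> w Bw; have [|nN] := pselect (N w); [right|left; exact: BC].
Qed.

Variables (f g : R -> R) (e z : R).
Hypotheses (fi : mu.-integrable obs (EFin \o f)) (gi : mu.-integrable obs (EFin \o g)).
Hypothesis gf2i : mu.-integrable obs (EFin \o (fun x => (g x - f x) ^+ 2)).
Hypotheses (e0 : 0 <= e) (gfe : n * \int[mu]_(x in obs) (g x - f x) ^+ 2 <= e ^+ 2).

(** The event that approximates A may exceed the level slightly; [power_bound] quantifies what this
    costs. *)
Theorem testing A : measurable A ->
  (P (Y g @^-1` A) <= gauss `]-oo, (- z)%R])%E ->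
  (P (Y f @^-1` A) <= gauss `]-oo, (e - z)%R])%E.
Proof.
move=> mA; rewrite (observation_centered f mA) (observation_centered g mA).
set A' := @centered R @^-1` A => gA.
have sA' : <<s @finite_cylinders R >> A' by exact: centered_preimage.
have mA' : measurable A' by exact: sigma_sub_measurable (@finite_cylinders_measurable R) _ sA'.
have fin u B : measurable B -> P (Y u @^-1` B) \is a fin_num.
  exact: (probability_observation_fin n bW).
have gfin (x : R) : gauss `]-oo, x] \is a fin_num by exact: fin_num_measure.
(* The sum of the laws under f and g, so that a single event approximates A' under both. *)
pose m := measure_add (image_law P (measurable_observation n bW f))
                      (image_law P (measurable_observation n bW g)).
have mE B : m B = (P (Y f @^-1` B) + P (Y g @^-1` B))%E by rewrite /m measure_addE.
have moo : (m setT < +oo)%E by rewrite mE ltey_eq fin_numD !fin.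
pose C := expR (`|z| * e).
have C0 : 0 <= C by exact: expR_ge0.
have close u B (r : R) : measurable B -> (m (symdiff A' B) < r%:E)%E ->
    (P (Y u @^-1` symdiff A' B) <= m (symdiff A' B))%E ->
    fine (P (Y u @^-1` A')) <= fine (P (Y u @^-1` B)) + r /\
    fine (P (Y u @^-1` B)) <= fine (P (Y u @^-1` A')) + r.
  move=> mB AB leD.
  have mD : measurable (symdiff A' B) by exact: measurable_symdiff.
  have Dr : fine (P (Y u @^-1` symdiff A' B)) <= r.
    by rewrite -lee_fin fineK ?fin//; apply: le_trans leD (ltW AB).
  have mY D : measurable D -> measurable (Y u @^-1` D).
    by move=> mD'; have := measurable_observation n bW u measurableT mD'; rewrite setTI.
  have cover C1 C2 : measurable C1 -> measurable C2 ->
      C1 `<=` C2 `|` symdiff A' B ->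
      fine (P (Y u @^-1` C1)) <= fine (P (Y u @^-1` C2)) + r.
    move=> m1 m2 sub; apply: le_trans (lerD (lexx _) Dr).
    rewrite -fineD ?fin//; apply: fine_le; rewrite ?fin_numD ?fin//.
    apply: le_trans (measureU2 _ (mY _ m2) (mY _ mD)).
    apply: le_measure; rewrite ?inE; [exact: mY|by apply: measurableU; exact: mY|].
    by move=> w /sub.
  by split; apply: cover => // x Cx; rewrite /symdiff /=;
    [have [?|?] := pselect (B x)|have [?|?] := pselect (A' x)]; tauto.
(* An error r from the approximation under f, and C r from the excess over the level under g. *)
have key (r : R) : 0 < r ->
    fine (P (Y f @^-1` A')) <= fine (gauss `]-oo, e - z]) + (C * r + r).
  move=> r0.
  have [B SB AB] := algebra_approximation moo (@finite_cylinders_measurable R)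
    finite_cylinders0 (@finite_cylindersC R) (@finite_cylindersU R) sA' r0.
  have mB := finite_cylinders_measurable SB.
  have mD : measurable (symdiff A' B) by exact: measurable_symdiff.
  have [f1 _] := close f B r mB AB ltac:(by rewrite mE leeDl).
  have [_ g1] := close g B r mB AB ltac:(by rewrite mE leeDr).
  have [s os sB] := SB.
  have [t [k [ot tt sub]]] := finite_cylinders_increments os.
  have := testing_increments n0 bW z fi gi gf2i e0 gfe ot tt (sub _ sB).
  rewrite /power_bound -/C => fB.
  have : fine (P (Y g @^-1` A')) <= fine (gauss `]-oo, - z]) by apply: fine_le => //; exact: fin.
  set pg := fine (P (Y g @^-1` A')) in g1 *; set al := fine (gauss `]-oo, - z]) in fB *.
  move=> pgal.
  have mx : Num.max 0 (fine (P (Y g @^-1` B)) - al) <= r.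
    by rewrite ge_max (ltW r0)/=; lra.
  have := ler_wpM2l C0 mx; lra.
rewrite -(fineK (fin f _ mA')) -(fineK (gfin _)) lee_fin.
apply/ler_addgt0Pr => r r0.
have C1 : 0 < C + 1 by rewrite ltr_pwDr.
have := key (r / (C + 1)) (divr_gt0 r0 C1).
rewrite -[X in C * _ + X]mul1r -mulrDl [(C + 1) * _]mulrC divfK//.
by rewrite gt_eqF.
Qed.

End Testing.

(** * Lower bound on the expected length *)

Section GaussTail.
Context {R : realType}.
Notation gauss := (@gauss R).
Local Open Scope ereal_scope.

Definition gauss_tail (u : R) : \bar R := gauss `]u, +oo[%classic.

Lemma measurable_gauss_tail : measurable_fun [set: R] gauss_tail.
Proof.
have mL : measurable [set p : R * R | (p.1 < p.2)%R].
  rewrite -[X in measurable X]setTI.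
  rewrite (_ : [set p | _] = [set p : R * R | (p.1%:E < p.2%:E)]); last first.
    by apply/seteqP; split => p /=; rewrite lte_fin.
  by apply: measurable_lte => //; apply/measurable_EFinP.
apply: (eq_measurable_fun (gauss \o xsection [set p : R * R | (p.1 < p.2)%R])).
  move=> u _ /=; congr (gauss _); apply/seteqP; split => x /=.
    by rewrite /xsection /= inE /= in_itv/= andbT.
  by rewrite /xsection /= inE /= in_itv/= andbT.
exact: measurable_fun_xsection.
Qed.

Lemma gauss_set1 (x : R) : gauss [set x] = 0.
Proof.
have : normal_prob 0%R 1%R [set x] = 0 :> \bar R.
  by rewrite /normal_prob integral_set1.
by [].
Qed.

Lemma gauss_opp_set (A : set R) : measurable A ->
  gauss ((fun x => - x)%R @^-1` A) = gauss A.
Proof.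
move=> mA.
have mA' : measurable ((fun x : R => - x)%R @^-1` A).
  have h : measurable_fun [set: R] (fun x : R => - x)%R by exact: measurable_funN.
  by have := h measurableT A mA; rewrite setTI.
transitivity (\int[gauss]_x (\1_((fun x => - x)%R @^-1` A) x)%:E).
  by rewrite integral_indic// setIT.
transitivity (\int[gauss]_x (\1_A x)%:E); last by rewrite integral_indic// setIT.
rewrite -(@gauss_opp _ (fun x => (\1_A x)%:E))//.
by apply/measurable_EFinP.
Qed.

Lemma gauss_tailC (u : R) : gauss_tail u = 1 - gauss `]-oo, u]%classic.
Proof.
rewrite -(@probability_setC _ _ _ gauss)//; congr (gauss _).
by rewrite setCitvl.
Qed.

Lemma gauss_tail_opp (u : R) : gauss_tail (- u) = gauss `]-oo, u]%classic.
Proof.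
rewrite -(gauss_opp_set (A := `]-oo, u]%classic))//.
rewrite (_ : (fun x => - x)%R @^-1` _ = [set (- u)%R] `|` `](- u)%R, +oo[%classic).
  rewrite measureU//; first by rewrite -[LHS]add0e; congr (_ + _); exact/esym/gauss_set1.
  by apply/seteqP; split => // x [/= ->]; rewrite in_itv/= ltxx.
apply/seteqP; split => x /=; rewrite !in_itv/= andbT.
  by rewrite lerNl le_eqVlt => /predU1P[->|]; [left|right].
by move=> [->|/ltW]; rewrite ?opprK// lerNl.
Qed.

Lemma gauss_tail_add_opp (u : R) : gauss_tail u + gauss_tail (- u) = 1.
Proof. by rewrite gauss_tail_opp gauss_tailC subeK// fin_num_measure. Qed.

Lemma gauss_tail_ge0 (u : R) : 0 <= gauss_tail u.
Proof. exact: measure_ge0. Qed.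

(** Reflection preserves the integral and the tails at u and -u add up to 1, so twice the integral
    is the length 2 z of the interval. *)
Lemma integral_gauss_tail (z : R) : (0 <= z)%R ->
  \int[leb]_u ((\1_(`[(- z)%R, z]%classic) u : R)%:E * gauss_tail u) = z%:E.
Proof.
move=> z0; pose F u := (\1_(`[(- z)%R, z]%classic) u : R)%:E * gauss_tail u.
have mI : measurable_fun [set: R] (fun u : R => (\1_(`[(- z)%R, z]%classic) u : R)%:E).
  by apply/measurable_EFinP.
have mF : measurable_fun [set: R] F.
  by apply: emeasurable_funM => //; exact: measurable_gauss_tail.
have F0 u : 0 <= F u by rewrite mule_ge0// ?gauss_tail_ge0// lee_fin.
have FN : \int[leb]_u F u = \int[leb]_u F (- u)%R.
  rewrite (@ge0_integral_leb_affine _ F (-1)%R 0%R)// normrN1 mul1e.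
  by apply: eq_integral => u _; rewrite mulN1r addr0.
have mFN : measurable_fun [set: R] (fun u => F (- u)%R).
  exact: measurableT_comp.
have FD : \int[leb]_u F u + \int[leb]_u F u = \int[leb]_u (F u + F (- u)%R).
  by rewrite {2}FN -(ge0_integralD _ measurableT (fun u _ => F0 u) mF (fun u _ => F0 _) mFN).
have {FD FN} : \int[leb]_u F u + \int[leb]_u F u = (z + z)%:E.
  rewrite {}FD {FN}.
  transitivity (\int[leb]_u (\1_(`[(- z)%R, z]%classic) u : R)%:E).
    apply: eq_integral => u _; rewrite /F.
    rewrite (_ : \1_(`[(- z)%R, z]%classic) (- u)%R = \1_(`[(- z)%R, z]%classic) u :> R).
      by rewrite -ge0_muleDr ?gauss_tail_ge0// gauss_tail_add_opp mule1.
    rewrite !indicE; congr ((nat_of_bool _)%:R).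
    by apply/idP/idP; rewrite !inE /= !in_itv/= => /andP[? ?]; apply/andP; split; lra.
  rewrite integral_indic// setIT.
  transitivity (@lebesgue_measure R `[(- z)%R, z]%classic) => //.
  rewrite lebesgue_measure_itv/= lte_fin.
  have [zz|zz] := ltP (- z)%R z; first by rewrite -EFinD opprK.
  by congr EFin; lra.
rewrite -/F; case: (\int[leb]_u F u) => [r| |]//= /eqP.
by rewrite -EFinD eqe => /eqP h; congr EFin; lra.
Qed.

End GaussTail.

Section LowerBound.
Context {R : realType} (d : measure_display) (T : measurableType d).
Variables (P : probability T R) (n : R) (W : R -> T -> R).
Hypotheses (n0 : 0 < n) (bW : brownian P W).
Notation mu := (@lebesgue_measure R).
Notation obs := (@obs_interval R).
Notation Y := (observation n W).
Local Open Scope ereal_scope.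

(** Tonelli on the set of pairs (w, x) with x in the random interval; joint measurability of the
    graph makes this set measurable. *)
Lemma expected_length_Tonelli f (C : path_space R -> set R) :
  measurable [set yx : path_space R * R | C yx.1 yx.2] ->
  measurable_fun setT (fun x : R => P [set w | C (Y f w) x]) /\
  expected_length P n W f C = \int[leb]_x P [set w | C (Y f w) x].
Proof.
move=> mC.
pose G := [set wx : T * R | C (Y f wx.1) wx.2].
have mG : measurable G.
  have h : measurable_fun setT (fun wx : T * R => (Y f wx.1, wx.2)).
    apply: measurable_fun_pair => //.
    exact: measurableT_comp (measurable_observation n bW f) _.
  by have := h measurableT _ mC; rewrite setTI.
have yG x : ysection G x = [set w | C (Y f w) x].
  by apply/seteqP; split => w; rewrite /ysection /= inE.
have xG w : xsection G w = C (Y f w).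
  by apply/seteqP; split => x; rewrite /xsection /= inE.
split.
  have := measurable_fun_ysection P mG.
  by apply: eq_measurable_fun => x _ /=; rewrite yG.
have := indic_fubini_tonelli P (@leb R) mG.
rewrite indic_fubini_tonelli_FE// indic_fubini_tonelli_GE//.
rewrite /expected_length /= => E.
transitivity (\int[P]_w (leb \o xsection G) w).
  by apply: eq_integral => w _ /=; rewrite xG.
by rewrite E; apply: eq_integral => x _ /=; rewrite yG.
Qed.

Variables (a z : R) (f c : R -> R) (e : R).
Hypotheses (za : gauss `]-oo, (- z)%R]%classic = a%:E) (z0 : (0 <= z)%R).
Hypotheses (fi : mu.-integrable obs (EFin \o f)) (ci : mu.-integrable obs (EFin \o c)).
Hypothesis c2i : mu.-integrable obs (EFin \o (fun x => c x ^+ 2)%R).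
Hypothesis cF : forall t, (0 <= t <= 1)%R -> Fc (fun x => f x + t * c x)%R.
Hypotheses (c0 : (0 < c 0)%R) (e0 : (0 < e)%R) (ze : (2 * z <= e)%R).
Hypothesis ce : (n * \int[mu]_(x in obs) c x ^+ 2 <= e ^+ 2)%R.

(** Missing the value at 0 of g = f + t c has probability at most a under g, and the testing bound
    with shift t e limits its probability under f. *)
Lemma cover_probability_ge (C : path_space R -> set R) t :
  I_ a P n W C -> (0 <= t <= 1)%R ->
  gauss_tail (t * e - z) <= P [set w | C (Y f w) (f 0 + t * c 0)%R].
Proof.
move=> [mC _ covC] /andP[t0 t1].
pose g x := (f x + t * c x)%R.
have Fg : Fc g by apply: cF; rewrite t0.
have mobs := (measurable_obs : measurable (obs : set (measurableTypeR R))).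
have tci : mu.-integrable obs (EFin \o (fun x => t * c x)%R).
  have := integrableZl mobs t ci.
  by apply: eq_integrable => // x _; rewrite /= EFinM.
have gi : mu.-integrable obs (EFin \o g).
  by have := integrableD mobs fi tci; apply: eq_integrable.
pose A := [set y : path_space R | C y (g 0%R)].
have mA : measurable A.
  have h : measurable_fun setT (fun y : path_space R => (y, g 0%R)).
    exact: measurable_fun_pair.
  by have := h measurableT _ mC; rewrite setTI.
have mY u B : measurable B -> measurable (Y u @^-1` B).
  by move=> mB; have := measurable_observation n bW u measurableT mB; rewrite setTI.
have gfE x : (g x - f x = t * c x)%R by rewrite /g addrC addKr.
have gf2 x : ((g x - f x) ^+ 2 = t ^+ 2 * c x ^+ 2)%R by rewrite gfE exprMn.
have gf2i : mu.-integrable obs (EFin \o (fun x => (g x - f x) ^+ 2)%R).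
  have := integrableZl mobs (t ^+ 2)%R c2i.
  by apply: eq_integrable => // x _; rewrite /= gf2 EFinM.
have te0 : (0 <= t * e)%R by rewrite mulr_ge0// ltW.
have gfe : (n * \int[mu]_(x in obs) (g x - f x) ^+ 2 <= (t * e) ^+ 2)%R.
  under eq_Rintegral do rewrite gf2.
  rewrite RintegralZl// mulrCA exprMn ler_wpM2l// sqr_ge0.
  by [].
have miss : P (Y g @^-1` (~` A)) <= gauss `]-oo, (- z)%R]%classic.
  rewrite za -[Y g @^-1` _]/(~` (Y g @^-1` A)) probability_setC; last exact: mY.
  have := covC _ Fg; rewrite -[X in _ <= X -> _]/(P (Y g @^-1` A)).
  have : P (Y g @^-1` A) \is a fin_num by exact: fin_num_measure (mY _ _ mA).
  case: (P (Y g @^-1` A)) => // p _; rewrite -EFinB !lee_fin; lra.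
have := testing n0 bW fi gi gf2i te0 gfe (measurableC mA) miss.
rewrite gauss_tailC -[Y f @^-1` _]/(~` (Y f @^-1` A)) probability_setC; last exact: mY.
have : P (Y f @^-1` A) \is a fin_num by exact: fin_num_measure (mY _ _ mA).
have : gauss `]-oo, (t * e - z)%R]%classic \is a fin_num by exact: fin_num_measure.
rewrite -[X in _ -> _ -> _ -> _ <= X]/(P (Y f @^-1` A)).
case: (P (Y f @^-1` A)) => // p; case: (gauss _) => // q _ _.
by rewrite -!EFinB !lee_fin; lra.
Qed.

(** Points are written f(0) + t c(0) with t = (u + z) / e, which makes the coverage bound exactly
    [gauss_tail u]; 2 z <= e keeps t in [0, 1] for u in [-z, z]. *)
Lemma lower_bound (C : path_space R -> set R) : I_ a P n W C ->
  (c 0 * z / e)%:E <= expected_length P n W f C.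
Proof.
move=> IC; have [mC _ _] := IC.
have [mP ->] := expected_length_Tonelli f mC.
pose s := (c 0 / e)%R; have s0 : (0 < s)%R by rewrite divr_gt0.
rewrite (_ : c 0 * z / e = s * z)%R; last by rewrite /s mulrAC.
(* Only points with [u] in [-z, z] are used: there the tails at u and -u add up to 1. *)
rewrite EFinM -(integral_gauss_tail z0).
rewrite (@ge0_integral_leb_affine _ (fun x => P [set w | C (Y f w) x])
  s (f 0 + s * z)%R)//; last by rewrite gt_eqF.
rewrite gtr0_norm//; apply: lee_pmul => //; first by rewrite lee_fin ltW.
- by apply: integral_ge0 => u _; rewrite mule_ge0// ?gauss_tail_ge0// lee_fin.
apply: ge0_le_integral => //.
- by move=> u _; rewrite mule_ge0// ?gauss_tail_ge0// lee_fin.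
- by apply: emeasurable_funM; [apply/measurable_EFinP|exact: measurable_gauss_tail].
- apply: measurableT_comp mP _; exact: measurable_affine.
move=> u _; rewrite indicE.
case: (boolP (u \in _)) => [|_]; last by rewrite mul0e.
rewrite inE /= in_itv/= mul1e => /andP[u1 u2].
have := @cover_probability_ge C ((u + z) / e)%R IC.
rewrite divfK ?gt_eqF// addrK.
rewrite (_ : f 0 + (u + z) / e * c 0 = s * u + (f 0 + s * z))%R; last first.
  by rewrite /s; field; rewrite gt_eqF.
have uz0 : (0 <= u + z)%R by rewrite -lerBlDr sub0r.
have uze : (u + z <= e)%R by rewrite (le_trans _ ze)// mulr_natl mulr2n lerD2r.
by apply; rewrite divr_ge0 ?(ltW e0)//= ler_pdivrMr// mul1r.
Qed.

Lemma Lstar_ge : (c 0 * z / e)%:E <= Lstar a P n W f.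
Proof. by apply: le_ereal_inf_tmp => _ [C IC <-]; exact: lower_bound. Qed.

End LowerBound.

(** * Convex functions *)

Section ConvexFunctions.
Context {R : realType}.
Notation mu := (@lebesgue_measure R).
Notation obs := (@obs_interval R).
Implicit Types (f g : R -> R) (x y t : R).

Lemma FcP f : Fc f <-> forall t x y, 0 <= t <= 1 -> obs x -> obs y ->
  f (t * x + (1 - t) * y) <= t * f x + (1 - t) * f y.
Proof.
split=> [Ff t x y /andP[t0 t1] ox oy|Ff t x y /set_mem ox /set_mem oy].
  exact: (Ff (Itv01 t0 t1) x y (mem_set ox) (mem_set oy)).
by apply: (Ff t%:num x y _ ox oy); rewrite ge0 le1.
Qed.

(** From above by convexity between the two ends of the interval; from below by reflection, as f(0)
    is at most the mean of f(x) and f(-x). *)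
Lemma Fc_bounded f : Fc f -> exists M, forall x, obs x -> `|f x| <= M.
Proof.
move=> /FcP Ff; pose U := `|f (- 2^-1)| + `|f 2^-1|.
have ub x : obs x -> f x <= U.
  move=> /obsE/andP[x1 x2].
  have h : 0 <= 2^-1 - x <= 1 by lra.
  have ol : obs (- 2^-1) by apply/obsE; lra.
  have or : obs 2^-1 by apply/obsE; lra.
  have := Ff _ _ _ h ol or.
  rewrite (_ : _ * - 2^-1 + _ = x); last by field.
  have := ler_norm (f (- 2^-1)); have := ler_norm (f 2^-1).
  have := normr_ge0 (f (- 2^-1)); have := normr_ge0 (f 2^-1).
  rewrite /U; nra.
exists (U + 2 * `|f 0|) => x ox; rewrite ler_norml.
have ox' : obs (- x) by move: ox => /obsE ?; apply/obsE; lra.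
have h : 0 <= (2^-1 : R) <= 1 by rewrite invr_ge0 ler0n invf_le1 ?ltr0n// ler1n.
have := Ff _ _ _ h ox ox'.
rewrite (_ : _ * x + _ = 0); last by field.
have := ub _ ox; have := ub _ ox'; have := ler_norm (f 0); have := ler_norm (- f 0).
rewrite normrN; lra.
Qed.

(** Strict sublevel sets of a convex function are intervals; continuity could fail at the ends of
    the interval. *)
Lemma Fc_measurable f : Fc f -> measurable_fun obs f.
Proof.
move=> /FcP Ff mD; apply: (measurability _ (RGenInftyO.measurableE R)) => //.
move=> _ [_ [a ->] <-].
apply: is_interval_measurable => x y [ox fx] [oy fy] z /andP[xz zy].
split; first by move: ox oy => /obsE ? /obsE ?; apply/obsE; lra.
have [xy|xy] := ltP x y; last by rewrite (_ : z = x)//; lra.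
move: fx fy; rewrite /= !in_itv/= => fx fy.
have yx : 0 < y - x by rewrite subr_gt0.
pose t := (y - z) / (y - x).
have t01 : 0 <= t <= 1 by apply/andP; split; [apply: divr_ge0|rewrite ler_pdivrMr// mul1r]; lra.
have := Ff t x y t01 ox oy.
rewrite (_ : t * x + (1 - t) * y = z); last by rewrite /t; field; rewrite gt_eqF.
move: t01 => /andP[t0 t1] fz.
pose M := Num.max (f x) (f y).
have Ma : M < a by rewrite gt_max fx fy.
have xM : f x <= M by rewrite le_max lexx.
have yM : f y <= M by rewrite le_max lexx orbT.
have h1 : t * f x <= t * M by exact: ler_wpM2l.
have h2 : (1 - t) * f y <= (1 - t) * M by apply: ler_wpM2l => //; lra.
by apply: le_lt_trans fz _; lra.
Qed.

Lemma obs_lty : (mu obs < +oo)%E.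
Proof.
rewrite /obs_interval lebesgue_measure_itv/=.
by case: ifP => _; rewrite ?ltry// -EFinD ltry.
Qed.

Lemma Fc_integrable f : Fc f -> mu.-integrable obs (EFin \o f).
Proof.
move=> Ff; have [M fM] := Fc_bounded Ff.
apply: (@le_bound_integrable _ _ f M) => //.
- exact: measurable_obs.
- exact: obs_lty.
- exact: Fc_measurable.
Qed.

Lemma Fc_convex f g t : 0 <= t <= 1 -> Fc f -> Fc g ->
  Fc (fun x => f x + t * (g x - f x)).
Proof.
move=> /andP[t0 t1] /FcP Ff /FcP Fg; apply/FcP => s x y s01 ox oy.
have := Ff s x y s01 ox oy; have := Fg s x y s01 ox oy.
nra.
Qed.

Lemma Fc_max_affine f (p q : R) : Fc f -> Fc (fun x => Num.max (f x) (p + q * x)).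
Proof.
move=> /FcP Ff; apply/FcP => s x y s01 ox oy.
rewrite ge_max; have /andP[s0 s1] := s01.
have h1 : f x <= Num.max (f x) (p + q * x) by rewrite le_max lexx.
have h2 : p + q * x <= Num.max (f x) (p + q * x) by rewrite le_max lexx orbT.
have h3 : f y <= Num.max (f y) (p + q * y) by rewrite le_max lexx.
have h4 : p + q * y <= Num.max (f y) (p + q * y) by rewrite le_max lexx orbT.
by apply/andP; split; [have := Ff s x y s01 ox oy|]; nra.
Qed.

Lemma Fc_add_cst f (p : R) : Fc f -> Fc (fun x => f x + p).
Proof.
by move=> /FcP Ff; apply/FcP => s x y s01 ox oy; have := Ff s x y s01 ox oy; lra.
Qed.

End ConvexFunctions.

Section SymmetricIntegral.
Context {R : realType}.
Notation mu := (@lebesgue_measure R).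
Notation obs := (@obs_interval R).
Implicit Types (g : R -> R) (h : R).

Lemma Rintegral_scale g (D : set R) h : h != 0 -> measurable D ->
  mu.-integrable D (EFin \o g) ->
  \int[mu]_(x in D) g x =
  `|h| * \int[mu]_(u in (fun u => h * u) @^-1` D) g (h * u).
Proof.
move=> h0 mD gi; pose G := (EFin \o g) \_ D.
have mG : measurable_fun setT G.
  by apply/(measurable_restrictT _ _).1 => //; exact: measurable_int gi.
have mh : measurable_fun [set: R] (fun u : R => h * u) by exact: measurable_funM.
have Gh u : ((EFin \o (fun u => g (h * u))) \_ ((fun u => h * u) @^-1` D)) u = G (h * u).
  by rewrite /G !patchE.
pose H : R -> \bar R := fun u => G (h * u).
have posE : (\int[mu]_x (G^\+ x) = `|h|%:E * \int[mu]_u (H^\+ u))%E.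
  rewrite (@ge0_integral_affine _ _ h 0)//; last exact: measurable_funepos.
  by congr *%E; apply: eq_integral => u _; rewrite !funeposE /H addr0.
have negE : (\int[mu]_x (G^\- x) = `|h|%:E * \int[mu]_u (H^\- u))%E.
  rewrite (@ge0_integral_affine _ _ h 0)//; last exact: measurable_funeneg.
  by congr *%E; apply: eq_integral => u _; rewrite !funenegE /H addr0.
have Gi : mu.-integrable setT G by apply/(integrable_mkcond _ _).1.
have posfin := integrable_pos_fin_num measurableT Gi.
have negfin := integrable_neg_fin_num measurableT Gi.
have fin1 (x : \bar R) : (`|h|%:E * x)%E \is a fin_num -> x \is a fin_num.
  have h2 : (0 < `|h|%:E)%E by rewrite lte_fin normr_gt0.
  by case: x => [r|//|]; rewrite ?gt0_muley ?gt0_muleNy.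
have p2 : (\int[mu]_u (H^\+ u))%E \is a fin_num by apply: fin1; rewrite -posE.
have n2 : (\int[mu]_u (H^\- u))%E \is a fin_num by apply: fin1; rewrite -negE.
have RE : (\int[mu]_(u in (fun u => (h * u)%R) @^-1` D) (g (h * u)%R)%:E =
    \int[mu]_u H u)%E.
  by rewrite integral_mkcond; apply: eq_integral => u _; exact: Gh.
rewrite /Rintegral RE integral_mkcond -/G integralE posE negE [in RHS]integralE.
by rewrite -(fineK p2) -(fineK n2) -!EFinM -!EFinB /= mulrBr.
Qed.

End SymmetricIntegral.

Section Averages.
Context {R : realType}.
Notation mu := (@lebesgue_measure R).
Notation obs := (@obs_interval R).
Implicit Types (f g : R -> R) (h u : R).

(** A class closed under sums, products and rescaling, with members integrable on sets of finite
    measure; it settles integrability conditions uniformly. *)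
Definition bounded_measurable (D : set R) g :=
  measurable_fun D g /\ exists M, forall x, D x -> `|g x| <= M.

Lemma Fc_bounded_measurable f : Fc f -> bounded_measurable obs f.
Proof. by move=> Ff; split; [exact: Fc_measurable|exact: Fc_bounded]. Qed.

Lemma bounded_measurable_integrable D g : measurable D -> (mu D < +oo)%E ->
  bounded_measurable D g -> mu.-integrable D (EFin \o g).
Proof. by move=> mD Doo [mg [M gM]]; exact: (@le_bound_integrable _ _ _ M). Qed.

Lemma bounded_measurableD D f g : bounded_measurable D f ->
  bounded_measurable D g -> bounded_measurable D (fun x => f x + g x).
Proof.
move=> [mf [M fM]] [mg [N gN]]; split; first exact: measurable_funD.
by exists (M + N) => x Dx; rewrite (le_trans (ler_normD _ _))// lerD ?fM ?gN.
Qed.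

Lemma bounded_measurableM D f g : bounded_measurable D f ->
  bounded_measurable D g -> bounded_measurable D (fun x => f x * g x).
Proof.
move=> [mf [M fM]] [mg [N gN]]; split; first exact: measurable_funM.
by exists (M * N) => x Dx; rewrite normrM ler_pM ?fM ?gN.
Qed.

Lemma bounded_measurable_cst D (k : R) : bounded_measurable D (fun=> k).
Proof. by split; [exact: measurable_cst|exists `|k|]. Qed.

Lemma bounded_measurable_id : bounded_measurable `[0, 1] (fun x : R => x).
Proof.
split; first exact: measurable_id.
by exists 1 => x /=; rewrite in_itv/= => /andP[x0 x1]; rewrite ger0_norm.
Qed.

Lemma bounded_measurable_scale g h : `|h| <= 2^-1 -> bounded_measurable obs g ->
  bounded_measurable `[0, 1] (fun u => g (h * u)).
Proof.
move=> h2 [mg [M gM]].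
have sub : (fun u => h * u) @` `[0, 1] `<=` obs.
  move=> _ [u /= + <-]; rewrite in_itv/= => /andP[u0 u1]; apply/obsE.
  by rewrite -ler_norml normrM (le_trans _ h2)// ler_piMr// ger0_norm.
split.
  apply: (measurable_comp measurable_obs sub mg).
  exact: measurable_funM.
by exists M => u u01; apply: gM; apply: sub; exists u.
Qed.

Lemma unit_lty : (mu `[0%R, 1%R]%classic < +oo)%E.
Proof. by rewrite lebesgue_measure_itv/= lte_fin ltr01 -EFinD ltry. Qed.

Lemma unit_integrable g : bounded_measurable `[0, 1] g ->
  mu.-integrable `[0, 1] (EFin \o g).
Proof.
apply: bounded_measurable_integrable; [exact: measurable_itv|exact: unit_lty].
Qed.

Lemma obs_integrable g : bounded_measurable obs g -> mu.-integrable obs (EFin \o g).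
Proof.
apply: bounded_measurable_integrable; [exact: measurable_obs|exact: obs_lty].
Qed.

Notation "'I01' f" := (\int[mu]_(u in `[0, 1]) f u) (at level 10, f at level 8).

Lemma unitD f g : bounded_measurable `[0, 1] f -> bounded_measurable `[0, 1] g ->
  \int[mu]_(u in `[0, 1]) (f u + g u) =
  \int[mu]_(u in `[0, 1]) f u + \int[mu]_(u in `[0, 1]) g u.
Proof. by move=> bf bg; rewrite RintegralD//; exact: unit_integrable. Qed.

Lemma unitZ f (k : R) : bounded_measurable `[0, 1] f ->
  \int[mu]_(u in `[0, 1]) (k * f u) = k * \int[mu]_(u in `[0, 1]) f u.
Proof. by move=> bf; rewrite RintegralZl//; exact: unit_integrable. Qed.

Lemma unit_cst (k : R) : \int[mu]_(u in `[0, 1]) k = k.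
Proof.
rewrite Rintegral_cst//.
have -> : fine (mu `[0%R, 1%R]%classic) = 1.
  by rewrite lebesgue_measure_itv/= lte_fin ltr01 -EFinD subr0.
by rewrite mulr1.
Qed.

Lemma unit_id : \int[mu]_(u in `[0, 1]) u = 2^-1 :> R.
Proof.
have := @Rintegral_onemXn R 1.
have b1 : bounded_measurable `[0, 1] (fun u : R => -1 * u).
  by apply: bounded_measurableM; [exact: bounded_measurable_cst|exact: bounded_measurable_id].
under eq_Rintegral do rewrite expr1 /unstable.onem addrC -mulN1r.
rewrite unitD//; last exact: bounded_measurable_cst.
rewrite unitZ; last exact: bounded_measurable_id.
rewrite unit_cst; lra.
Qed.

Lemma unit_sqr : \int[mu]_(u in `[0, 1]) (u ^+ 2) = 3^-1 :> R.
Proof.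
have := @Rintegral_onemXn R 2.
have bi := bounded_measurable_id.
have b2 : bounded_measurable `[0, 1] (fun u : R => u * u) by exact: bounded_measurableM.
have b1 : bounded_measurable `[0, 1] (fun u : R => (-2) * u).
  by apply: bounded_measurableM => //; exact: bounded_measurable_cst.
have b3 : bounded_measurable `[0, 1] (fun u : R => 1 + (-2) * u).
  by apply: bounded_measurableD => //; exact: bounded_measurable_cst.
rewrite (_ : \int[mu]_(x in `[0, 1]) _ =
    \int[mu]_(u in `[0, 1]) ((1 + (-2) * u) + u * u)); last first.
  by apply: eq_Rintegral => u _; rewrite /unstable.onem; ring.
rewrite unitD// unitD//; last exact: bounded_measurable_cst.
rewrite unitZ// unit_cst unit_id.
by move=> h; rewrite (_ : \int[mu]_(u in `[0, 1]) _ = \int[mu]_(u in `[0, 1]) (u * u))//; lra.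
Qed.

(** The mean of f over [-h, h], rescaled to a fixed domain so that different h can be compared under
    one integral. *)
Definition symmetric_average f h : R :=
  2^-1 * \int[mu]_(u in `[0, 1]) (f (h * u) + f (- h * u)).

Lemma Rintegral_symmetric g h : bounded_measurable obs g -> 0 < h <= 2^-1 ->
  \int[mu]_(x in `]- h, h]) g x =
  h * \int[mu]_(u in `[0, 1]) (g (h * u) + g (- h * u)).
Proof.
move=> bg /andP[h0 h2].
have hn : h != 0 by rewrite gt_eqF.
have gi := obs_integrable bg.
have sub (i : interval R) : (forall x, x \in i -> - h <= x <= h) ->
    mu.-integrable [set` i] (EFin \o g).
  move=> ih; apply: integrableS gi; [exact: measurable_obs|exact: measurable_itv|].
  by move=> x /= /ih ?; apply/obsE; lra.
have gi1 : mu.-integrable `]- h, h] (EFin \o g).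
  by apply: sub => x; rewrite in_itv/=; lra.
have E : \int[mu]_(x in `]- h, h]) g x =
    \int[mu]_(x in `[- h, 0]) g x + \int[mu]_(x in `[0, h]) g x.
  rewrite -(@Rintegral_itv_obnd_cbnd _ 0); last first.
    by apply: sub => x; rewrite in_itv/=; lra.
  rewrite -(@Rintegral_itvB _ g (BRight (- h)) (BRight h) 0)//; last first.
  - by rewrite bnd_simp ltW.
  - by rewrite bnd_simp; lra.
  rewrite -(@Rintegral_itv_obnd_cbnd _ (- h)); last first.
    by apply: sub => x; rewrite in_itv/=; lra.
  by rewrite addrC subrK.
rewrite E.
rewrite (Rintegral_scale (h := - h) (D := `[- h, 0]%classic)); last 3 first.
- by rewrite oppr_eq0.
- exact: measurable_itv.
- by apply: sub => x; rewrite in_itv/=; lra.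
rewrite (Rintegral_scale (h := h) (D := `[0, h]%classic))//; last first.
  by apply: sub => x; rewrite in_itv/=; lra.
rewrite normrN gtr0_norm// -mulrDr; congr (_ * _).
rewrite (_ : (fun u => - h * u) @^-1` _ = `[0, 1]%classic); last first.
  apply/seteqP; split => u /=; rewrite !in_itv/= => /andP[u1 u2]; apply/andP; split; nra.
rewrite (_ : (fun u => h * u) @^-1` _ = `[0, 1]%classic); last first.
  apply/seteqP; split => u /=; rewrite !in_itv/= => /andP[u1 u2]; apply/andP; split; nra.
rewrite addrC unitD//; apply: bounded_measurable_scale => //.
- by rewrite gtr0_norm.
- by rewrite normrN gtr0_norm.
Qed.

End Averages.

Section ConvexAverages.
Context {R : realType}.
Notation mu := (@lebesgue_measure R).
Notation obs := (@obs_interval R).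
Variable f : R -> R.
Hypothesis Ff : Fc f.
Implicit Types (h u : R).

Let bf := Fc_bounded_measurable Ff.

(** Twice the even part of f: convex and even, hence nondecreasing in the distance to 0, which
    drives the comparisons between scales. *)
Definition symmetric_part h : R := f h + f (- h).

Lemma bounded_measurable_symmetric h : 0 <= h <= 2^-1 ->
  bounded_measurable `[0, 1] (fun u => f (h * u) + f (- h * u)).
Proof.
move=> h01; apply: bounded_measurableD; apply: bounded_measurable_scale => //.
  by rewrite ger0_norm; lra.
by rewrite normrN ger0_norm; lra.
Qed.

Lemma symmetric_part_convex t x y : 0 <= t <= 1 -> obs x -> obs y ->
  symmetric_part (t * x + (1 - t) * y) <=
  t * symmetric_part x + (1 - t) * symmetric_part y.
Proof.
move=> t01 ox oy; have /FcP F := Ff.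
have ox' : obs (- x) by move: ox => /obsE ?; apply/obsE; lra.
have oy' : obs (- y) by move: oy => /obsE ?; apply/obsE; lra.
have := F t x y t01 ox oy; have := F t (- x) (- y) t01 ox' oy'.
rewrite /symmetric_part (_ : t * - x + _ = - (t * x + (1 - t) * y)); last by ring.
lra.
Qed.

Lemma symmetric_partN x : symmetric_part (- x) = symmetric_part x.
Proof. by rewrite /symmetric_part opprK addrC. Qed.

Lemma symmetric_part_scale t x : 0 <= t <= 1 -> obs x ->
  symmetric_part (t * x) <= symmetric_part x.
Proof.
move=> t01 ox.
have ox' : obs (- x) by move: ox => /obsE ?; apply/obsE; lra.
have s01 : 0 <= (1 + t) / 2 <= 1 by lra.
have := symmetric_part_convex s01 ox ox'.
rewrite symmetric_partN (_ : _ * x + _ = t * x); last by field.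
lra.
Qed.

Lemma symmetric_average_diffE h k : 0 <= h <= 2^-1 -> 0 <= k <= 2^-1 ->
  symmetric_average f h - symmetric_average f k =
  2^-1 * \int[mu]_(u in `[0, 1]) (symmetric_part (h * u) - symmetric_part (k * u)).
Proof.
move=> h01 k01; rewrite /symmetric_average -mulrBr; congr (_ * _).
rewrite -RintegralB//; last 2 first.
- by apply: unit_integrable; exact: bounded_measurable_symmetric.
- by apply: unit_integrable; exact: bounded_measurable_symmetric.
by apply: eq_Rintegral => u _; rewrite /symmetric_part !mulNr.
Qed.

Lemma bounded_measurable_symmetric_partB h k : 0 <= h <= 2^-1 -> 0 <= k <= 2^-1 ->
  bounded_measurable `[0, 1] (fun u => symmetric_part (h * u) - symmetric_part (k * u)).
Proof.
move=> h01 k01.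
rewrite (_ : (fun _ => _) = fun u => (f (h * u) + f (- h * u)) +
    (-1) * (f (k * u) + f (- k * u))); last first.
  by apply/funext => u; rewrite /symmetric_part !mulNr mul1r.
apply: bounded_measurableD; first exact: bounded_measurable_symmetric.
apply: bounded_measurableM; first exact: bounded_measurable_cst.
exact: bounded_measurable_symmetric.
Qed.

Lemma obs_scale h u : 0 <= h <= 2^-1 -> u \in `[0, 1] -> obs (h * u).
Proof.
rewrite in_itv/= => /andP[h0 h1] /andP[u0 u1]; apply/obsE; nra.
Qed.

(** Pointwise, with s the symmetric part: x/2 is one third of x plus two thirds of x/4, and s(x/4)
    <= s(x) turns the weights 1/3 and 2/3 into 1/2 and 1/2. *)
Lemma symmetric_average_diff_nonincreasing h : 0 < h <= 2^-1 ->
  symmetric_average f (h / 2) - symmetric_average f (h / 2 / 2) <=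
  symmetric_average f h - symmetric_average f (h / 2).
Proof.
move=> h01.
have h1 : 0 <= h <= 2^-1 by lra.
have h2 : 0 <= h / 2 <= 2^-1 by lra.
have h3 : 0 <= h / 2 / 2 <= 2^-1 by lra.
rewrite !symmetric_average_diffE// ler_pM2l//.
apply: le_Rintegral => //.
- by apply: unit_integrable; exact: bounded_measurable_symmetric_partB.
- by apply: unit_integrable; exact: bounded_measurable_symmetric_partB.
move=> u u01; have ou := obs_scale h1 u01; have ou4 := obs_scale h3 u01.
have t1 : 0 <= (3^-1 : R) <= 1 by rewrite invr_ge0 ler0n invf_le1 ?ltr0n// ler1n.
have t2 : 0 <= (4^-1 : R) <= 1 by rewrite invr_ge0 ler0n invf_le1 ?ltr0n// ler1n.
have := symmetric_part_convex t1 ou ou4.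
rewrite (_ : 3^-1 * _ + _ = h / 2 * u); last by field.
have := symmetric_part_scale t2 ou.
rewrite (_ : 4^-1 * _ = h / 2 / 2 * u); last by field.
lra.
Qed.

(** Pointwise, s(h u) <= u s(h) + (1 - u) s(0) and s(h u / 2) >= s(0), and u has mean 1/2. In terms
    of the chord over [-h, h]: its excess over f at 0 is at least twice the difference of the
    averages. *)
Lemma symmetric_average_diff_le h : 0 < h <= 2^-1 ->
  symmetric_average f h - symmetric_average f (h / 2) <=
  2^-1 * (2^-1 * symmetric_part h - f 0).
Proof.
move=> h01.
have h1 : 0 <= h <= 2^-1 by lra.
have h2 : 0 <= h / 2 <= 2^-1 by lra.
rewrite symmetric_average_diffE//.
have oh : obs h by apply/obsE; lra.
have o0 : obs 0 by apply/obsE; lra.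
have s0 : symmetric_part 0 = 2 * f 0 by rewrite /symmetric_part oppr0; ring.
pose k := symmetric_part h - 2 * f 0.
have bk : bounded_measurable `[0, 1] (fun u : R => k * u).
  by apply: bounded_measurableM; [exact: bounded_measurable_cst|exact: bounded_measurable_id].
have : \int[mu]_(u in `[0, 1]) (symmetric_part (h * u) - symmetric_part (h / 2 * u))
    <= \int[mu]_(u in `[0, 1]) (k * u).
  apply: le_Rintegral => //.
  - by apply: unit_integrable; exact: bounded_measurable_symmetric_partB.
  - exact: unit_integrable.
  move=> u u01; have ou2 := obs_scale h2 u01.
  have u01' : 0 <= u <= 1 by move: u01; rewrite /= in_itv.
  have := symmetric_part_convex u01' oh o0.
  rewrite (_ : u * h + _ = h * u); last by ring.
  have := @symmetric_part_scale 0 _ _ ou2; rewrite mul0r lexx ler01 s0 => /(_ isT).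
  rewrite /k; lra.
rewrite unitZ; last exact: bounded_measurable_id.
rewrite unit_id /k; lra.
Qed.

(** * The excess of the chord over f *)

Section Chord.
Variable h : R.
Hypothesis h01 : 0 < h <= 2^-1.

Definition chord (x : R) : R :=
  2^-1 * symmetric_part h + (f h - f (- h)) / (2 * h) * x.

(** On the observation interval the maximum equals f outside [-h, h], so the perturbation is local,
    and f plus a fraction of it is a convex combination of two convex functions. *)
Definition chord_excess (x : R) : R := Num.max (f x) (chord x) - f x.

Let h0 : 0 < h. Proof. by case/andP: h01. Qed.
Let oh : obs h. Proof. by apply/obsE; move: h01; lra. Qed.
Let oh' : obs (- h). Proof. by apply/obsE; move: h01; lra. Qed.

Lemma chord_excess_Fc t : 0 <= t <= 1 -> Fc (fun x => f x + t * chord_excess x).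
Proof. by move=> t01; apply: Fc_convex => //; exact: Fc_max_affine. Qed.

Lemma chord_excess_ge0 x : 0 <= chord_excess x.
Proof. by rewrite subr_ge0 le_max lexx. Qed.

Lemma chordE x : chord x = ((h + x) * f h + (h - x) * f (- h)) / (2 * h).
Proof. by rewrite /chord /symmetric_part; field; rewrite gt_eqF. Qed.

Lemma le_chord x : - h <= x <= h -> f x <= chord x.
Proof.
move=> xh; have /FcP F := Ff; have hp := h0; have hp1 := h01.
have t01 : 0 <= (h + x) / (2 * h) <= 1.
  apply/andP; split; first by apply: divr_ge0; lra.
  by rewrite ler_pdivrMr; lra.
have := F _ _ _ t01 oh oh'.
rewrite (_ : _ * h + _ = x); last by field; rewrite gt_eqF.
by rewrite chordE (_ : _ * f h + _ = ((h + x) * f h + (h - x) * f (- h)) / (2 * h))//;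
  field; rewrite gt_eqF.
Qed.

Lemma chord_excess_in x : - h <= x <= h -> chord_excess x = chord x - f x.
Proof. by move=> xh; rewrite /chord_excess (max_idPr (le_chord xh)). Qed.

Lemma chord_excess0 : chord_excess 0 = 2^-1 * symmetric_part h - f 0.
Proof.
by have hp := h0; rewrite chord_excess_in; [rewrite /chord mulr0 addr0|lra].
Qed.

(** For x > h the point h lies between -h and x, and convexity bounds f(h) in terms of f(x) and
    f(-h); symmetrically on the left. *)
Lemma chord_le x : obs x -> ~~ (- h < x <= h) -> chord x <= f x.
Proof.
move=> ox xh; have /FcP F := Ff; have hp := h0; have hp1 := h01.
have [hx|hx] := ltP h x.
  have t01 : 0 <= 2 * h / (x + h) <= 1.
    apply/andP; split; first by apply: divr_ge0; lra.
    by rewrite ler_pdivrMr; lra.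
  have := F _ _ _ t01 ox oh'.
  rewrite (_ : _ * x + _ = h); last by field; rewrite gt_eqF//; lra.
  rewrite chordE => H; rewrite ler_pdivrMr; last by lra.
  have xh0 : 0 < x + h by lra.
  have := ler_wpM2r (ltW xh0) H.
  rewrite (_ : (_ * f x + _) * (x + h) = 2 * h * f x + (x - h) * f (- h)); last first.
    by field; rewrite gt_eqF.
  lra.
have {}xh : x <= - h by rewrite leNgt; apply/negP => xh'; move: xh; rewrite xh' hx.
(* The left end counts as outside because integrals run over ]-h, h]; the chord meets f there. *)
have [->|xn] := eqVneq x (- h).
  rewrite (_ : chord (- h) = f (- h))//.
  by rewrite chordE; field; rewrite gt_eqF.
have {}xh : x < - h by rewrite lt_neqAle xn.
have t01 : 0 <= 2 * h / (h - x) <= 1.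
  apply/andP; split; first by apply: divr_ge0; lra.
  by rewrite ler_pdivrMr; lra.
have := F _ _ _ t01 ox oh.
rewrite (_ : _ * x + _ = - h); last by field; rewrite gt_eqF//; lra.
rewrite chordE => H; rewrite ler_pdivrMr; last by lra.
have xh0 : 0 < h - x by lra.
have := ler_wpM2r (ltW xh0) H.
rewrite (_ : (_ * f x + _) * (h - x) = 2 * h * f x + (- h - x) * f h); last first.
  by field; rewrite gt_eqF.
lra.
Qed.

Lemma chord_excess_out x : obs x -> ~~ (- h < x <= h) -> chord_excess x = 0.
Proof.
by move=> ox xh; rewrite /chord_excess (max_idPl (chord_le ox xh)) subrr.
Qed.

Lemma bounded_measurable_chord_excess : bounded_measurable obs chord_excess.
Proof.
have bm : bounded_measurable obs (fun x => Num.max (f x) (chord x)).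
  by apply: Fc_bounded_measurable; exact: Fc_max_affine.
rewrite (_ : chord_excess = fun x => Num.max (f x) (chord x) + (-1) * f x); last first.
  by apply/funext => x; rewrite /chord_excess mulN1r.
apply: bounded_measurableD => //; apply: bounded_measurableM => //.
exact: bounded_measurable_cst.
Qed.

(* The excess is concave on [-h, h], nonnegative and vanishes at both ends, so
   with A its value at 0 and p, q its values at hu and -hu one has p + q <= 2A
   and p, q <= A (1 + u); hence p^2 + q^2 <= 2 A^2 (1 + u^2). *)
Lemma chord_excess_sqr_le u : 0 <= u <= 1 ->
  chord_excess (h * u) ^+ 2 + chord_excess (- h * u) ^+ 2 <=
  2 * chord_excess 0 ^+ 2 * (1 + u * u).
Proof.
move=> u01; have /andP[u0 u1] := u01; have /FcP F := Ff.
have hp := h0; have hp1 := h01.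
have hu1 : - h <= h * u <= h by apply/andP; split; nra.
have hu2 : - h <= - h * u <= h by apply/andP; split; nra.
have h00 : - h <= 0 <= h by lra.
have ou : obs (h * u) by apply/obsE; nra.
have ou' : obs (- h * u) by apply/obsE; nra.
have p0 := chord_excess_ge0 (h * u); have q0 := chord_excess_ge0 (- h * u).
have A0 := chord_excess_ge0 0.
move: p0 q0 A0; rewrite !chord_excess_in//.
set p := chord (h * u) - f (h * u); set q := chord (- h * u) - f (- h * u).
set A := chord 0 - f 0 => p0 q0 A0.
have pq : p + q <= 2 * A.
  have t01 : 0 <= (2^-1 : R) <= 1 by rewrite invr_ge0 ler0n invf_le1 ?ltr0n// ler1n.
  have := F _ _ _ t01 ou ou'.
  rewrite (_ : _ * (h * u) + _ = 0); last by field.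
  by rewrite /p /q /A /chord; lra.
have u10 : 0 < 1 + u by lra.
have t01 : 0 <= (1 + u)^-1 <= 1 by rewrite invr_ge0 ltW//= invf_le1//; lra.
(* 0 is a convex combination of x = h u or - h u, with weight 1 / (1 + u), and of the opposite end
   y, where chord and f agree. *)
have side (x y : R) : obs x -> obs y -> (1 + u)^-1 * x + (1 - (1 + u)^-1) * y = 0 ->
    chord y = f y -> chord x - f x <= A * (1 + u).
  move=> ox oy xy0 yE; have := F _ _ _ t01 ox oy; rewrite xy0 -yE => H.
  have H2 : (1 + u)^-1 * chord x + (1 - (1 + u)^-1) * chord y = chord 0.
    by rewrite -xy0 /chord; ring.
  have H3 : (1 + u)^-1 * (chord x - f x) <= A by rewrite /A; lra.
  by rewrite -ler_pdivrMr// mulrC.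
have pA : p <= A * (1 + u).
  apply: (side _ (- h)) => //; first by field; rewrite gt_eqF.
  by rewrite chordE; field; rewrite gt_eqF.
have qA : q <= A * (1 + u).
  apply: (side _ h) => //; first by field; rewrite gt_eqF.
  by rewrite chordE; field; rewrite gt_eqF.
have Au : 0 <= A * u by rewrite mulr_ge0.
(* If r <= A both squares are at most A^2. If r = A + d with d > 0, then s <= A - d and d <= A u, so
   the sum is at most 2 A^2 + 2 d^2. *)
have key (r s : R) : 0 <= s -> s <= r -> r + s <= 2 * A -> r <= A * (1 + u) ->
    r ^+ 2 + s ^+ 2 <= 2 * A ^+ 2 * (1 + u * u).
  move=> s0 sr rs rA.
  have rs0 : 0 <= r + s by lra.
  have d0 : 0 <= r - s by lra.
  have [r1|r1] := leP r A.
    have : r ^+ 2 <= A ^+ 2 by rewrite ler_sqr ?nnegrE//; lra.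
    have : s ^+ 2 <= A ^+ 2 by rewrite ler_sqr ?nnegrE//; lra.
    have : 0 <= A ^+ 2 * (u * u) by rewrite mulr_ge0 ?sqr_ge0// mulr_ge0.
    lra.
  have s2 : s ^+ 2 <= (2 * A - r) ^+ 2 by rewrite ler_sqr ?nnegrE//; lra.
  have d2 : (r - A) ^+ 2 <= (A * u) ^+ 2 by rewrite ler_sqr ?nnegrE//; lra.
  have -> : 2 * A ^+ 2 * (1 + u * u) = 2 * A ^+ 2 + 2 * (A * u) ^+ 2 by ring.
  have : r ^+ 2 + (2 * A - r) ^+ 2 = 2 * A ^+ 2 + 2 * (r - A) ^+ 2 by ring.
  lra.
have [sr|/ltW rs] := leP q p; first exact: key.
by rewrite addrC; apply: key => //; rewrite addrC.
Qed.

(** The factor 8/3 is 2 (1 + 1/3), from integrating 2 A^2 (1 + u^2) over [0, 1]. *)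
Lemma Rintegral_chord_excess_sqr_le :
  \int[mu]_(x in obs) chord_excess x ^+ 2 <= 8 / 3 * h * chord_excess 0 ^+ 2.
Proof.
have bc := bounded_measurable_chord_excess; have hp := h0; have hp1 := h01.
have bc2 : bounded_measurable obs (fun x => chord_excess x ^+ 2).
  by have := bounded_measurableM bc bc.
have -> : \int[mu]_(x in obs) chord_excess x ^+ 2 =
    \int[mu]_(x in `]- h, h]) chord_excess x ^+ 2.
  rewrite -(@setIidr _ obs `]- h, h]%classic); last first.
    by move=> x /=; rewrite in_itv/= => ?; apply/obsE; lra.
  rewrite Rintegral_mkcondr; apply: eq_Rintegral => x /set_mem ox.
  rewrite patchE; case: ifPn => //; rewrite notin_setE /= in_itv/= => /negP xh.
  by rewrite chord_excess_out// expr0n.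
rewrite (@Rintegral_symmetric _ (fun x => chord_excess x ^+ 2))//.
set A := chord_excess 0.
have bi := @bounded_measurable_id R.
have b2 : bounded_measurable `[0, 1] (fun u : R => u * u) by exact: bounded_measurableM.
have b3 : bounded_measurable `[0, 1] (fun u : R => 1 + u * u).
  by apply: bounded_measurableD => //; exact: bounded_measurable_cst.
have b4 : bounded_measurable `[0, 1] (fun u : R => 2 * A ^+ 2 * (1 + u * u)).
  by apply: bounded_measurableM => //; exact: bounded_measurable_cst.
have : \int[mu]_(u in `[0, 1]) (chord_excess (h * u) ^+ 2 + chord_excess (- h * u) ^+ 2)
    <= \int[mu]_(u in `[0, 1]) (2 * A ^+ 2 * (1 + u * u)).
  apply: le_Rintegral => //.
  - apply: unit_integrable; apply: bounded_measurableD;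
      apply: (bounded_measurable_scale _ bc2).
      by rewrite gtr0_norm//; lra.
    by rewrite normrN gtr0_norm//; lra.
  - exact: unit_integrable.
  by move=> u /=; rewrite in_itv/= => ?; exact: chord_excess_sqr_le.
have E1 : \int[mu]_(u in `[0, 1]) (2 * A ^+ 2 * (1 + u * u)) =
    2 * A ^+ 2 * \int[mu]_(u in `[0, 1]) (1 + u * u) by exact: unitZ.
have E2 : \int[mu]_(u in `[0, 1]) (1 + u * u) = 1 + 3^-1 :> R.
  rewrite -unit_sqr -[X in _ = X + _](unit_cst 1); apply: unitD => //.
  exact: bounded_measurable_cst.
rewrite E1 E2 => H.
have := ler_wpM2l (ltW h0) H; lra.
Qed.

End Chord.

End ConvexAverages.

(** * Normal quantiles *)

Section NormalTail.
Context {R : realType}.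
Notation gauss := (@gauss R).
Notation phi := (normal_pdf 0%R 1%R : R -> R).
Notation peak := (normal_peak (1 : R)).
Local Open Scope ereal_scope.

(** From 2 <= pi < 4 alone: the peak 1 / sqrt(2 pi) lies between 1 / sqrt 8, which exceeds 0.35, and
    1/2. *)
Lemma normal_peak1_bounds : (35 / 100 <= peak <= 2^-1)%R.
Proof.
rewrite /normal_peak expr1n mul1r; set s := Num.sqrt _.
have p2 : (0 <= pi *+ 2 :> R)%R by rewrite mulrn_wge0// pi_ge0.
have s0 : (0 < s)%R by rewrite sqrtr_gt0 mulrn_wgt0// pi_gt0.
have s2 : (s ^+ 2 = 2 * pi)%R by rewrite sqr_sqrtr// mulr_natl.
have := @pi_ge2 R; have := @pihalf_lt2 R => hu hl.
have sl : (2 <= s)%R by rewrite -(ler_pXn2r (n := 2))// ?nnegrE ?(ltW s0)// s2; lra.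
have su : (s <= 100 / 35)%R.
  by rewrite -(ler_pXn2r (n := 2))// ?nnegrE ?(ltW s0)// ?s2; lra.
by rewrite -[(s^-1)%R]mul1r ler_pdivlMr// ler_pdivrMr//; apply/andP; split; lra.
Qed.

Lemma gauss_tailE (x : R) : gauss_tail x =
  \int[leb]_u ((\1_(`[0%R, +oo[%classic) u : R)%:E * (phi (x + u)%R)%:E).
Proof.
rewrite -[x]opprK gauss_tail_opp opprK.
transitivity (\int[gauss]_t (\1_(`]-oo, (- x)%R]%classic) t : R)%:E).
  by rewrite integral_indic// setIT.
have mI : measurable_fun [set: R] (fun t : R => (\1_(`]-oo, (- x)%R]%classic) t : R)%:E).
  by apply/measurable_EFinP.
rewrite (ge0_integral_gauss mI); last by move=> t; rewrite lee_fin.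
rewrite (@ge0_integral_leb_affine _ _ (-1)%R (- x)%R)//; last 2 first.
- by apply: emeasurable_funM => //; exact: measurable_phi.
- by move=> t; rewrite mule_ge0// lee_fin// phi_ge0.
rewrite normrN1 mul1e; apply: eq_integral => u _.
rewrite !indicE; congr ((nat_of_bool _)%:R%:E * _).
  by apply/idP/idP; rewrite !inE /= !in_itv/= ?andbT; lra.
by rewrite !phiE mulN1r -opprD sqrrN addrC.
Qed.

(** The density at x + u is that at x times exp(- x u - u^2 / 2); dropping u^2 leaves an exponential
    density. *)
Lemma gauss_tail_le (x : R) : (0 < x)%R ->
  gauss_tail x <= (peak * expR (- x ^+ 2 / 2) / x)%:E.
Proof.
move=> x0; rewrite gauss_tailE.
have mE : measurable_fun [set: R] (EFin \o exponential_pdf x).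
  by apply/measurable_EFinP; exact: measurable_exponential_pdf.
have E0 u : 0 <= (exponential_pdf x u)%:E by rewrite lee_fin exponential_pdf_ge0// ltW.
have k0 : (0 <= peak * expR (- x ^+ 2 / 2) / x)%R.
  by rewrite divr_ge0 ?(ltW x0)// mulr_ge0 ?expR_ge0// normal_peak_ge0.
rewrite -[leRHS]mule1 -(integral_exponential_pdf x0) -ge0_integral_leb//.
rewrite -ge0_integralZl//.
apply: ge0_le_integral => //.
- by move=> u _; rewrite mule_ge0// lee_fin// phi_ge0.
- apply: emeasurable_funM; first by apply/measurable_EFinP.
  apply/measurable_EFinP; apply: (measurableT_comp (measurable_normal_pdf 0 1)).
  exact: measurable_funD.
- exact: emeasurable_funM.
move=> u _; rewrite indicE.
case: (boolP (u \in _)) => [|_]; last by rewrite mul0e mule_ge0// lee_fin.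
rewrite inE /= in_itv/= andbT mul1e => u0.
rewrite -EFinM lee_fin exponential_pdfE//=.
rewrite phiE -mulrA -!mulrA ler_wpM2l ?normal_peak_ge0//.
rewrite mulKf ?gt_eqF// -expRD ler_expR.
have : (0 <= u ^+ 2)%R by exact: sqr_ge0.
nra.
Qed.

(** For u in [0, h] one has u^2 <= h u, so the density at x + u is at least that at x times exp(- l
    u); the tail beyond x + h is discarded. *)
Lemma gauss_tail_ge (x h l : R) : (0 <= x)%R -> (0 < h)%R -> l = (x + h / 2)%R ->
  (peak * expR (- x ^+ 2 / 2) / l * (1 - expR (- l * h)))%:E <= gauss_tail x.
Proof.
move=> x0 h0 lE; rewrite gauss_tailE.
have l0 : (0 < l)%R by rewrite lE; lra.
have mE : measurable_fun [set: R] (EFin \o exponential_pdf l).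
  by apply/measurable_EFinP; exact: measurable_exponential_pdf.
have E0 u : 0 <= (exponential_pdf l u)%:E by rewrite lee_fin exponential_pdf_ge0// ltW.
have k0 : (0 <= peak * expR (- x ^+ 2 / 2) / l)%R.
  by rewrite divr_ge0 ?(ltW l0)// mulr_ge0 ?expR_ge0// normal_peak_ge0.
rewrite EFinM EFinB -(exponential_prob_itv0c l h0)// /exponential_prob.
have mI : measurable_fun [set: R] (fun u : R => (\1_(`[0%R, h]%classic) u : R)%:E).
  by apply/measurable_EFinP.
have -> : \int[lebesgue_measure]_(u in `[0%R, h]) (exponential_pdf l u)%:E =
    \int[leb]_u ((\1_(`[0%R, h]%classic) u : R)%:E * (exponential_pdf l u)%:E).
  rewrite ge0_integral_leb//; last 2 first.
  - exact: emeasurable_funM.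
  - by move=> u; rewrite mule_ge0// lee_fin.
  rewrite integral_mkcond; apply: eq_integral => u _; rewrite patchE indicE.
  by case: ifPn => _; rewrite ?mul1e ?mul0e.
rewrite -ge0_integralZl//; last 2 first.
- exact: emeasurable_funM.
- by move=> u _; rewrite mule_ge0// lee_fin.
apply: ge0_le_integral => //.
- by move=> u _; rewrite !mule_ge0// lee_fin.
- by apply: emeasurable_funM => //; exact: emeasurable_funM.
- apply: emeasurable_funM; first by apply/measurable_EFinP.
  apply/measurable_EFinP; apply: (measurableT_comp (measurable_normal_pdf 0 1)).
  exact: measurable_funD.
move=> u _; rewrite !indicE.
case: (boolP (u \in `[0%R, h]%classic)) => [|_]; last first.
  by rewrite mul0e mule0 mule_ge0// lee_fin ?phi_ge0//.
rewrite inE /= in_itv/= mul1e => /andP[u0 uh].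
rewrite mem_set/= ?in_itv/= ?u0// mul1e.
rewrite -EFinM lee_fin exponential_pdfE//=.
rewrite phiE -mulrA -!mulrA ler_wpM2l ?normal_peak_ge0//.
rewrite mulKf ?gt_eqF// -expRD ler_expR lE.
have : (0 <= u * (h - u))%R by rewrite mulr_ge0// subr_ge0.
nra.
Qed.

Lemma gauss_tail_nonincreasing (x y : R) : (x <= y)%R -> gauss_tail y <= gauss_tail x.
Proof.
move=> xy; apply: le_measure; rewrite ?inE//.
by apply: subset_itvr; rewrite bnd_simp.
Qed.

End NormalTail.

Section Quantile.
Context {R : realType}.
Notation gauss := (@gauss R).

Definition gauss_cdf (x : R) : R := fine (gauss `]-oo, x]%classic).

Lemma gauss_cdfE x : gauss `]-oo, x]%classic = (gauss_cdf x)%:E.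
Proof. by rewrite fineK// fin_num_measure. Qed.

Lemma gauss_tail_cdf x : gauss_tail x = (1 - gauss_cdf x)%:E.
Proof. by rewrite gauss_tailC gauss_cdfE. Qed.

Lemma gauss_cdf_lip (x y : R) : x <= y -> 0 <= gauss_cdf y - gauss_cdf x <= y - x.
Proof.
move=> xy; have mI : measurable (`]x, y]%classic : set R) by exact: measurable_itv.
have E : (gauss `]-oo, y] = gauss `]-oo, x] + gauss `]x, y])%E.
  rewrite -measureU//; last first.
    apply/seteqP; split => // t [/=]; rewrite !in_itv/= => tx /andP[xt _].
    by move: xt; rewrite ltNge tx.
  by congr (gauss _); rewrite -itv_bndbnd_setU ?bnd_simp.
have mI1 : measurable_fun [set: R] (fun t : R => (\1_(`]x, y]%classic) t : R)%:E).
  by apply/measurable_EFinP.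
have le : (gauss `]x, y]%classic <= (y - x)%:E)%E.
  have -> : gauss `]x, y]%classic = (\int[gauss]_t (\1_(`]x, y]%classic) t : R)%:E)%E.
    by rewrite integral_indic// setIT.
  rewrite (ge0_integral_gauss mI1); last by move=> t; rewrite lee_fin.
  apply: (@le_trans _ _ (\int[leb]_t (\1_(`]x, y]%classic) t : R)%:E)%E).
    apply: ge0_le_integral => //.
    - by move=> t _; rewrite mule_ge0// lee_fin// phi_ge0.
    - by apply: emeasurable_funM => //; exact: measurable_phi.
    move=> t _; rewrite -EFinM lee_fin ler_piMr// phiE.
    have /andP[_ p2] := @normal_peak1_bounds R.
    have p0 : 0 <= normal_peak (1 : R) by exact: normal_peak_ge0.
    have e1 : expR (- t ^+ 2 / 2) <= 1.
      by rewrite -expR0 ler_expR mulNr oppr_le0 divr_ge0// sqr_ge0.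
    have e0 := expR_ge0 (- t ^+ 2 / 2); nra.
  rewrite integral_indic// setIT.
  rewrite -[leLHS]/(lebesgue_measure `]x, y]%classic).
  rewrite lebesgue_measure_itv/= lte_fin; case: ifP => // _.
  by rewrite lee_fin subr_ge0.
move: E; rewrite !gauss_cdfE -[gauss `]x, y]%classic]fineK ?fin_num_measure// -EFinD => -[->].
rewrite addrAC subrr add0r fine_ge0//=.
by rewrite -lee_fin fineK ?fin_num_measure.
Qed.

Lemma continuous_gauss_cdf : continuous gauss_cdf.
Proof.
move=> x; apply/cvgrPdist_lt => e e0; near=> y.
have xy : `|x - y| < e by near: y; exact: cvgr_dist_lt.
apply: le_lt_trans xy.
have [yx|xy] := leP y x.
  have /andP[h1 h2] := gauss_cdf_lip yx.
  by rewrite !ger0_norm ?subr_ge0//; lra.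
have /andP[h1 h2] := gauss_cdf_lip (ltW xy).
by rewrite !ler0_norm ?subr_le0//; lra.
Unshelve. all: by end_near. Qed.

(** The upper tail bound at 1 / p is at most p / 2. This brackets quantiles for the intermediate
    value theorem. *)
Lemma gauss_tail_inv_lt (p : R) : 0 < p -> (gauss_tail p^-1 < p%:E)%E.
Proof.
move=> p0; have ip0 : 0 < p^-1 by rewrite invr_gt0.
apply: le_lt_trans (gauss_tail_le ip0) _; rewrite lte_fin invrK.
have /andP[_ p2] := @normal_peak1_bounds R.
have e1 : expR (- p^-1 ^+ 2 / 2) <= 1.
  by rewrite -expR0 ler_expR mulNr oppr_le0 divr_ge0// sqr_ge0.
have e0 := expR_ge0 (- p^-1 ^+ 2 / 2).
have : normal_peak 1 * expR (- p^-1 ^+ 2 / 2) <= 2^-1 :> R by nra.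
nra.
Qed.

Lemma gauss_cdf_surj (p : R) : 0 < p < 1 -> exists x, gauss_cdf x = p.
Proof.
move=> /andP[p0 p1]; have q0 : 0 < 1 - p by rewrite subr_gt0.
have hp := gauss_tail_inv_lt p0; have hq := gauss_tail_inv_lt q0.
have ip0 : 0 < p^-1 by rewrite invr_gt0.
have iq0 : 0 < (1 - p)^-1 by rewrite invr_gt0.
have ab : - p^-1 <= (1 - p)^-1 by lra.
have fa : gauss_cdf (- p^-1) < p.
  by move: hp; rewrite -[p^-1]opprK gauss_tail_opp opprK gauss_cdfE lte_fin.
have fb : p < gauss_cdf (1 - p)^-1.
  by move: hq; rewrite gauss_tail_cdf lte_fin; lra.
have cont : {within `[- p^-1, (1 - p)^-1], continuous gauss_cdf}.
  by apply: continuous_subspaceT; exact: continuous_gauss_cdf.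
have mid : Num.min (gauss_cdf (- p^-1)) (gauss_cdf (1 - p)^-1) <= p <=
    Num.max (gauss_cdf (- p^-1)) (gauss_cdf (1 - p)^-1).
  by rewrite ge_min le_max (ltW fa) (ltW fb) orbT.
by have [x _ fx] := IVT ab cont mid; exists x.
Qed.

Lemma gauss_tail_z (a : R) : 0 < a < 1 -> gauss_tail (z_ a) = a%:E.
Proof.
move=> /andP[a0 a1].
(* [get] is meaningful only on an inhabited set; surjectivity of the distribution function provides
   a member. *)
have [x hx] : exists x, gauss_cdf x = 1 - a by apply: gauss_cdf_surj; lra.
have : [set x : R | std_normal_cdf x = (1 - a)%:E] (z_ a).
  apply: (@getPex _ [set x : R | std_normal_cdf x = (1 - a)%:E]).
  by exists x; rewrite /= -hx -gauss_cdfE.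
rewrite /= /std_normal_cdf -[normal_prob _ _ _]/(gauss `]-oo, z_ a]).
by rewrite gauss_tail_cdf gauss_cdfE => -[->]; congr EFin; ring.
Qed.

Lemma gauss_lt_z (a : R) : 0 < a < 1 -> gauss `]-oo, (- z_ a)]%classic = a%:E.
Proof. by move=> a01; rewrite -gauss_tail_opp opprK gauss_tail_z. Qed.

Lemma z_gt (a x : R) : 0 < a < 1 -> (a%:E < gauss_tail x)%E -> x < z_ a.
Proof.
move=> a01; rewrite -(gauss_tail_z a01) => h; rewrite ltNge; apply/negP => zx.
by have := gauss_tail_nonincreasing zx; rewrite leNgt h.
Qed.

Lemma z_lt (a x : R) : 0 < a < 1 -> (gauss_tail x < a%:E)%E -> z_ a < x.
Proof.
move=> a01; rewrite -(gauss_tail_z a01) => h; rewrite ltNge; apply/negP => zx.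
by have := gauss_tail_nonincreasing zx; rewrite leNgt h.
Qed.

Lemma gauss_tail0 : gauss_tail (0 : R) = (2^-1)%:E.
Proof.
have := gauss_tail_add_opp (0 : R); rewrite oppr0 gauss_tail_cdf -EFinD => -[h].
by congr EFin; lra.
Qed.

Lemma z_gt0 (a : R) : 0 < a < 2^-1 -> 0 < z_ a.
Proof.
move=> /andP[a0 a2]; apply: z_gt; last by rewrite gauss_tail0 lte_fin.
by rewrite a0 (lt_trans a2)// invf_lt1// ltr1n.
Qed.

End Quantile.

(** * Numerical bounds for normal quantiles *)

Section NumericalQuantiles.
Context {R : realType}.

Lemma expR_ge_oneDX (y : R) (m : nat) : (0 < m)%N -> 0 <= 1 + y / m%:R ->
  (1 + y / m%:R) ^+ m <= expR y.
Proof.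
move=> m0 h; have mn : (m%:R : R) != 0 by rewrite pnatr_eq0 -lt0n.
rewrite [in leRHS](_ : y = m%:R * (y / m%:R)); last by rewrite mulrC divfK.
by rewrite expRM_natl ler_pXn2r// ?nnegrE ?expR_ge0// expR_ge1Dx.
Qed.

(** The lower tail bound with h = 1 gives 0.35^2 (1 - 1/5) / 1.9, about 0.0516; the exponentials are
    bounded below by powers (1 + y/m)^m. *)
Lemma z_05_gt : 14 / 10 < z_ (5 / 100 : R).
Proof.
apply: z_gt; first by apply/andP; split; lra.
have h1 : (0 < 1 :> R) by [].
apply: lt_le_trans (gauss_tail_ge (x := 14 / 10) (l := 19 / 10) _ h1 _); [|lra|lra].
rewrite lte_fin.
have /andP[p1 _] := @normal_peak1_bounds R.
have e1 : 35 / 100 <= expR (- (14 / 10) ^+ 2 / 2 : R).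
  apply: le_trans (expR_ge_oneDX (m := 8) _ _) => //; lra.
have e2 : 5 <= expR (19 / 10 : R).
  apply: le_trans (expR_ge_oneDX (m := 8) _ _) => //; lra.
have e3 : expR (- (19 / 10) * 1) <= 5^-1 :> R.
  by rewrite mulr1 expRN lef_pV2// ?posrE ?expR_gt0.
have k : (35 / 100) * (35 / 100) <= normal_peak 1 * expR (- (14 / 10) ^+ 2 / 2) :> R.
  apply: ler_pM; [lra|lra|exact: p1|exact: e1].
rewrite mulrAC ltr_pdivlMr; last by lra.
nra.
Qed.

Lemma z_01_gt : 21 / 10 < z_ (1 / 100 : R).
Proof.
apply: z_gt; first by apply/andP; split; lra.
have h1 : (0 < 1 :> R) by [].
apply: lt_le_trans (gauss_tail_ge (x := 21 / 10) (l := 26 / 10) _ h1 _); [|lra|lra].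
rewrite lte_fin.
have /andP[p1 _] := @normal_peak1_bounds R.
have e1 : 93 / 1000 <= expR (- (21 / 10) ^+ 2 / 2 : R).
  apply: le_trans (expR_ge_oneDX (m := 16) _ _) => //; lra.
have e2 : 9 <= expR (26 / 10 : R).
  apply: le_trans (expR_ge_oneDX (m := 8) _ _) => //; lra.
have e3 : expR (- (26 / 10) * 1) <= 9^-1 :> R.
  by rewrite mulr1 expRN lef_pV2// ?posrE ?expR_gt0.
have k : (35 / 100) * (93 / 1000) <= normal_peak 1 * expR (- (21 / 10) ^+ 2 / 2) :> R.
  apply: ler_pM; [lra|lra|exact: p1|exact: e1].
rewrite mulrAC ltr_pdivlMr; last by lra.
nra.
Qed.

(** The upper tail bound gives (1/2) (1/44) / 2.8, about 0.00406, below 0.05 / 12. *)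
Lemma z_05_12_lt : z_ (5 / 100 / 6 / 2 : R) < 28 / 10.
Proof.
apply: z_lt; first by apply/andP; split; lra.
have h1 : (0 < 28 / 10 :> R) by lra.
apply: le_lt_trans (gauss_tail_le h1) _; rewrite lte_fin.
have /andP[_ p1] := @normal_peak1_bounds R.
have e2 : 44 <= expR (98 / 25 : R).
  apply: le_trans (expR_ge_oneDX (m := 64) _ _) => //; lra.
have e3 : expR (- (28 / 10) ^+ 2 / 2) <= 44^-1 :> R.
  rewrite (_ : _ / 2 = - (98 / 25)); last by field.
  by rewrite expRN lef_pV2// ?posrE ?expR_gt0.
have k : normal_peak 1 * expR (- (28 / 10) ^+ 2 / 2) <= 2^-1 * 44^-1 :> R.
  apply: ler_pM; [exact: normal_peak_ge0|exact: expR_ge0|exact: p1|exact: e3].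
rewrite ltr_pdivrMr//; lra.
Qed.

Lemma z_01_12_lt : z_ (1 / 100 / 6 / 2 : R) < 33 / 10.
Proof.
apply: z_lt; first by apply/andP; split; lra.
have h1 : (0 < 33 / 10 :> R) by lra.
apply: le_lt_trans (gauss_tail_le h1) _; rewrite lte_fin.
have /andP[_ p1] := @normal_peak1_bounds R.
have e2 : 200 <= expR (1089 / 200 : R).
  have e4 : 378 / 100 <= expR (1089 / 800 : R).
    apply: le_trans (expR_ge_oneDX (m := 32) isT _); last by lra.
    apply: le_trans (_ : (417 / 400) ^+ 32 <= _); first by lra.
    by apply: lerXn2r; rewrite ?nnegrE; lra.
  rewrite (_ : 1089 / 200 = 4%:R * (1089 / 800)); last by lra.
  rewrite expRM_natl; apply: le_trans (_ : (378 / 100) ^+ 4 <= _); first by lra.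
  by apply: lerXn2r; rewrite ?nnegrE; [lra|exact: expR_ge0|exact: e4].
have e3 : expR (- (33 / 10) ^+ 2 / 2) <= 200^-1 :> R.
  rewrite (_ : _ / 2 = - (1089 / 200)); last by field.
  by rewrite expRN lef_pV2// ?posrE ?expR_gt0.
have k : normal_peak 1 * expR (- (33 / 10) ^+ 2 / 2) <= 2^-1 * 200^-1 :> R.
  apply: ler_pM; [exact: normal_peak_ge0|exact: expR_ge0|exact: p1|exact: e3].
rewrite ltr_pdivrMr//; lra.
Qed.

End NumericalQuantiles.

(** * Runs of decreasing noise *)

(** Stated for any measurable space, as it serves both the full sigma-algebra and that of the inner
    coordinates. *)
Lemma measurable_average_below {R : realType} d (T : measurableType d)
    (g : T -> R) (S : set T) (B : set R) (s : R) :
  measurable_fun setT g -> measurable S -> measurable B ->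
  measurable [set p : T * R | B ((p.2 + g p.1) / s) /\ g p.1 < p.2 /\ S p.1].
Proof.
move=> mg mS mB.
have mg1 : measurable_fun setT (fun p : T * R => g p.1).
  exact: measurableT_comp.
have m1 : measurable_fun setT (fun p : T * R => (p.2 + g p.1) / s).
  by apply: measurable_funM => //; apply: measurable_funD.
rewrite (_ : [set _ | _] = (fun p : T * R => (p.2 + g p.1) / s) @^-1` B `&`
  ([set p | g p.1 < p.2] `&` fst @^-1` S)); last by apply/seteqP; split => p /=; tauto.
apply: measurableI; first by have := m1 measurableT B mB; rewrite setTI.
apply: measurableI.
  have mt : measurable [set true] by [].
  have := measurable_fun_ltr mg1 (@measurable_snd _ _ T R) measurableT mt.
  by rewrite setTI.
by have := @measurable_fst _ _ T R measurableT S mS; rewrite setTI.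
Qed.

Section NestedAverages.
Context d (T : measurableType d) (R : realType) (P : probability T R).
Variables (Z : nat -> T -> R) (c : nat).
Notation k := (c.*2.+1).
Hypothesis mZ : forall i, (i < k)%N -> measurable_fun setT (Z i).
Hypothesis indZ : mutually_independent P (fun i : 'I_k => Z i).
Hypothesis lawZ : forall i, (i < k)%N -> forall B, measurable B ->
  P (Z i @^-1` B) = gauss B.
Notation gauss := (@gauss R).
Notation r2 := (Num.sqrt 2 : R).

(* [inner q] is the normalised increment over the q-th symmetric interval around
   the central one, and [outer q] that over its two neighbours together. *)
Definition outer q (w : T) : R := (Z (c - q.+1) w + Z (c + q.+1) w) / r2.

Fixpoint inner q (w : T) : R :=
  if q is p.+1 then (outer p w + inner p w) / r2 else Z c w.

Fixpoint dominated q : set T :=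
  if q is p.+1 then dominated p `&` [set w | inner p w < outer p w] else setT.

Let I q : pred nat := fun i => (c - q <= i <= c + q)%N.

Let r20 : 0 < r2. Proof. by rewrite sqrtr_gt0. Qed.
Let r2E : r2 ^+ 2 = 2. Proof. by rewrite sqr_sqrtr. Qed.

Let measurable_outer (J : pred nat) q : (q < c)%N -> J (c - q.+1)%N -> J (c + q.+1)%N ->
  measurable_fun setT (outer q : coordinate_type Z k J -> R).
Proof.
move=> qc J1 J2; apply: measurable_funM => //; apply: measurable_funD.
  by apply: measurable_coordinate => //; lia.
by apply: measurable_coordinate => //; lia.
Qed.

Let measurable_inner (J : pred nat) q : (q <= c)%N -> (forall i, I q i -> J i) ->
  measurable_fun setT (inner q : coordinate_type Z k J -> R).
Proof.
elim: q J => [|q IH] J qc IJ /=.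
  by apply: measurable_coordinate; [lia|apply: IJ; rewrite /I; lia].
apply: measurable_funM => //; apply: measurable_funD.
  by apply: measurable_outer => //; apply: IJ; rewrite /I; lia.
by apply: IH => [|i Iqi]; [lia|apply: IJ; move: Iqi; rewrite /I; lia].
Qed.

Let measurable_dominated (J : pred nat) q : (q <= c)%N -> (forall i, I q i -> J i) ->
  measurable (dominated q : set (coordinate_type Z k J)).
Proof.
elim: q J => [|q IH] J qc IJ /=; first exact: measurableT.
apply: measurableI.
  by apply: IH => [|i Iqi]; [lia|apply: IJ; move: Iqi; rewrite /I; lia].
have mi : measurable_fun setT (inner q : coordinate_type Z k J -> R).
  by apply: measurable_inner => [|i Iqi]; [lia|apply: IJ; move: Iqi; rewrite /I; lia].
have mo : measurable_fun setT (outer q : coordinate_type Z k J -> R).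
  by apply: measurable_outer => //; apply: IJ; rewrite /I; lia.
have mt : measurable [set true] by [].
by have := measurable_fun_ltr mi mo measurableT mt; rewrite setTI.
Qed.

Let outer_law q B : (q < c)%N -> measurable B -> P (outer q @^-1` B) = gauss B.
Proof.
move=> qc mB.
pose a i : R := if (i == c - q.+1)%N || (i == c + q.+1)%N then r2^-1 else 0.
have lt1 : (c - q.+1 < k)%N by lia.
have lt2 : (c + q.+1 < k)%N by lia.
have ne : Ordinal lt2 != Ordinal lt1 by rewrite -val_eqE /=; lia.
have sumE (h : nat -> R) : (forall i, ~~ ((i == c - q.+1)%N || (i == c + q.+1)%N) -> h i = 0) ->
    \sum_(i < k) h i = h (c - q.+1)%N + h (c + q.+1)%N.
  move=> h0; rewrite (bigD1 (Ordinal lt1))//= (bigD1 (Ordinal lt2))//=.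
  rewrite big1 ?addr0// => i /andP[i1 i2]; apply: h0.
  by rewrite negb_or; move: i1 i2; rewrite -!val_eqE /= => -> ->.
have := @ge0_integral_lincomb _ _ _ _ _ _ mZ indZ lawZ a
  (fun x => (\1_B x : R)%:E) k (leqnn k).
have -> : (fun w => (\1_B (\sum_(i < k) a i * Z i w))%:E : \bar R) =
    (fun w => (\1_(outer q @^-1` B) w)%:E).
  apply/funext => w; rewrite (sumE (fun i => a i * Z i w)); last first.
    by move=> i /negbTE ia; rewrite /a ia mul0r.
  rewrite /a !eqxx orbT /=.
  rewrite (_ : _ + _ = outer q w)//.
  by rewrite /outer mulrDl !(mulrC r2^-1).
rewrite (sumE (fun i => a i ^+ 2)); last first.
  by move=> i /negbTE ia; rewrite /a ia expr0n.
rewrite /a !eqxx orbT /= exprVn r2E.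
rewrite (_ : Num.sqrt _ = 1); last by rewrite (_ : _ + _ = 1) ?sqrtr1//; lra.
move=> H; have mO : measurable (outer q @^-1` B).
  rewrite -[X in measurable X]setTI; apply: (_ : measurable_fun setT (outer q)) => //.
  by apply: measurable_funM => //; apply: measurable_funD; apply: mZ.
transitivity (\int[P]_w (\1_(outer q @^-1` B) w)%:E)%E.
  by rewrite integral_indic// setIT.
rewrite H//; last first.
  by apply/measurable_EFinP.
transitivity (\int[gauss]_x (\1_B x)%:E)%E.
  by apply: eq_integral => x _; rewrite mul1r.
by rewrite integral_indic// setIT.
Qed.

(* A rotation by pi/4 turns the event [inner q < outer q] into a condition on the
   sign of a standard normal independent of [inner q.+1]. *)
Lemma probability_dominated q B : (q <= c)%N -> measurable B ->
  (P (inner q @^-1` B `&` dominated q) <= (2 ^- q)%:E * gauss B)%E.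
Proof.
elim: q B => [|q IH] B qc mB.
  by rewrite /= setIT expr0 invr1 mul1e lawZ//; lia.
have mO : measurable_fun setT (outer q).
  by apply: measurable_funM => //; apply: measurable_funD; apply: mZ; lia.
have mGI : measurable_fun setT (inner q : coordinate_type Z k (I q) -> R).
  by apply: measurable_inner => //; lia.
have mSI : measurable (dominated q : set (coordinate_type Z k (I q))).
  by apply: measurable_dominated => //; lia.
have mtoI := measurable_to_coordinate_type mZ (I := I q).
have mG : measurable_fun setT (inner q : T -> R) by exact: measurableT_comp mGI mtoI.
have mS : measurable (dominated q : set T).
  by have := mtoI measurableT _ mSI; rewrite setTI.
have mNext : measurable (inner q.+1 @^-1` B `&` dominated q.+1 : set T).
  apply: measurableI => /=.
    have mn : measurable_fun setT (fun w : T => (outer q w + inner q w) / r2).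
      by apply: measurable_funM => //; exact: measurable_funD.
    by have := mn measurableT B mB; rewrite setTI.
  apply: measurableI => //.
  have mt : measurable [set true] by [].
  by have := measurable_fun_ltr mG mO measurableT mt; rewrite setTI.
(* The second component stands for the value of [outer q], a standard normal independent of the
   inner coordinates. *)
pose E := [set p : T * R | B ((p.2 + inner q p.1) / r2) /\
  inner q p.1 < p.2 /\ dominated q p.1].
have mE : measurable E by exact: measurable_average_below.
have mEI : measurable (E : set (coordinate_type Z k (I q) * R)).
  exact: measurable_average_below.
have indE : (P (inner q.+1 @^-1` B `&` dominated q.+1) =
    \int[P]_w \int[gauss]_x (\1_E (w, x) : R)%:E)%E.
  transitivity (\int[P]_w (\1_(inner q.+1 @^-1` B `&` dominated q.+1) w : R)%:E)%E.
    by rewrite integral_indic// setIT.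
  transitivity (\int[P]_w (\1_E (w, outer q w) : R)%:E)%E.
    apply: eq_integral => w _; rewrite !indicE; congr ((nat_of_bool _)%:R%:E).
    by apply/idP/idP; rewrite !inE /E /=; tauto.
  have mF : measurable_fun setT
      (fun p : coordinate_type Z k (I q) * R => (\1_E p : R)%:E).
    by apply/measurable_EFinP; exact: measurable_indic.
  rewrite (@ge0_integral_independent _ _ _ P _ (coordinate_type Z k (I q)) _ _
    (id : T -> coordinate_type Z k (I q)) (outer q) mtoI mO _ _ mF)//.
  - apply: eq_integral => w _; apply: eq_measure_integral => D mD _.
    exact: outer_law.
  - move=> A D mA mD; rewrite preimage_id.
    pose J : pred nat := fun i => (i == c - q.+1)%N || (i == c + q.+1)%N.
    apply: (independent_coordinates mZ indZ (I := I q) (J := J)) => //.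
      by move=> i; rewrite /I /J; lia.
    have mOJ : measurable_fun setT (outer q : coordinate_type Z k J -> R).
      by apply: measurable_outer => //; rewrite /J eqxx ?orbT.
    by have := mOJ measurableT D mD; rewrite setTI.
rewrite indE.
rewrite (fubini_tonelli (m1 := P) (m2 := gauss) (fun p : T * R => (\1_E p : R)%:E)); last 2 first.
- by apply/measurable_EFinP; exact: measurable_indic.
- by move=> p; rewrite lee_fin.
(* The event in rotated coordinates: the first is [inner q.+1], and the second is nonpositive
   exactly when the inner value is at most the outer one. *)
pose H (p : R * R) : \bar R := ((\1_B p.1 : R)%:E * (\1_(`]-oo, 0%R]%classic) p.2 : R)%:E)%E.
have mB1 : measurable_fun [set: R] (fun x : R => (\1_B x : R)%:E).
  by apply/measurable_EFinP.
have mI0 : measurable_fun [set: R] (fun x : R => (\1_(`]-oo, 0%R]%classic) x : R)%:E).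
  by apply/measurable_EFinP.
have mH : measurable_fun [set: R * R] H.
  apply: emeasurable_funM; first exact: (measurableT_comp mB1 measurable_fst).
  exact: (measurableT_comp mI0 measurable_snd).
have H0 p : (0 <= H p)%E by rewrite mule_ge0// lee_fin.
pose a := r2^-1.
have a0 : a != 0 by rewrite invr_eq0 gt_eqF.
have aa : a ^+ 2 + a ^+ 2 = 1 by rewrite /a exprVn r2E; lra.
have mHr : measurable_fun [set: R * R]
    (fun p : R * R => H (a * p.1 + a * p.2, a * p.2 - a * p.1)).
  apply: measurableT_comp => //; apply: measurable_fun_pair => /=.
    exact: measurable_lincomb.
  rewrite (_ : (fun _ => _) = fun p => - a * p.1 + a * p.2); last first.
    by apply/funext => p /=; rewrite mulNr addrC.
  exact: measurable_lincomb.
have q20 : 0 <= 2 ^- q :> R by rewrite invr_ge0 exprn_ge0.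
apply: (@le_trans _ _ (\int[gauss]_x ((2 ^- q)%:E *
    \int[gauss]_y H (a * x + a * y, a * y - a * x)%R))%E).
  apply: ge0_le_integral => //.
  - by move=> x _; apply: integral_ge0 => w _; rewrite lee_fin.
  - apply: (@measurable_fun_fubini_tonelli_G _ _ _ _ _ P (fun p : T * R => (\1_E p : R)%:E)).
      by apply/measurable_EFinP; exact: measurable_indic.
    by move=> p; rewrite lee_fin.
  - apply: emeasurable_funM => //.
    exact: (@measurable_fun_fubini_tonelli_F _ _ _ _ _ gauss
      (fun p : R * R => H (a * p.1 + a * p.2, a * p.2 - a * p.1))).
  move=> x _.
  (* For a fixed outer value x, besides [dominated q] only a restriction of the inner value to [C]
     remains; this is why the induction runs over all B. *)
  pose C := [set y : R | B ((x + y) / r2) /\ y < x].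
  have mC : measurable C.
    have m1 : measurable_fun [set: R] (fun y : R => (x + y) / r2).
      by apply: measurable_funM => //; exact: measurable_funD.
    rewrite (_ : C = (fun y : R => (x + y) / r2) @^-1` B `&` `]-oo, x[%classic).
      by apply: measurableI => //; have := m1 measurableT B mB; rewrite setTI.
    by apply/seteqP; split => y; rewrite /C /= in_itv.
  have -> : (\int[P]_w (\1_E (w, x) : R)%:E = P (inner q @^-1` C `&` dominated q))%E.
    transitivity (\int[P]_w (\1_(inner q @^-1` C `&` dominated q) w : R)%:E)%E.
      apply: eq_integral => w _; rewrite !indicE; congr ((nat_of_bool _)%:R%:E).
      by apply/idP/idP; rewrite !inE /E /C /=; tauto.
    rewrite integral_indic// ?setIT//; apply: measurableI => //.
    by have := mG measurableT C mC; rewrite setTI.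
  apply: (le_trans (IH _ (ltnW qc) mC)).
  apply: lee_wpmul2l; first by rewrite lee_fin.
  have -> : gauss C = (\int[gauss]_y (\1_C y : R)%:E)%E.
    by rewrite integral_indic// setIT.
  apply: ge0_le_integral => //.
  - by apply/measurable_EFinP; exact: measurable_indic.
  - exact: (measurableT_comp mHr (pair1_measurable x)).
  move=> y _; rewrite /H /= -EFinM lee_fin !indicE.
  case: (boolP (y \in C)) => [|_]; last by rewrite mulr_ge0.
  rewrite inE => -[By yx]; rewrite !mem_set ?mulr1//=.
    rewrite in_itv/= subr_le0 ler_pM2l; first exact: ltW.
    by rewrite invr_gt0.
  by rewrite -mulrDr mulrC.
rewrite ge0_integralZl//; last 2 first.
- exact: (@measurable_fun_fubini_tonelli_F _ _ _ _ _ gauss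
    (fun p : R * R => H (a * p.1 + a * p.2, a * p.2 - a * p.1))).
- by move=> x _; exact: integral_ge0.
rewrite (gauss_rotation a0 aa mH H0).
have -> : (\int[gauss]_x \int[gauss]_y H (x, y) = gauss B * (2^-1)%:E)%E.
  transitivity (\int[gauss]_x ((\1_B x : R)%:E * (2^-1)%:E))%E.
    apply: eq_integral => x _; rewrite /H /= ge0_integralZl//.
    congr (_ * _)%E; rewrite integral_indic// setIT.
    by rewrite -[LHS]/(gauss `]-oo, 0%R]%classic) -gauss_tail_opp oppr0 gauss_tail0.
  rewrite ge0_integralZr//; congr (_ * _)%E.
  by rewrite integral_indic// setIT.
by rewrite [(gauss B * _)%E]muleC muleA -EFinM exprSr invfM.
Qed.

End NestedAverages.

(** * Brownian noise at dyadic scales *)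

Section DyadicNoise.
Context {R : realType} (d : measure_display) (T : measurableType d).
Variables (P : probability T R) (n : R) (W : R -> T -> R).
Hypotheses (n0 : 0 < n) (bW : brownian P W).
Notation obs := (@obs_interval R).
Notation r2 := (Num.sqrt 2 : R).

Definition noise j (w : T) : R :=
  2 ^+ j.-1 * ((Num.sqrt n)^-1 * (W (2 ^- j) w - W (- 2 ^- j) w)).

Lemma dyadic_range j : (0 < j)%N -> 0 < (2 ^- j : R) <= 2^-1.
Proof.
move=> j0; rewrite invr_gt0 exprn_gt0//=.
by rewrite lef_pV2 ?posrE ?exprn_gt0// -[leLHS]expr1 ler_weXn2l// ler1n.
Qed.

Lemma obs_dyadic j : (0 < j)%N -> obs (2 ^- j) /\ obs (- 2 ^- j).
Proof.
move=> j0; have := dyadic_range j0.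
by split; apply/obsE; lra.
Qed.

Let dyadic_halve j : 2 ^- j.+1 = 2 ^- j / 2 :> R.
Proof. by rewrite exprSr invfM. Qed.

Let dyadic_gt0 j : 0 < 2 ^- j :> R.
Proof. by rewrite invr_gt0 exprn_gt0. Qed.

(* The times -2^-1, ..., -2^-(c+1), 2^-(c+1), ..., 2^-1. *)
Definition dyadic_times c (i : nat) : R :=
  if (i <= c)%N then - 2 ^- i.+1 else 2 ^- (c.*2.+2 - i).

Section Fixed.
Variable c : nat.
Notation t := (dyadic_times c).
Notation k := (c.*2.+1).

Lemma obs_dyadic_times i : (i <= k)%N -> obs (t i).
Proof.
move=> ik; rewrite /dyadic_times; case: ifP => ic; first exact: (obs_dyadic _).2.
by apply: (obs_dyadic _).1; lia.
Qed.

Lemma dyadic_times_lt i : (i < k)%N -> t i < t i.+1.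
Proof.
move=> ik; rewrite /dyadic_times; case: ifP => ic; case: ifP => ic1; try lia.
- by rewrite (dyadic_halve i.+1); have := dyadic_gt0 i.+1; lra.
- by rewrite (lt_trans (y := 0)) ?oppr_lt0 ?dyadic_gt0.
- rewrite (_ : (c.*2.+2 - i = (c.*2.+2 - i.+1).+1)%N); last by lia.
  by rewrite (dyadic_halve (c.*2.+2 - i.+1)); have := dyadic_gt0 (c.*2.+2 - i.+1); lra.
Qed.

Notation Z := (normalized_increments W t).

Let ZE i w : (i < k)%N ->
  W (t i.+1) w - W (t i) w = Num.sqrt (t i.+1 - t i) * Z i w.
Proof.
move=> ik; rewrite /normalized_increments mulrC divfK// gt_eqF// sqrtr_gt0.
by rewrite subr_gt0 dyadic_times_lt.
Qed.

Let r20 : 0 < r2. Proof. by rewrite sqrtr_gt0. Qed.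
Let r2E : r2 * r2 = 2. Proof. by rewrite -expr2 sqr_sqrtr. Qed.

Let sqrt_dyadic_double j : Num.sqrt (2 ^- j) = r2 * Num.sqrt (2 ^- j.+1) :> R.
Proof.
by rewrite -sqrtrM// dyadic_halve mulrCA divff ?mulr1.
Qed.

(** Level q belongs to scale c + 1 - q, as scales run inward and q outward. The central interval is
    as long as its two neighbours together, whence the equal weights 1 / sqrt 2. *)
Lemma increment_inner q w : (q <= c)%N ->
  W (2 ^- (c.+1 - q)) w - W (- 2 ^- (c.+1 - q)) w =
  Num.sqrt (2 ^- (c - q)) * inner Z c q w.
Proof.
elim: q => [|q IH] qc.
  rewrite /= !subn0; have ck : (c < k)%N by lia.
  have := ZE w ck; rewrite /dyadic_times leqnn ltnn.
  rewrite (_ : (c.*2.+2 - c.+1 = c.+1)%N); last by lia.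
  by move=> ->; congr (Num.sqrt _ * _); rewrite dyadic_halve; lra.
have IH' := IH (ltnW qc).
have lk : (c - q.+1 < k)%N by lia.
have rk : (c + q.+1 < k)%N by lia.
have := ZE w lk; have := ZE w rk; rewrite /dyadic_times.
rewrite (_ : ((c + q.+1).+1 <= c)%N = false); last by lia.
rewrite (_ : (c + q.+1 <= c)%N = false); last by lia.
rewrite (_ : ((c - q.+1).+1 <= c)%N = true); last by lia.
rewrite (_ : (c - q.+1 <= c)%N = true); last by lia.
rewrite (_ : (c.*2.+2 - (c + q.+1).+1 = c - q)%N); last by lia.
rewrite (_ : (c.*2.+2 - (c + q.+1) = c.+1 - q)%N); last by lia.
rewrite (_ : ((c - q.+1).+2 = c.+1 - q)%N); last by lia.
rewrite (_ : ((c - q.+1).+1 = c - q)%N); last by lia.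
rewrite (_ : (c.+1 - q.+1 = c - q)%N)//.
have D1 : 2 ^- (c - q) - 2 ^- (c.+1 - q) = 2 ^- (c.+1 - q) :> R.
  by rewrite subSn ?(ltnW qc)// (dyadic_halve (c - q)); lra.
have D2 : - 2 ^- (c.+1 - q) - - 2 ^- (c - q) = 2 ^- (c.+1 - q) :> R.
  by rewrite -[RHS]D1; lra.
rewrite D1 D2 => HR HL.
have s1 : Num.sqrt (2 ^- (c - q)) = r2 * Num.sqrt (2 ^- (c.+1 - q)) :> R.
  by rewrite sqrt_dyadic_double subSn// ltnW.
have s2 : Num.sqrt (2 ^- (c - q.+1)) = r2 * (r2 * Num.sqrt (2 ^- (c.+1 - q))) :> R.
  rewrite -s1 sqrt_dyadic_double; congr (_ * Num.sqrt (2 ^- _)); lia.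
rewrite s2 /= /outer; rewrite s1 in IH'.
set s := Num.sqrt (2 ^- (c.+1 - q)) in HR HL IH' *.
transitivity (s * Z (c + q.+1) w + r2 * s * inner Z c q w + s * Z (c - q.+1) w).
  by rewrite -HR -HL -IH'; ring.
by field; rewrite gt_eqF.
Qed.

(** The average over the doubled interval is the mean of the inner average and of that over the two
    neighbours, so the difference is a positive multiple of outer minus inner. *)
Lemma noise_diff_gt0 q w : (q < c)%N ->
  (0 < noise (c - q) w - noise (c.+1 - q) w) = (inner Z c q w < outer Z c q w).
Proof.
move=> qc; rewrite /noise.
have E1 := increment_inner w qc; have E2 := increment_inner w (ltnW qc).
rewrite (_ : (c.+1 - q.+1 = c - q)%N)// in E1.
rewrite E1 E2.
have s1 : Num.sqrt (2 ^- (c - q.+1)) = r2 * Num.sqrt (2 ^- (c - q)) :> R.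
  rewrite sqrt_dyadic_double; congr (_ * Num.sqrt (2 ^- _)); lia.
rewrite s1.
have -> : (2 : R) ^+ (c.+1 - q).-1 = 2 * 2 ^+ (c - q).-1.
  by rewrite -exprS; congr (_ ^+ _); lia.
set s := Num.sqrt (2 ^- (c - q)).
have s0 : 0 < s by rewrite sqrtr_gt0.
have sn : 0 < (Num.sqrt n)^-1 by rewrite invr_gt0 sqrtr_gt0.
have p0 : 0 < (2 : R) ^+ (c - q).-1 by exact: exprn_gt0.
set p := (2 : R) ^+ _ in p0 *; set v := (Num.sqrt n)^-1 in sn *.
rewrite (_ : _ - _ = p * v * s * (outer Z c q w - inner Z c q w)).
  by rewrite pmulr_rgt0 ?subr_gt0// !mulr_gt0.
rewrite /= ; set o := outer _ _ _ _; set i := inner _ _ _ _.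
rewrite (_ : r2 * s * ((o + i) / r2) = s * (o + i)); last by field; rewrite gt_eqF.
ring.
Qed.

Lemma dominatedP q w : dominated Z c q w <->
  forall q', (q' < q)%N -> inner Z c q' w < outer Z c q' w.
Proof.
elim: q => [|q IH] /=; first by split.
split=> [[/IH h h1] q'|h]; first by rewrite ltnS leq_eqVlt => /predU1P[->|/h].
split; last exact: h.
by apply/IH => q' q'q; apply: h; exact: ltnW.
Qed.

End Fixed.

Definition noise_decreasing J m : set T :=
  [set w | forall i, (J <= i < J + m)%N -> 0 < noise i w - noise i.+1 w].

Lemma measurable_noise j : (0 < j)%N -> measurable_fun setT (noise j).
Proof.
move=> j0; case: (obs_dyadic j0) => o1 o2.
apply: measurable_funM => //; apply: measurable_funM => //.
by apply: measurable_funB; exact: (brownian_measurable bW).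
Qed.

Lemma measurable_noise_decreasing J m : (0 < J)%N ->
  measurable (noise_decreasing J m).
Proof.
move=> J0.
rewrite (_ : noise_decreasing J m =
  \bigcap_(i in [set i | (J <= i < J + m)%N]) [set w | 0 < noise i w - noise i.+1 w]).
  apply: fin_bigcap_measurable.
    by apply: (sub_finite_set _ (finite_II (J + m))) => i /= /andP[].
  move=> i /= /andP[Ji _].
  have m1 : measurable_fun setT (fun w => noise i w - noise i.+1 w).
    by apply: measurable_funB; apply: measurable_noise => //; lia.
  have := m1 measurableT `]0, +oo[%classic (measurable_itv _); rewrite setTI.
  by congr measurable; apply/seteqP; split => w /=; rewrite in_itv/= andbT.
by apply/seteqP; split => w /= h i; exact: h.
Qed.

Lemma probability_noise_decreasing J m : (0 < J)%N ->
  (P (noise_decreasing J m) <= (2 ^- m)%:E)%E.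
Proof.
move=> J0; case: m => [|m].
  rewrite expr0 invr1; apply: probability_le1; exact: measurable_noise_decreasing.
(* The number of comparisons is now m + 1, and the finest scale involved is J + m + 1 = c + 1, that
   of the central interval of the grid. *)
pose c := (J + m)%N.
have mc : (m.+1 <= c)%N by rewrite /c; lia.
have ot := @obs_dyadic_times c; have tt := @dyadic_times_lt c.
have := probability_dominated (measurable_normalized_increments bW ot)
  (normalized_increments_independent bW ot tt)
  (normalized_increments_law bW ot tt) mc (@measurableT _ R).
rewrite preimage_setT setTI (@probability_setT _ _ _ (@gauss R)) mule1.
apply: le_trans.
rewrite (_ : noise_decreasing J m.+1 =
  dominated (normalized_increments W (dyadic_times c)) c m.+1)//.
apply/seteqP; split => w /=.
  move=> h; apply/(dominatedP c m.+1) => q qm.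
  rewrite -noise_diff_gt0; last by lia.
  have := h (c - q)%N; rewrite -subSn; last by lia.
  by apply; rewrite /c; lia.
move=> /(dominatedP c m.+1) h i iJ.
have := h (c - i)%N; rewrite -noise_diff_gt0; last by rewrite /c; lia.
rewrite subKn; last by rewrite /c; lia.
rewrite (_ : (c.+1 - (c - i) = i.+1)%N); last by rewrite /c; lia.
by apply; rewrite /c; lia.
Qed.

End DyadicNoise.

(** * Upper bound on the expected length *)

(** The integral of a nonnegative function is a supremum over simple functions below it, so
    monotonicity holds without measurability. It is applied to the length of the stopped
    interval. *)
Lemma le_ge0_integral_nonmeasurable d (T : measurableType d) (R : realType)
    (m : {measure set T -> \bar R}) (g h : T -> \bar R) :
  (forall x, 0 <= g x)%E -> (forall x, g x <= h x)%E ->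
  (\int[m]_x g x <= \int[m]_x h x)%E.
Proof.
move=> g0 gh; have h0 x : (0 <= h x)%E by exact: le_trans (gh x).
rewrite !ge0_integralTE//; apply: ereal_sup_le => _ [k kg <-].
by exists k => // x; exact: le_trans (kg x) (gh x).
Qed.

Section Levels.
Context {R : realType} (n : R).
Hypothesis n0 : 0 < n.
Notation r2 := (Num.sqrt 2 : R).

Lemma sigma_gt0 j : 0 < sigma n j.
Proof. by rewrite sqrtr_gt0 divr_gt0// exprn_gt0. Qed.

Lemma sigmaS j : (0 < j)%N -> sigma n j.+1 = r2 * sigma n j.
Proof.
case: j => // j _; rewrite /sigma /= exprS -mulrA sqrtrM//.
Qed.

Lemma sigmaD J k : (0 < J)%N -> sigma n (J + k) = r2 ^+ k * sigma n J.
Proof.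
move=> J0; elim: k => [|k IH]; first by rewrite addn0 expr0 mul1r.
by rewrite addnS sigmaS ?addn_gt0 ?J0// IH mulrA -exprS.
Qed.

Lemma sigma_nondecreasing i j : (0 < i <= j)%N -> sigma n i <= sigma n j.
Proof.
move=> /andP[i0 ij]; rewrite -(subnKC ij) sigmaD// ler_peMl ?(ltW (sigma_gt0 _))//.
by rewrite exprn_ege1// -[leLHS]sqrtr1 ler_wsqrtr// ler1n.
Qed.

Lemma sigma_unbounded x J : exists k, x <= sigma n (J.+1 + k).
Proof.
have s1 := sigma_gt0 J.+1.
pose y := x / sigma n J.+1.
exists (Num.bound y).*2; rewrite sigmaD// -ler_pdivrMr//.
rewrite -mul2n exprM sqr_sqrtr//; apply: le_trans (ler_norm y) _.
apply: le_trans (ltW (archi_boundP (normr_ge0 y))) _.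
rewrite -natrX ler_nat.
have -> : Num.bound `|y| = Num.bound y by rewrite /Num.bound normr_id.
by apply: ltnW; exact: ltn_expl.
Qed.

End Levels.

Section ExpectedLength.
Context {R : realType} (d : measure_display) (T : measurableType d).
Variables (P : probability T R) (n : R) (W : R -> T -> R).
Hypotheses (n0 : 0 < n) (bW : brownian P W).
Variable f : R -> R.
Hypothesis Ff : Fc f.
Notation obs := (@obs_interval R).
Notation mu := (@lebesgue_measure R).
Notation r2 := (Num.sqrt 2 : R).
Notation Y := (observation n W f).
Notation xi := (noise n W).

Definition mean_level j : R := symmetric_average f (2 ^- j).

Definition mean_gap j : R := mean_level j - mean_level j.+1.

Let dyadic_halve j : 2 ^- j.+1 = 2 ^- j / 2 :> R.
Proof. by rewrite exprSr invfM. Qed.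

Lemma delta_observation j w : (0 < j)%N ->
  delta (Y w) j = mean_level j + xi j w.
Proof.
move=> j0; have h01 := @dyadic_range R _ j0; case: (@obs_dyadic R _ j0) => o1 o2.
rewrite /delta /observation /noise /mean_level /symmetric_average.
have := primitiveB (Fc_integrable Ff) o2 o1.
rewrite Rintegral_symmetric//; last exact: Fc_bounded_measurable.
move=> /(_ ltac:(lra)).
set A := Rintegral _ _ _; set B := Rintegral _ _ _; set I := Rintegral _ _ _.
move=> E; rewrite opprD addrACA E -mulrBr mulrDr; congr (_ + _).
rewrite mulrA; congr (_ * _); case: j j0 {h01 o1 o2 A B I E} => // j _ /=.
by rewrite exprS invfM mulrCA divff ?mulr1// expf_neq0.
Qed.

Lemma T_observation j w : (0 < j)%N ->
  T_ (Y w) j = mean_gap j + (xi j w - xi j.+1 w).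
Proof. by move=> j0; rewrite /T_ !delta_observation// /mean_gap; ring. Qed.

Lemma mean_gap_nonincreasing i j : (0 < i <= j)%N -> mean_gap j <= mean_gap i.
Proof.
move=> /andP[i0 ij]; rewrite -(subnKC ij); elim: (j - i)%N => [|k IH].
  by rewrite addn0.
apply: le_trans IH; rewrite addnS /mean_gap /mean_level.
have k0 : (0 < i + k)%N by rewrite addn_gt0 i0.
by rewrite !dyadic_halve; exact: symmetric_average_diff_nonincreasing (@dyadic_range R _ k0).
Qed.

Variables (a z zb : R).
Hypotheses (zE : z = z_ a) (zbE : zb = z_ (a / 6 / 2)) (z0 : 0 < z) (zb0 : 0 < zb).

Notation K := ((Num.sqrt 5 + r2) * zb).

Let Kz0 : 0 < K + z.
Proof.
by rewrite addr_gt0// mulr_gt0// addr_gt0 ?sqrtr_gt0.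
Qed.

(** The endpoints differ by [T_ y j] plus K sigma_j, because sigma_(j+1) is sqrt 2 times sigma_j. *)
Lemma length_CIc y j : (0 < j)%N -> T_ y j <= z * sigma n j ->
  (mu (CIc n (a / 6) y j) <= ((K + z) * sigma n j)%:E)%E.
Proof.
move=> j0 Tj; rewrite /CIc lebesgue_measure_itv/= -zbE.
have s0 := sigma_gt0 n0 j.
case: ifPn => [_|_]; last by rewrite lee_fin mulr_ge0 ?ltW.
rewrite -EFinB lee_fin sigmaS//; move: Tj; rewrite /T_.
set s5 := Num.sqrt 5; set s2 := r2; move: s0; set s := sigma n j => s0 Tj.
nra.
Qed.

Variable J : nat.
Hypotheses (J0 : (0 < J)%N) (stopJ : mean_gap J <= z * sigma n J).

(** Continuing means T_j > z sigma_j, while z sigma_j >= z sigma_J >= [mean_gap J] >= [mean_gap j],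
    so the noise must supply the difference. *)
Lemma noise_decreasing_of_continuing y w j : y = Y w -> (J <= j)%N ->
  ~~ stops n a y j -> 0 < xi j w - xi j.+1 w.
Proof.
move=> -> Jj; have j0 : (0 < j)%N by exact: leq_trans Jj.
rewrite /stops j0/= -zE -ltNge T_observation// => h.
have g : mean_gap j <= mean_gap J by apply: mean_gap_nonincreasing; rewrite J0.
have s : sigma n J <= sigma n j.
  by rewrite sigma_nondecreasing// J0.
have : z * sigma n J <= z * sigma n j by rewrite ler_pM2l.
by move: stopJ; lra.
Qed.

(** Increments of the powers of sqrt 2, so that the length at the stopping scale becomes a sum over
    the scales survived. *)
Definition step k : R := if k is k'.+1 then r2 ^+ k - r2 ^+ k' else 1.

Lemma step_ge0 k : 0 <= step k.
Proof.
case: k => [|k] //=; rewrite subr_ge0 exprS ler_peMl ?exprn_ge0//.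
by rewrite -[leLHS]sqrtr1 ler_wsqrtr// ler1n.
Qed.

Lemma sum_step m : \sum_(0 <= k < m.+1) step k = r2 ^+ m.
Proof.
elim: m => [|m IH]; first by rewrite big_nat1.
by rewrite big_nat_recr//= IH addrC subrK.
Qed.

(** For k >= 1 the term is 1 - 1 / sqrt 2 times the k-th power of 1 / sqrt 2, a geometric series. *)
Lemma sum_step_dyadic m :
  \sum_(0 <= k < m.+1) step k * 2 ^- k = 1 + r2^-1 - r2^-1 ^+ m.+1.
Proof.
have r20 : r2 != 0 by rewrite gt_eqF// sqrtr_gt0.
elim: m => [|m IH]; first by rewrite big_nat1 /= expr0 invr1 mulr1 expr1 addrK.
rewrite big_nat_recr//= IH (_ : 2 ^- m.+1 = r2^-1 ^+ m.+1 * r2^-1 ^+ m.+1); last first.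
  by rewrite -exprMn -invfM -expr2 sqr_sqrtr// exprVn.
rewrite !exprVn; have : r2 ^+ m != 0 by rewrite expf_neq0.
by rewrite !exprS; move: (r2 ^+ m) => x x0; field; rewrite x0 r20.
Qed.

(* The first m+1 of these telescope to the bound on the length when stopping at J+m. *)
Let wstep k : R := (K + z) * sigma n J * step k.

Let wstep_ge0 k : 0 <= wstep k.
Proof. by rewrite !mulr_ge0 ?step_ge0 ?ltW ?sigma_gt0. Qed.

(** Stopping at J or before is paid for by the term k = 0. Stopping at J + m forces the noise to
    decrease m times, and the first m + 1 terms pay. If the procedure never stops, all indicators
    are 1 and the series diverges, matching the whole line. *)
Lemma length_star_le w :
  (mu (CIc_star n a (Y w)) <=
   \sum_(0 <= k <oo) (wstep k * \1_(noise_decreasing n W J k) w)%:E)%E.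
Proof.
have ge0 k : (0 <= (wstep k * (\1_(noise_decreasing n W J k) w : R))%:E)%E.
  by rewrite lee_fin mulr_ge0.
have partial m : noise_decreasing n W J m w ->
    (((K + z) * sigma n (J + m))%:E <=
     \sum_(0 <= k <oo) (wstep k * \1_(noise_decreasing n W J k) w)%:E)%E.
  move=> h; apply: le_trans (nneseries_lim_ge m.+1 _); last by move=> *; exact: ge0.
  rewrite sumEFin lee_fin sigmaD// [_ ^+ m * _]mulrC mulrA -sum_step mulr_sumr.
  rewrite !big_nat; apply: ler_sum => k km; rewrite /wstep indicE mem_set ?mulr1//.
  move=> i /andP[Ji ik]; apply: h; rewrite Ji/= (leq_trans ik)// leq_add2l -ltnS.
  by case/andP: km.
rewrite /CIc_star; case: pselect => [h|h].
  case: ex_minnP => j sj minj; have /andP[j0 Tj] := sj.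
  rewrite -zE in Tj; apply: le_trans (length_CIc j0 Tj) _.
  have [jJ|Jj] := leqP j J.
    apply: le_trans (partial 0%N _).
      by rewrite addn0 lee_fin ler_pM2l// sigma_nondecreasing// j0.
    by move=> i; rewrite addn0 => /andP[/leq_ltn_trans /[apply]]; rewrite ltnn.
  rewrite -(subnKC (ltnW Jj)); apply: partial => i /andP[Ji].
  rewrite (subnKC (ltnW Jj)) => ij; apply: (noise_decreasing_of_continuing erefl Ji).
  by apply/negP => /minj; rewrite leqNgt ij.
have all m : noise_decreasing n W J m w.
  move=> i /andP[Ji _]; apply: (noise_decreasing_of_continuing erefl Ji).
  by apply/negP => si; apply: h; exists i.
rewrite [X in (_ <= X)%E](_ : _ = +oo%E) ?leey//; apply/eqyP => A A0.
case: J J0 partial all => // J' _ partial all.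
have [k hk] := sigma_unbounded n0 (A / (K + z)) J'.
apply: le_trans (partial k (all k)).
by rewrite lee_fin mulrC -ler_pdivrMr.
Qed.

Lemma expected_length_star_le :
  (expected_length P n W f (CIc_star n a) <=
   ((K + z) * (1 + r2^-1) * sigma n J)%:E)%E.
Proof.
rewrite /expected_length.
apply: le_trans (le_ge0_integral_nonmeasurable _ (fun=> measure_ge0 _ _) length_star_le) _.
rewrite integral_nneseries//; last 2 first.
- move=> k; apply/measurable_EFinP; apply: measurable_funM => //.
  by apply: measurable_indic; exact: (measurable_noise_decreasing n0 bW).
- by move=> k w _; rewrite lee_fin mulr_ge0.
have term k : (\int[P]_w (wstep k * \1_(noise_decreasing n W J k) w)%:E <=
    (wstep k * 2 ^- k)%:E)%E.
  under eq_integral do rewrite EFinM.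
  have mk : measurable (noise_decreasing n W J k).
    exact: (measurable_noise_decreasing n0 bW).
  rewrite ge0_integralZl_EFin//; last first.
    by apply/measurable_EFinP; exact: measurable_indic.
  rewrite integral_indic// setIT [leRHS]EFinM; apply: lee_pmul; rewrite ?lee_fin//.
  exact: probability_noise_decreasing.
apply: lime_le.
  apply: is_cvg_nneseries => k _ _; apply: integral_ge0 => w _.
  by rewrite lee_fin mulr_ge0.
near=> N.
apply: le_trans (lee_sum _ (fun k _ => term k)) _.
rewrite sumEFin lee_fin.
have -> : N = N.-1.+1 by rewrite prednK//; near: N; exact: nbhs_infty_gt.
rewrite (eq_bigr (fun k => (K + z) * sigma n J * (step k * 2 ^- k))); last first.
  by move=> k _; rewrite /wstep mulrA.
rewrite -mulr_sumr sum_step_dyadic [leRHS]mulrAC ler_wpM2l//.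
  by rewrite mulr_ge0// ltW// sigma_gt0.
by rewrite lerBlDr lerDl exprn_ge0// invr_ge0.
Unshelve. all: by end_near. Qed.

End ExpectedLength.

(** * Comparison of the two bounds *)

Section RiskComparison.
Context {R : realType} (d : measure_display) (T : measurableType d).
Variables (P : probability T R) (n : R) (W : R -> T -> R).
Hypotheses (n0 : 0 < n) (bW : brownian P W).
Variable f : R -> R.
Hypothesis Ff : Fc f.
Notation obs := (@obs_interval R).
Notation mu := (@lebesgue_measure R).
Notation r2 := (Num.sqrt 2 : R).
Notation r3 := (Num.sqrt 3 : R).
Variables (a z : R).
Hypotheses (zE : gauss `]-oo, - z] = a%:E) (z0 : 0 < z).

Let fi : mu.-integrable obs (EFin \o f).
Proof. exact: Fc_integrable. Qed.

Lemma sigma_sqr j : sigma n j ^+ 2 = 2 ^+ j.-1 / n.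
Proof. by rewrite sqr_sqrtr// divr_ge0 ?exprn_ge0// ltW. Qed.

(** The constant 2 z sigma_1 has energy n (2 z sigma_1)^2 = (2 z)^2, so e = 2 z, the least value
    that the lower bound admits. *)
Lemma Lstar_ge_sigma1 : ((z * sigma n 1)%:E <= Lstar a P n W f)%E.
Proof.
have s0 := sigma_gt0 n0 1; set s := sigma n 1 in s0 *.
pose c (x : R) := 2 * z * s.
have bc : bounded_measurable obs c by exact: bounded_measurable_cst.
rewrite (_ : z * s = c 0 * z / (2 * z)); last by rewrite /c; field; rewrite gt_eqF.
apply: (Lstar_ge n0 bW zE (ltW z0) fi (obs_integrable bc)).
- exact: obs_integrable (bounded_measurableM bc bc).
- by move=> t _; exact: (Fc_add_cst (t * (2 * z * s)) Ff).
- by rewrite !mulr_gt0.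
- by rewrite mulr_gt0.
- by [].
rewrite /c Rintegral_cst; last exact: measurable_obs.
have obs1 : mu obs = 1%:E.
  rewrite lebesgue_measure_itv/= lte_fin ifT; last by lra.
  by rewrite -EFinB; congr EFin; lra.
rewrite -[X in fine X]/(mu obs) obs1.
rewrite /= mulr1 exprMn /s sigma_sqr expr0 mul1r mulrCA divff ?mulr1//.
by rewrite gt_eqF.
Qed.

Lemma Lstar_ge_sigma j : (0 < j)%N -> z * sigma n j < mean_gap f j ->
  ((r3 / 2 * z * sigma n j)%:E <= Lstar a P n W f)%E.
Proof.
move=> j0 gapj.
have h01 := @dyadic_range R _ j0.
pose c := chord_excess f (2 ^- j).
have bc : bounded_measurable obs c by exact: bounded_measurable_chord_excess.
have s0 := sigma_gt0 n0 j.
have c0 : 2 * (z * sigma n j) < c 0.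
  rewrite /c chord_excess0//; have := symmetric_average_diff_le Ff h01.
  move: gapj; rewrite /mean_gap /mean_level exprSr invfM; lra.
have zs0 : 0 < z * sigma n j by rewrite mulr_gt0.
have cp : 0 < c 0 by lra.
have r30 : 0 < r3 by rewrite sqrtr_gt0.
have r3E : r3 ^+ 2 = 3 by rewrite sqr_sqrtr.
have r3le : r3 <= 2 by move: r3E r30; set r := r3; nra.
(* Since n h = 1 / (2 sigma_j^2) for h = 2^-j, this is the square root of (8/3) n h c(0)^2. *)
pose e := 2 / r3 * (c 0 / sigma n j).
rewrite (_ : r3 / 2 * z * sigma n j = c 0 * z / e); last first.
  by rewrite /e; field; rewrite !gt_eqF.
apply: (Lstar_ge n0 bW zE (ltW z0) fi (obs_integrable bc)) => //.
- exact: obs_integrable (bounded_measurableM bc bc).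
- exact: chord_excess_Fc.
- by rewrite /e mulr_gt0// divr_gt0.
(* 2 z <= e follows from c(0) > 2 z sigma_j and sqrt 3 <= 2. *)
- rewrite /e mulrAC ler_pdivlMr// -mulrA ler_pM2l// ler_pdivlMr//.
  move: c0; set s := sigma n j in s0 *; move: (c 0) => k kz.
  have : z * r3 <= z * 2 by rewrite ler_pM2l.
  by move: s0 zs0; set y := z * s; nra.
apply: le_trans (ler_wpM2l (ltW n0) (Rintegral_chord_excess_sqr_le Ff h01)) _.
rewrite /e !exprMn !exprVn sigma_sqr r3E -/c.
rewrite le_eqVlt; apply/orP; left; apply/eqP.
case: j j0 {h01 gapj s0 c0 zs0 e} @c bc cp => // j _ c bc cp.
rewrite exprS /= invfM; have : (2 : R) ^+ j != 0 by rewrite expf_neq0.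
by move=> p0; field; rewrite p0 gt_eqF.
Qed.

End RiskComparison.

(** The condition compares (K + z) (1 + 1 / sqrt 2) sigma_J, the upper bound, with C times (sqrt 3 /
    2) z sigma_J / sqrt 2, the lower bound, cleared of denominators. *)
Lemma star_within_factor_of_quantiles (R : realType) (a C : R)
    (z := z_ a) (zb := z_ (a / 6 / 2)) : 0 < a <= 2 / 10 ->
  ((Num.sqrt 5 + Num.sqrt 2) * zb + z) * (1 + Num.sqrt 2) * 2 <=
    C * (Num.sqrt 3 * z) ->
  star_within_factor a C.
Proof.
move=> a01 HC n n0 d T P W bW f Ff.
have z0 : 0 < z by apply: z_gt0; lra.
have zb0 : 0 < zb by apply: z_gt0; lra.
have zE : gauss `]-oo, - z] = a%:E by apply: gauss_lt_z; lra.
pose stop j := (0 < j)%N && (mean_gap f j <= z * sigma n j).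
have exJ : exists j, stop j.
  have [k hk] := sigma_unbounded n0 (mean_gap f 1 / z) 0.
  exists (1 + k)%N; rewrite /stop /=.
  apply: le_trans (@mean_gap_nonincreasing _ _ Ff 1 (1 + k)%N isT) _.
  by rewrite mulrC -ler_pdivrMr.
case: (ex_minnP exJ) => J /andP[J0 stopJ] minJ.
have := expected_length_star_le n0 bW Ff erefl erefl z0 zb0 J0 stopJ.
move=> /le_trans; apply.
set K := _ * _ + z.
have [r20 r30] : 0 < Num.sqrt 2 :> R /\ 0 < Num.sqrt 3 :> R by rewrite !sqrtr_gt0.
have r2E : Num.sqrt 2 ^+ 2 = 2 :> R by rewrite sqr_sqrtr.
have r3E : Num.sqrt 3 ^+ 2 = 3 :> R by rewrite sqr_sqrtr.
have s0 := sigma_gt0 n0 J.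
(* sigma_J / sqrt 2 is the value at scale J - 1. For J = 1 no earlier scale exists, and the bound z
   sigma_1 is stronger. *)
have L : ((Num.sqrt 3 / 2 * z * (sigma n J / Num.sqrt 2))%:E <= Lstar a P n W f)%E.
  case: J J0 stopJ minJ s0 => // -[|j] J0 stopJ minJ s0.
    apply: le_trans (Lstar_ge_sigma1 n0 bW Ff zE z0); rewrite lee_fin.
    rewrite [leLHS](_ : _ = z * sigma n 1 * (Num.sqrt 3 / 2 / Num.sqrt 2)); last by ring.
    apply: ler_piMr; first by rewrite mulr_ge0 ?ltW.
    move: r20 r30 r2E r3E; set x := Num.sqrt 2; set y := Num.sqrt 3 => *.
    by rewrite ler_pdivrMr// mul1r; nra.
  rewrite sigmaS// [_ * sigma n j.+1]mulrC mulfK ?gt_eqF//.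
  apply: Lstar_ge_sigma => //.
  rewrite ltNge; apply/negP => h.
  by have /minJ : stop j.+1 by []; rewrite ltnn.
have K0 : 0 <= K.
  by rewrite addr_ge0 ?mulr_ge0 ?addr_ge0 ?sqrtr_ge0 ?ltW.
have C0 : 0 <= C.
  have : 0 <= C * (Num.sqrt 3 * z).
    by apply: le_trans HC; rewrite -/K !mulr_ge0// addr_ge0// sqrtr_ge0.
  by rewrite pmulr_lge0// mulr_gt0.
apply: le_trans (lee_wpmul2l _ L); last by rewrite lee_fin.
rewrite -EFinM lee_fin.
rewrite [leRHS](_ : _ = C * (Num.sqrt 3 * z) * (sigma n J / (2 * Num.sqrt 2))); last first.
  by field; rewrite gt_eqF.
apply: le_trans (ler_wpM2r _ HC); last by rewrite divr_ge0 ?mulr_ge0 ?ltW.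
rewrite -/K le_eqVlt; apply/orP; left; apply/eqP.
by field; rewrite gt_eqF.
Qed.

Theorem mainTheorem7 (R : realType) :
  (forall a : R, 0 < a -> a <= 2 / 10 ->
     exists c2 : R, star_within_factor a c2)
  /\ star_within_factor (5 / 100 : R) 24
  /\ star_within_factor (1 / 100 : R) 19.
Proof.
split=> [a a0 a1|].
  have z0 : 0 < z_ a by apply: z_gt0; lra.
  pose D := ((Num.sqrt 5 + Num.sqrt 2) * z_ (a / 6 / 2) + z_ a) * (1 + Num.sqrt 2) * 2.
  exists (D / (Num.sqrt 3 * z_ a)); apply: star_within_factor_of_quantiles.
    by rewrite a0.
  by rewrite divfK// gt_eqF// mulr_gt0// sqrtr_gt0.
have r2E : Num.sqrt 2 ^+ 2 = 2 :> R by rewrite sqr_sqrtr.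
have r3E : Num.sqrt 3 ^+ 2 = 3 :> R by rewrite sqr_sqrtr.
have r5E : Num.sqrt 5 ^+ 2 = 5 :> R by rewrite sqr_sqrtr.
have r20 : 0 <= Num.sqrt 2 :> R by rewrite sqrtr_ge0.
have r30 : 0 <= Num.sqrt 3 :> R by rewrite sqrtr_ge0.
have r50 : 0 <= Num.sqrt 5 :> R by rewrite sqrtr_ge0.
(* The fractions here and below are continued-fraction convergents, above sqrt 2 and sqrt 5 and
   below sqrt 3. *)
have r2le : Num.sqrt 2 <= 99 / 70 :> R.
  by move: r2E r20; move: (Num.sqrt 2 : R) => x; nra.
have r3ge : 71 / 41 <= Num.sqrt 3 :> R.
  by move: r3E r30; move: (Num.sqrt 3 : R) => x; nra.
have r5le : Num.sqrt 5 <= 161 / 72 :> R.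
  by move: r5E r50; move: (Num.sqrt 5 : R) => x; nra.
(* Checking at the lower bound l of z suffices: for C > 3 the coefficient (71/41) C of z on the
   right exceeds 169/35 on the left. *)
have bound (z zb l u C : R) : 0 < l < z -> 0 < zb < u -> 3 < C ->
    ((161 / 72 + 99 / 70) * u + l) * (169 / 70) * 2 <= C * (71 / 41 * l) ->
    ((Num.sqrt 5 + Num.sqrt 2) * zb + z) * (1 + Num.sqrt 2) * 2 <=
      C * (Num.sqrt 3 * z).
  move=> lz zbu hC num.
  have h1 : (Num.sqrt 5 + Num.sqrt 2) * zb <= (161 / 72 + 99 / 70) * u.
    by apply: ler_pM; lra.
  apply: (@le_trans _ _ (((161 / 72 + 99 / 70) * u + z) * (169 / 70) * 2)).
    rewrite ler_pM2r//; apply: ler_pM; [|lra|lra|lra].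
    by apply: addr_ge0; [apply: mulr_ge0|]; lra.
  apply: (@le_trans _ _ (C * (71 / 41 * z))).
    have : (71 / 41 * C - 169 / 70 * 2) * l <= (71 / 41 * C - 169 / 70 * 2) * z.
      by apply: ler_wpM2l; lra.
    lra.
  by apply: ler_wpM2l; [lra|apply: ler_wpM2r; lra].
split; apply: star_within_factor_of_quantiles; [lra| |lra|].
  (* The two sides are about 56.1 and 58.2 here, and 68.3 and 69.1 at level 0.01. *)
  apply: (bound _ _ (14 / 10) (28 / 10)); [| |lra|lra].
  - by rewrite z_05_gt andbT; lra.
  - by rewrite z_05_12_lt andbT; apply: z_gt0; lra.
apply: (bound _ _ (21 / 10) (33 / 10)); [| |lra|lra].
- by rewrite z_01_gt andbT; lra.
- by rewrite z_01_12_lt andbT; apply: z_gt0; lra.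
Qed.
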